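(* The unique entire $C^2$ area-stationary graphs over the $xy$-plane in $\mathbb{H}^1$ are Euclidean planes and vertical rotations of graphs of the form $$t=xy+(ay+b),$$ where $a$ and $b$ are real constants. That is, the graph $\{t=u(x,y)\}$ of a function $u\in C^2(\mathbb{R}^2)$ is area-stationary if and only if it is a (non-vertical) Euclidean plane or the image of a graph $t=xy+(ay+b)$, for some $a,b\in\mathbb{R}$, under a Euclidean rotation about the $t$-axis.
   Context: $\mathbb{H}^1$ is the Heisenberg group: $\mathbb{R}^3$ with coordinates $(x,y,t)$ and product $[z,t]*[z',t']=[z+z',t+t'+\operatorname{Im}(z\overline{z'})]$, $z=x+iy$. Put $X=\partial_x+y\,\partial_t$, $Y=\partial_y-x\,\partial_t$, $T=\partial_t$. The horizontal distribution is spanned by $X,Y$; $U_H$ is the orthogonal projection of $U$ onto it. $g=\langle\cdot,\cdot\rangle$ is the Riemannian metric making $\{X,Y,T\}$ orthonormal. For an immersed surface $\Sigma$ with unit normal $N$ (with respect to $g$), the area is $A(\Sigma)=\int_\Sigma|N_H|\,d\Sigma$, with $d\Sigma$ the Riemannian area element. For a $C^1$ vector field $U$ with compact support on $\Sigma$, the induced variation is $\Sigma_s=\{\exp_p(sU_p):p\in\Sigma\}$, $s$ small ($\exp$ the exponential map of $g$). $\Sigma$ is area-stationary if $\frac{d}{ds}|_{s=0}A(\Sigma_s)=0$ for every such variation (for non-compact $\Sigma$ the area is computed on a compact piece containing the support of $U$). An entire graph over the $xy$-plane is a graph $t=u(x,y)$ defined over the whole plane. *)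

(* Defs.v *)
From Stdlib Require Import Reals ClassicalEpsilon.
From Coquelicot Require Import Coquelicot.
Open Scope R_scope.

(* Points of the Heisenberg group H^1, in the coordinates (x, y, t).  Tangent
   vectors are also elements of [H1]: their components with respect to the
   coordinate basis d/dx, d/dy, d/dt. *)
Definition H1 : Type := (R * R * R)%type.
Definition cx (p : H1) : R := fst (fst p).
Definition cy (p : H1) : R := snd (fst p).
Definition ct (p : H1) : R := snd p.

Definition vadd (v w : H1) : H1 := (cx v + cx w, cy v + cy w, ct v + ct w).
Definition vscal (a : R) (v : H1) : H1 := (a * cx v, a * cy v, a * ct v).

Definition X (p : H1) : H1 := (1, 0, cy p).
Definition Y (p : H1) : H1 := (0, 1, - cx p).
Definition T (p : H1) : H1 := (0, 0, 1).

(* Coefficients in the frame X, Y, T: at p one has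
   v = frX p v X + frY p v Y + frT p v T. *)
Definition frX (p v : H1) : R := cx v.
Definition frY (p v : H1) : R := cy v.
Definition frT (p v : H1) : R := ct v - cy p * cx v + cx p * cy v.

Definition metric (p v w : H1) : R :=
  frX p v * frX p w + frY p v * frY p w + frT p v * frT p w.

Definition gnorm (p v : H1) : R := sqrt (metric p v v).

Definition horizontal (p v : H1) : H1 :=
  vadd (vscal (metric p v (X p)) (X p)) (vscal (metric p v (Y p)) (Y p)).

(* Derivative at p, in the direction u, of the function q |-> g_q(v, w), where
   v and w have constant coordinates. *)
Definition dmetric (u p v w : H1) : R :=
  Derive (fun s => metric (vadd p (vscal s u)) v w) 0.

(* Christoffel symbols of the first kind, as a trilinear form: by Koszul's
   formula this is g(D_u v, w) for u, v, w with constant coordinates, D being the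
   Levi-Civita connection of g. *)
Definition christoffel (p u v w : H1) : R :=
  / 2 * (dmetric u p v w + dmetric v p u w - dmetric w p u v).

Definition is_derive_curve (c : R -> H1) (s : R) (v : H1) : Prop :=
  is_derive (fun r => cx (c r)) s (cx v) /\
  is_derive (fun r => cy (c r)) s (cy v) /\
  is_derive (fun r => ct (c r)) s (ct v).

(* The equation D_{c'} c' = 0, paired with an arbitrary vector w; v and a are
   the first and second coordinate derivatives of c. *)
Definition is_geodesic (c : R -> H1) : Prop :=
  exists v a : R -> H1,
    (forall s, is_derive_curve c s (v s)) /\
    (forall s, is_derive_curve v s (a s)) /\
    (forall s w, metric (c s) (a s) w + christoffel (c s) (v s) (v s) w = 0).

Definition is_exp (p v q : H1) : Prop :=
  exists c : R -> H1,
    is_geodesic c /\ c 0 = p /\ is_derive_curve c 0 v /\ c 1 = q.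

(* The metric g is left-invariant, hence complete, so that for all p and v
   there is exactly one q with [is_exp p v q]. *)
Definition exp_map (p v : H1) : H1 := epsilon (inhabits p) (is_exp p v).

Definition dx (f : R -> R -> R) (x y : R) : R := Derive (fun z => f z y) x.
Definition dy (f : R -> R -> R) (x y : R) : R := Derive (fun z => f x z) y.

Definition C1 (f : R -> R -> R) : Prop :=
  forall x y,
    ex_derive (fun z => f z y) x /\ ex_derive (fun z => f x z) y /\
    continuity_2d_pt (dx f) x y /\ continuity_2d_pt (dy f) x y.

Definition C2 (f : R -> R -> R) : Prop := C1 f /\ C1 (dx f) /\ C1 (dy f).

(* Surfaces are given by a global parametrization phi : R^2 -> H^1, and vector
   fields along them by maps U : R^2 -> H1, U x y being based at phi x y. *)
Definition tangent_x (phi : R -> R -> H1) (x y : R) : H1 :=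
  (dx (fun a b => cx (phi a b)) x y,
   dx (fun a b => cy (phi a b)) x y,
   dx (fun a b => ct (phi a b)) x y).
Definition tangent_y (phi : R -> R -> H1) (x y : R) : H1 :=
  (dy (fun a b => cx (phi a b)) x y,
   dy (fun a b => cy (phi a b)) x y,
   dy (fun a b => ct (phi a b)) x y).

(* Vector product for g, in the positively oriented orthonormal frame X, Y, T. *)
Definition cross (p v w : H1) : H1 :=
  vadd (vscal (frY p v * frT p w - frT p v * frY p w) (X p))
 (vadd (vscal (frT p v * frX p w - frX p v * frT p w) (Y p))
       (vscal (frX p v * frY p w - frY p v * frX p w) (T p))).

Definition unit_normal (phi : R -> R -> H1) (x y : R) : H1 :=
  let n := cross (phi x y) (tangent_x phi x y) (tangent_y phi x y) in
  vscal (/ gnorm (phi x y) n) n.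

Definition area_element (phi : R -> R -> H1) (x y : R) : R :=
  let p := phi x y in
  let v := tangent_x phi x y in
  let w := tangent_y phi x y in
  sqrt (metric p v v * metric p w w - metric p v w ^ 2).

(* Area of the compact piece phi ([a, b] x [c, d]). *)
Definition area (phi : R -> R -> H1) (a b c d : R) : R :=
  RInt (fun x =>
    RInt (fun y =>
      gnorm (phi x y) (horizontal (phi x y) (unit_normal phi x y))
      * area_element phi x y) c d) a b.

Definition variation (phi U : R -> R -> H1) (s : R) (x y : R) : H1 :=
  exp_map (phi x y) (vscal s (U x y)).

Definition C1_field (U : R -> R -> H1) : Prop :=
  C1 (fun x y => cx (U x y)) /\
  C1 (fun x y => cy (U x y)) /\
  C1 (fun x y => ct (U x y)).

Definition supported_in (U : R -> R -> H1) (a b c d : R) : Prop :=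
  forall x y, ~ (a <= x <= b /\ c <= y <= d) -> U x y = (0, 0, 0).

(* Here the derivative of the area is required to exist and to be zero. *)
Definition area_stationary (phi : R -> R -> H1) : Prop :=
  forall (U : R -> R -> H1) (a b c d : R),
    C1_field U -> a < b -> c < d -> supported_in U a b c d ->
    is_derive (fun s => area (variation phi U s) a b c d) 0 0.

Definition graph_param (u : R -> R -> R) (x y : R) : H1 := (x, y, u x y).

Definition graph (u : R -> R -> R) (p : H1) : Prop := ct p = u (cx p) (cy p).

Definition nonvertical_plane (S : H1 -> Prop) : Prop :=
  exists al be ga de : R, ga <> 0 /\
    forall p, S p <-> al * cx p + be * cy p + ga * ct p = de.

Definition rotation (th : R) (p : H1) : H1 :=
  (cos th * cx p - sin th * cy p, sin th * cx p + cos th * cy p, ct p).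

Definition image (f : H1 -> H1) (S : H1 -> Prop) (p : H1) : Prop :=
  exists q, S q /\ f q = p.

(* Main.v *)
(** Write V = (u_x - y, u_y + x) for the horizontal normal of the graph, so that its area is
    the integral of |V| and curl V = 2, and let J be the rotation by a right angle.

    Necessity.  Vertical variations, tested against the calibrations V / sqrt (|V|^2 + sg^2),
    give <JV, DV JV> = 0.  Off the zeros of V the direction of V is then constant along the
    lines tangent to JV.  Comparing neighbouring lines gives |V| explicitly along each line:
    in the direction - JV the line never meets a zero of V, in the direction JV it meets one
    transversally.  The blow-up of the equation at a zero shows that either DV = J there, and
    then V is radial around it and u is affine, or DV has rank one, and then the line
    continues through the zero; such lines cannot cross, so V is everywhere orthogonal to
    one fixed vector n.  In that case V = f Jn with derivative 2 for f along n.  On the curve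
    f = 0 the unit field V / |V| jumps, and its distributional divergence is concentrated
    there with a density proportional to the derivative of f along Jn; stationarity makes
    it vanish, so f is affine.

    Sufficiency.  In both families V / sqrt (|V|^2 + sg^2) is divergence free for every sg.
    The Riemannian exponential map is explicit, and the first variation of |V| is the
    divergence of a field with compact support up to an error that is negligible because V
    vanishes at most linearly along a line. *)

Require Import Defs.
From Stdlib Require Import Reals.
From Coquelicot Require Import Coquelicot.
From Stdlib Require Import Lra Psatz Classical ClassicalEpsilon FunctionalExtensionality.
Open Scope R_scope.

(** * Functions of two variables *)

(** The obstacle throughout is the zero set of V: |V| is not differentiable there and V / |V| is
    undefined. Replacing |V| by sqrt (|V|^2 + sg^2) turns both directions into exact integrations by
    parts. For necessity a one-sided convexity estimate suffices, with error [sg] per unit of area,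
    and [sg] is chosen small after the variation parameter s; for sufficiency the regularization is
    tied to it, sg = |s|. The equation is kept multiplied by |V|^3, a polynomial in V and DV that
    makes sense at the zeros.

    Since V is only C^1, its equation cannot be differentiated. Each line is therefore parametrized
    by the fixed vector JV(p) at its starting point p; constancy of direction comes from a linear
    differential equation along it, and the comparison of neighbours from one derivative in p. The
    value curl V = 2 makes the profile explicit: with d = |V(p)|^2 and m = <JV, DV V>(p), the
    product (d - t m) <V(p + t JV(p)), V(p)> equals d^2 - 2 d^2 t + d m t^2, whose value - d (d - m)
    at t = 1 forces a zero by then. *)

Definition cont2 (f : R -> R -> R) : Prop := forall x y, continuity_2d_pt f x y.

Lemma cont2_const c : cont2 (fun _ _ => c).
Proof. intros x y; apply continuity_2d_pt_const. Qed.

Lemma cont2_fst : cont2 (fun x _ => x).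
Proof. intros x y; apply continuity_2d_pt_id1. Qed.

Lemma cont2_snd : cont2 (fun _ y => y).
Proof. intros x y; apply continuity_2d_pt_id2. Qed.

Lemma cont2_plus f g : cont2 f -> cont2 g -> cont2 (fun x y => f x y + g x y).
Proof. intros hf hg x y; apply continuity_2d_pt_plus; auto. Qed.

Lemma cont2_minus f g : cont2 f -> cont2 g -> cont2 (fun x y => f x y - g x y).
Proof. intros hf hg x y; apply continuity_2d_pt_minus; auto. Qed.

Lemma cont2_opp f : cont2 f -> cont2 (fun x y => - f x y).
Proof. intros hf x y; apply continuity_2d_pt_opp; auto. Qed.

Lemma cont2_mult f g : cont2 f -> cont2 g -> cont2 (fun x y => f x y * g x y).
Proof. intros hf hg x y; apply continuity_2d_pt_mult; auto. Qed.

Lemma cont2_comp h f :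
  (forall t, continuity_pt h t) -> cont2 f -> cont2 (fun x y => h (f x y)).
Proof. intros hh hf x y; apply continuity_1d_2d_pt_comp; auto. Qed.

Lemma cont2_pow f n : cont2 f -> cont2 (fun x y => f x y ^ n).
Proof.
  intros hf; apply (cont2_comp (fun t => t ^ n)); trivial.
  intros t; apply derivable_continuous_pt, derivable_pt_pow.
Qed.

Lemma cont2_inv f : cont2 f -> (forall x y, f x y <> 0) -> cont2 (fun x y => / f x y).
Proof. intros hf h x y; apply continuity_2d_pt_inv; auto. Qed.

Lemma cont2_div f g :
  cont2 f -> cont2 g -> (forall x y, g x y <> 0) -> cont2 (fun x y => f x y / g x y).
Proof. intros; apply cont2_mult; trivial; apply cont2_inv; trivial. Qed.

Lemma cont2_abs f : cont2 f -> cont2 (fun x y => Rabs (f x y)).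
Proof. apply cont2_comp, Rcontinuity_abs. Qed.

Lemma cont2_sqrt f : (forall x y, 0 <= f x y) -> cont2 f -> cont2 (fun x y => sqrt (f x y)).
Proof.
  intros h hf x y; apply continuity_1d_2d_pt_comp; auto.
  apply continuity_pt_sqrt, h.
Qed.

Lemma cont2_ext f g : (forall x y, f x y = g x y) -> cont2 f -> cont2 g.
Proof. intros e hf x y; apply (continuity_2d_pt_ext f); auto. Qed.

Ltac cont2_tac :=
  repeat first
    [ assumption
    | apply cont2_const | apply cont2_fst | apply cont2_snd
    | apply cont2_plus | apply cont2_minus | apply cont2_opp
    | apply cont2_pow | apply cont2_mult | apply cont2_abs ].

Lemma cont2_swap f : cont2 f -> cont2 (fun x y => f y x).
Proof.
  intros hf x y eps; destruct (hf y x eps) as [d hd]; exists d.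
  intros u v hu hv; apply hd; trivial.
Qed.

Lemma cont2_line f (a b : R -> R) t :
  cont2 f -> continuity_pt a t -> continuity_pt b t ->
  continuity_pt (fun t => f (a t) (b t)) t.
Proof.
  intros hf ha hb.
  apply continuity_pt_filterlim.
  apply (filterlim_comp_2 (G := locally (a t)) (H := locally (b t))
           _ _ (fun x y => f x y)).
  - apply continuity_pt_filterlim in ha; exact ha.
  - apply continuity_pt_filterlim in hb; exact hb.
  - pose proof (proj1 (continuity_2d_pt_filterlim f (a t) (b t)) (hf _ _)) as h.
    intros P HP. specialize (h P HP).
    destruct h as [d hd].
    exists (ball (a t) d) (ball (b t) d); try (apply locally_ball).
    intros x y hx hy; apply (hd (x, y)); split; assumption.
Qed.

Lemma cont2_snd_cont f x y : cont2 f -> continuous (fun y => f x y) y.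
Proof.
  intros hf; apply continuity_pt_filterlim.
  apply (cont2_line f (fun _ => x) (fun y => y)); trivial; reg.
Qed.

Lemma cont2_fst_cont f x y : cont2 f -> continuous (fun x => f x y) x.
Proof.
  intros hf; apply continuity_pt_filterlim.
  apply (cont2_line f (fun x => x) (fun _ => y)); trivial; reg.
Qed.

Lemma cpt_const c t : continuity_pt (fun _ => c) t.
Proof. reg. Qed.

Lemma cpt_id t : continuity_pt (fun t => t) t.
Proof. reg. Qed.

Lemma cpt_plus f g t :
  continuity_pt f t -> continuity_pt g t -> continuity_pt (fun t => f t + g t) t.
Proof. apply continuity_pt_plus. Qed.

Lemma cpt_minus f g t :
  continuity_pt f t -> continuity_pt g t -> continuity_pt (fun t => f t - g t) t.
Proof. apply continuity_pt_minus. Qed.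

Lemma cpt_opp f t : continuity_pt f t -> continuity_pt (fun t => - f t) t.
Proof. apply continuity_pt_opp. Qed.

Lemma cpt_mult f g t :
  continuity_pt f t -> continuity_pt g t -> continuity_pt (fun t => f t * g t) t.
Proof. apply continuity_pt_mult. Qed.

Lemma cpt_pow f n t : continuity_pt f t -> continuity_pt (fun t => f t ^ n) t.
Proof.
  intros h; apply (continuity_pt_comp f (fun z => z ^ n)); trivial.
  apply derivable_continuous_pt, derivable_pt_pow.
Qed.

Ltac cpt_tac :=
  repeat first
    [ assumption | apply cpt_const | apply cpt_id | apply cpt_plus | apply cpt_minus
    | apply cpt_opp | apply cpt_pow | apply cpt_mult ].

(** The partial derivatives are explicit functions rather than values of [Derive]: closed formulas
    then propagate through sums, products and compositions, and [dx], [dy] reappear only at the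
    interface with [C1]. *)
Definition has_grad (f fx fy : R -> R -> R) : Prop :=
  (forall x y, is_derive (fun z => f z y) x (fx x y)) /\
  (forall x y, is_derive (fun z => f x z) y (fy x y)) /\
  cont2 fx /\ cont2 fy.

Lemma C1_has_grad {f} : Defs.C1 f -> has_grad f (dx f) (dy f).
Proof.
  intros h; split; [|split; [|split]]; intros x y.
  - apply (Derive_correct (fun z => f z y)), (proj1 (h x y)).
  - apply (Derive_correct (fun z => f x z)), (proj1 (proj2 (h x y))).
  - exact (proj1 (proj2 (proj2 (h x y)))).
  - exact (proj2 (proj2 (proj2 (h x y)))).
Qed.

Lemma has_grad_dx {f fx fy} x y : has_grad f fx fy -> dx f x y = fx x y.
Proof. intros h; apply is_derive_unique, h. Qed.

Lemma has_grad_dy {f fx fy} x y : has_grad f fx fy -> dy f x y = fy x y.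
Proof. intros h; apply is_derive_unique, h. Qed.

Lemma has_grad_C1 {f fx fy} : has_grad f fx fy -> Defs.C1 f.
Proof.
  intros h x y; repeat split.
  - exists (fx x y); apply h.
  - exists (fy x y); apply h.
  - apply (cont2_ext fx); [ | apply h]; intros; symmetry; eapply has_grad_dx, h.
  - apply (cont2_ext fy); [ | apply h]; intros; symmetry; eapply has_grad_dy, h.
Qed.

Lemma has_grad_diff f fx fy x y :
  has_grad f fx fy -> differentiable_pt_lim f x y (fx x y) (fy x y).
Proof.
  intros h.
  apply filterdiff_differentiable_pt_lim.
  apply (is_derive_filterdiff f x y fx (fy x y)).
  - exists (mkposreal 1 Rlt_0_1); intros [u v] _; apply h.
  - apply h.
  - apply (proj1 (continuity_2d_pt_filterlim fx x y)); apply h.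
Qed.

Lemma has_grad_cont {f fx fy} : has_grad f fx fy -> cont2 f.
Proof.
  intros h x y; apply differentiable_continuity_pt.
  exists (fx x y), (fy x y); apply has_grad_diff, h.
Qed.

Lemma has_grad_chain f fx fy (a b : R -> R) t da db :
  has_grad f fx fy -> is_derive a t da -> is_derive b t db ->
  is_derive (fun t => f (a t) (b t)) t (fx (a t) (b t) * da + fy (a t) (b t) * db).
Proof.
  intros h ha hb; apply is_derive_Reals.
  apply derivable_pt_lim_comp_2d; try (apply is_derive_Reals; assumption).
  apply has_grad_diff, h.
Qed.

Lemma has_grad_ext {f fx fy g gx gy} :
  (forall x y, f x y = g x y) -> (forall x y, fx x y = gx x y) ->
  (forall x y, fy x y = gy x y) -> has_grad f fx fy -> has_grad g gx gy.
Proof.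
  intros e ex ey (h1 & h2 & h3 & h4); split; [|split; [|split]].
  - intros x y; rewrite <- ex; apply (is_derive_ext (fun z => f z y)); auto.
  - intros x y; rewrite <- ey; apply (is_derive_ext (fun z => f x z)); auto.
  - apply (cont2_ext fx); auto.
  - apply (cont2_ext fy); auto.
Qed.

Lemma has_grad_const c : has_grad (fun _ _ => c) (fun _ _ => 0) (fun _ _ => 0).
Proof.
  split; [|split; [|split]]; try apply cont2_const; intros; apply (is_derive_const c).
Qed.

Lemma has_grad_fst : has_grad (fun x _ => x) (fun _ _ => 1) (fun _ _ => 0).
Proof.
  split; [|split; [|split]]; try apply cont2_const; intros.
  - apply (is_derive_id x).
  - apply (is_derive_const x).
Qed.

Lemma has_grad_snd : has_grad (fun _ y => y) (fun _ _ => 0) (fun _ _ => 1).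
Proof.
  split; [|split; [|split]]; try apply cont2_const; intros.
  - apply (is_derive_const y).
  - apply (is_derive_id y).
Qed.

Lemma has_grad_plus {f fx fy g gx gy} :
  has_grad f fx fy -> has_grad g gx gy ->
  has_grad (fun x y => f x y + g x y) (fun x y => fx x y + gx x y)
    (fun x y => fy x y + gy x y).
Proof.
  intros (h1 & h2 & h3 & h4) (k1 & k2 & k3 & k4); split; [|split; [|split]].
  - intros x y; apply @is_derive_plus; auto.
  - intros x y; apply @is_derive_plus; auto.
  - cont2_tac.
  - cont2_tac.
Qed.

Lemma has_grad_mult {f fx fy g gx gy} :
  has_grad f fx fy -> has_grad g gx gy ->
  has_grad (fun x y => f x y * g x y) (fun x y => fx x y * g x y + f x y * gx x y)
    (fun x y => fy x y * g x y + f x y * gy x y).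
Proof.
  intros hf hg.
  pose proof (has_grad_cont hf); pose proof (has_grad_cont hg).
  destruct hf as (h1 & h2 & h3 & h4); destruct hg as (k1 & k2 & k3 & k4).
  split; [|split; [|split]]; try cont2_tac; intros x y.
  - apply is_derive_Reals, (derivable_pt_lim_mult (fun z => f z y) (fun z => g z y));
      apply is_derive_Reals; auto.
  - apply is_derive_Reals, (derivable_pt_lim_mult (fun z => f x z) (fun z => g x z));
      apply is_derive_Reals; auto.
Qed.

Lemma has_grad_comp (h dh : R -> R) f fx fy :
  (forall x y, is_derive h (f x y) (dh (f x y))) ->
  cont2 (fun x y => dh (f x y)) ->
  has_grad f fx fy ->
  has_grad (fun x y => h (f x y)) (fun x y => dh (f x y) * fx x y)
    (fun x y => dh (f x y) * fy x y).
Proof.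
  intros hh hc (h1 & h2 & h3 & h4).
  split; [|split; [|split]]; try cont2_tac; intros x y; rewrite Rmult_comm.
  - apply (is_derive_comp h (fun z => f z y)); auto.
  - apply (is_derive_comp h (fun z => f x z)); auto.
Qed.

Lemma has_grad_swap {f fx fy} :
  has_grad f fx fy -> has_grad (fun x y => f y x) (fun x y => fy y x) (fun x y => fx y x).
Proof.
  intros (h1 & h2 & h3 & h4); split; [|split; [|split]]; auto using cont2_swap.
Qed.

Lemma has_grad_opp {f fx fy} :
  has_grad f fx fy ->
  has_grad (fun x y => - f x y) (fun x y => - fx x y) (fun x y => - fy x y).
Proof.
  intros h; generalize (has_grad_mult (has_grad_const (-1)) h).
  apply has_grad_ext; intros; ring.
Qed.

Lemma has_grad_minus {f fx fy g gx gy} :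
  has_grad f fx fy -> has_grad g gx gy ->
  has_grad (fun x y => f x y - g x y) (fun x y => fx x y - gx x y)
    (fun x y => fy x y - gy x y).
Proof. intros hf hg; apply has_grad_plus; trivial; apply has_grad_opp; trivial. Qed.

Lemma has_grad_scal c {f fx fy} :
  has_grad f fx fy ->
  has_grad (fun x y => c * f x y) (fun x y => c * fx x y) (fun x y => c * fy x y).
Proof.
  intros h; generalize (has_grad_mult (has_grad_const c) h).
  apply has_grad_ext; intros; ring.
Qed.

Lemma Schwarz_C2 u x y : C2 u -> dy (dx u) x y = dx (dy u) x y.
Proof.
  intros (h0 & h1 & h2); symmetry.
  apply (Schwarz u x y).
  - exists (mkposreal 1 Rlt_0_1); intros a b _ _; split; [|split; [|split]].
    + exact (proj1 (h0 a b)).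
    + exact (proj1 (proj2 (h0 a b))).
    + exact (proj1 (h2 a b)).
    + exact (proj1 (proj2 (h1 a b))).
  - exact (proj1 (proj2 (proj2 (h2 x y)))).
  - exact (proj2 (proj2 (proj2 (h1 x y)))).
Qed.

Lemma has_grad_zero_const {f fx fy} :
  has_grad f fx fy -> (forall x y, fx x y = 0) -> (forall x y, fy x y = 0) ->
  forall x y, f x y = f 0 0.
Proof.
  intros h hx hy x y.
  destruct (MVT_gen (fun t => f (t * x) (t * y)) 0 1 (fun _ => 0)) as (c & _ & e).
  - intros t _.
    evar_last.
    + apply (has_grad_chain f fx fy (fun t => t * x) (fun t => t * y)); trivial;
        auto_derive; trivial.
    + rewrite hx, hy; ring.
  - intros t _; apply (cont2_line f (fun t => t * x) (fun t => t * y));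
      [eapply has_grad_cont, h | reg | reg].
  - rewrite !Rmult_0_l, !Rmult_1_l in e; lra.
Qed.

Lemma cont2_comp2 f a b :
  cont2 f -> cont2 a -> cont2 b -> cont2 (fun x y => f (a x y) (b x y)).
Proof.
  intros hf ha hb x y; apply continuity_2d_pt_filterlim.
  pose proof (proj1 (continuity_2d_pt_filterlim a x y) (ha _ _)) as ha'.
  pose proof (proj1 (continuity_2d_pt_filterlim b x y) (hb _ _)) as hb'.
  refine (filterlim_comp_2 (G := locally (a x y)) (H := locally (b x y))
           _ _ (fun x y => f x y) ha' hb' _).
  intros S HS.
  destruct (proj1 (continuity_2d_pt_filterlim f (a x y) (b x y)) (hf _ _) S HS) as [d hd].
  exists (ball (a x y) d) (ball (b x y) d); try apply locally_ball.
  intros u v hu hv; apply (hd (u, v)); split; assumption.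
Qed.

(** * Passage to the limit, first zeros and linear differential equations *)

Lemma continuity_pt_limit_ge f c :
  continuity_pt f c ->
  (forall e, 0 < e -> exists t, Rabs (t - c) < e /\ 0 <= f t) -> 0 <= f c.
Proof.
  intros hf h; destruct (Rle_dec 0 (f c)) as [|hn]; trivial; exfalso.
  assert (hp : 0 < - f c) by lra.
  destruct (hf _ hp) as (del & hdel & hd).
  destruct (h del hdel) as (t & ht & hft).
  destruct (Req_dec t c) as [->|hne]; [lra|].
  assert (hb : Rabs (f t - f c) < - f c).
  { apply (hd t); split; [split; [exact I|auto]|exact ht]. }
  apply Rabs_lt_between in hb; lra.
Qed.

Lemma continuity_pt_limit_eq f c :
  continuity_pt f c ->
  (forall e, 0 < e -> exists t, Rabs (t - c) < e /\ f t = 0) -> f c = 0.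
Proof.
  intros hf h; apply Rle_antisym.
  - apply Ropp_le_cancel; rewrite Ropp_0.
    apply (continuity_pt_limit_ge (fun t => - f t)); [reg|].
    intros e he; destruct (h e he) as (t & ht & e0); exists t; split; trivial; lra.
  - apply (continuity_pt_limit_ge f); trivial.
    intros e he; destruct (h e he) as (t & ht & e0); exists t; split; trivial; lra.
Qed.

Lemma first_zero G T :
  (forall t, continuity_pt G t) -> 0 < G 0 -> 0 <= T ->
  ~ (forall t, 0 <= t <= T -> 0 < G t) ->
  exists T1, 0 < T1 <= T /\ G T1 = 0 /\ (forall t, 0 <= t < T1 -> 0 < G t).
Proof.
  intros hc h0 hT hn.
  (* [E] collects the times up to which [G] stays positive. Its supremum is the first zero, because
     positivity is an open condition. *)
  set (E := fun s => 0 <= s <= T /\ forall t, 0 <= t <= s -> 0 < G t).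
  destruct (completeness E) as (s & hub & hlub).
  - exists T; intros s hs; apply hs.
  - exists 0; split; [lra|]; intros t ht; replace t with 0 by lra; trivial.
  - assert (hs : 0 <= s <= T).
    { split.
      - apply hub; split; [lra|]; intros t ht; replace t with 0 by lra; trivial.
      - apply hlub; intros x hx; apply hx. }
    assert (hlt : forall t, 0 <= t < s -> 0 < G t).
    { intros t ht; destruct (Rlt_dec 0 (G t)) as [|hng]; trivial; exfalso.
      assert (s <= t); [|lra].
      apply hlub; intros x hx; destruct (Rle_dec x t); trivial; exfalso.
      apply hng, hx; lra. }
    assert (hle : G s <= 0).
    { destruct (Rle_dec (G s) 0) as [|hp]; trivial; exfalso.
      assert (hp' : 0 < G s) by lra.
      destruct (hc s _ hp') as (del & hdel & hd).
      assert (hpos : forall t, 0 <= t < s + del -> 0 < G t).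
      { intros t ht; destruct (Rlt_dec t s); [apply hlt; lra|].
        destruct (Req_dec t s) as [->|hne]; trivial.
        assert (hb : Rabs (G t - G s) < G s).
        { apply (hd t); split; [split; [exact I|auto]|].
          simpl; unfold Rdist; rewrite Rabs_right; lra. }
        apply Rabs_lt_between in hb; lra. }
      apply hn; intros t ht; destruct (Rlt_dec t (s + del)); [apply hpos; lra|].
      exfalso.
      assert (s + del / 2 <= s); [|lra].
      apply hub; split; [lra|]; intros; apply hpos; lra. }
    assert (hs0 : 0 < s) by (destruct (Req_dec s 0) as [->|]; lra).
    exists s; split; [lra|]; split; trivial.
    apply Rle_antisym; trivial.
    apply continuity_pt_limit_ge; trivial.
    intros e he; exists (s - Rmin e s / 2).
    assert (0 < Rmin e s) by (apply Rmin_pos; lra).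
    pose proof (Rmin_l e s); pose proof (Rmin_r e s).
    split; [rewrite Rabs_left; lra|]; apply Rlt_le, hlt; lra.
Qed.

(** Gronwall: with M the maximum of [h] on [0, T], F^2 exp (- 2 M t) is nonincreasing and starts at
    0. The hypotheses are restricted to the segment between 0 and [T] because the coefficient met
    later is singular where [normal_part] vanishes. *)
Lemma linear_ode_zero F h T :
  (forall t, Rmin 0 T <= t <= Rmax 0 T -> is_derive F t (h t * F t)) ->
  (forall t, Rmin 0 T <= t <= Rmax 0 T -> continuity_pt h t) ->
  F 0 = 0 -> F T = 0.
Proof.
  assert (pos : forall F h T, 0 <= T ->
    (forall t, 0 <= t <= T -> is_derive F t (h t * F t)) ->
    (forall t, 0 <= t <= T -> continuity_pt h t) -> F 0 = 0 -> F T = 0).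
  { clear; intros F h T hT hF hh h0.
    destruct (continuity_ab_maj h 0 T hT hh) as (w & hw & _).
    set (M := h w) in *.
    destruct (MVT_gen (fun t => F t ^ 2 * exp (- (2 * M * t))) 0 T
      (fun t => 2 * (h t - M) * (F t ^ 2 * exp (- (2 * M * t))))) as (z & hz & e).
    - rewrite Rmin_left, Rmax_right by trivial; intros t ht.
      assert (hd : is_derive F t (h t * F t)) by (apply hF; lra).
      auto_derive.
      + repeat split; trivial; exists (h t * F t); trivial.
      + replace (Derive (fun x => F x) t) with (h t * F t)
          by (symmetry; apply is_derive_unique; trivial).
        ring.
    - rewrite Rmin_left, Rmax_right by trivial; intros t ht.
      apply continuity_pt_filterlim, (ex_derive_continuous
        (fun t => F t ^ 2 * exp (- (2 * M * t)))).
      auto_derive; repeat split; trivial; exists (h t * F t); apply hF; lra.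
    - rewrite Rmin_left, Rmax_right in hz by trivial.
      rewrite h0 in e.
      assert (hM : h z <= M) by (apply hw; trivial).
      assert (0 <= F z ^ 2 * exp (- (2 * M * z))).
      { apply Rmult_le_pos; [apply pow2_ge_0|apply Rlt_le, exp_pos]. }
      assert (hle : F T ^ 2 * exp (- (2 * M * T)) <= 0).
      { replace (F T ^ 2 * exp (- (2 * M * T))) with
          (2 * (h z - M) * (F z ^ 2 * exp (- (2 * M * z))) * (T - 0)) by (rewrite <- e; ring).
        assert ((h z - M) * (F z ^ 2 * exp (- (2 * M * z))) <= 0) by nra.
        nra. }
      assert (hex := exp_pos (- (2 * M * T))).
      assert (F T ^ 2 <= 0) by nra.
      apply Rsqr_0_uniq; unfold Rsqr; nra. }
  intros hF hh h0.
  destruct (Rle_dec 0 T) as [hT|hT].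
  - apply (pos F h T); trivial; intros t ht; [apply hF|apply hh];
      rewrite Rmin_left, Rmax_right; trivial.
  - rewrite Rmin_right, Rmax_left in hF, hh by lra.
    (* For negative [T], F (- t) solves the equation with coefficient - h (- t). *)
    generalize (pos (fun t => F (- t)) (fun t => - h (- t)) (- T)); rewrite Ropp_involutive.
    intros k; apply k; clear k; [lra| | |rewrite Ropp_0; trivial].
    + intros t ht; evar_last.
      * apply (is_derive_comp F (fun t => - t)); [apply hF; lra|].
        auto_derive; trivial.
      * unfold scal; simpl; unfold mult; simpl; ring.
    + intros t ht; apply continuity_pt_opp.
      apply (continuity_pt_comp (fun t => - t) h); [reg|apply hh; lra].
Qed.

(** * Iterated integrals *)

Definition RInt2 (f : R -> R -> R) (a b c d : R) : R :=
  RInt (fun x => RInt (fun y => f x y) c d) a b.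

Lemma cont2_ex_RInt f x c d : cont2 f -> ex_RInt (fun y => f x y) c d.
Proof.
  intros hf; apply (@ex_RInt_continuous R_CompleteNormedModule); intros y _.
  apply cont2_snd_cont, hf.
Qed.

Lemma cont2_RInt f c d x :
  c <= d -> cont2 f -> continuous (fun x => RInt (fun y => f x y) c d) x.
Proof.
  intros hcd hf; apply continuity_pt_filterlim.
  intros eps heps.
  assert (he : 0 < eps / (2 * (d - c + 1))) by (apply Rdiv_lt_0_compat; lra).
  destruct (uniform_continuity_2d_1d' f c d x (fun y _ => hf x y) (mkposreal _ he))
    as [del hdel]; simpl in hdel.
  exists del; split; [apply del|].
  intros x' [_ hx']; simpl in hx' |- *; unfold Rdist in *.
  replace (RInt (fun y => f x' y) c d - RInt (fun y => f x y) c d)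
    with (RInt (fun y => minus (f x' y) (f x y)) c d)
    by (apply (RInt_minus (V := R_CompleteNormedModule)); apply cont2_ex_RInt; trivial).
  apply Rle_lt_trans with ((d - c) * (eps / (2 * (d - c + 1)))).
  - apply abs_RInt_le_const; trivial.
    + apply @ex_RInt_minus; apply cont2_ex_RInt; trivial.
    + intros t ht; apply Rlt_le, (hdel t x t x'); trivial.
      * pose proof (cond_pos del); lra.
      * apply Rabs_lt_between in hx'; lra.
      * rewrite Rminus_diag, Rabs_R0; apply del.
  - apply (Rmult_lt_reg_r (2 * (d - c + 1))); [lra|].
    field_simplify; nra.
Qed.

Lemma cont2_ex_RInt2 f a b c d :
  c <= d -> cont2 f -> ex_RInt (fun x => RInt (fun y => f x y) c d) a b.
Proof.
  intros hcd hf; apply (@ex_RInt_continuous R_CompleteNormedModule); intros x _.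
  apply cont2_RInt; trivial.
Qed.

Lemma RInt2_ext f g a b c d :
  a <= b -> c <= d ->
  (forall x y, a < x < b -> c < y < d -> f x y = g x y) -> RInt2 f a b c d = RInt2 g a b c d.
Proof.
  intros hab hcd h; apply RInt_ext; rewrite Rmin_left, Rmax_right; trivial.
  intros x hx; apply RInt_ext; rewrite Rmin_left, Rmax_right; auto.
Qed.

Lemma RInt2_ext_all f g a b c d : (forall x y, f x y = g x y) -> RInt2 f a b c d = RInt2 g a b c d.
Proof. intros h; apply RInt_ext; intros x _; apply RInt_ext; intros y _; apply h. Qed.

Lemma RInt2_le f g a b c d :
  a <= b -> c <= d -> cont2 f -> cont2 g ->
  (forall x y, a < x < b -> c < y < d -> f x y <= g x y) -> RInt2 f a b c d <= RInt2 g a b c d.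
Proof.
  intros hab hcd hf hg h; apply RInt_le; trivial; try (apply cont2_ex_RInt2; trivial).
  intros x hx; apply RInt_le; trivial; try (apply cont2_ex_RInt; trivial).
  intros y hy; auto.
Qed.

Lemma RInt2_plus f g a b c d :
  c <= d -> cont2 f -> cont2 g ->
  RInt2 (fun x y => f x y + g x y) a b c d = RInt2 f a b c d + RInt2 g a b c d.
Proof.
  intros hcd hf hg; unfold RInt2.
  rewrite <- (RInt_plus (V := R_CompleteNormedModule));
    try (apply cont2_ex_RInt2; trivial).
  apply RInt_ext; intros x _.
  apply (RInt_plus (V := R_CompleteNormedModule)); apply cont2_ex_RInt; trivial.
Qed.

Lemma RInt2_scal k f a b c d :
  c <= d -> cont2 f -> RInt2 (fun x y => k * f x y) a b c d = k * RInt2 f a b c d.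
Proof.
  intros hcd hf; unfold RInt2.
  rewrite <- (RInt_scal (V := R_CompleteNormedModule));
    try (apply cont2_ex_RInt2; trivial).
  apply RInt_ext; intros x _.
  apply (RInt_scal (V := R_CompleteNormedModule)); apply cont2_ex_RInt; trivial.
Qed.

Lemma RInt2_minus f g a b c d :
  c <= d -> cont2 f -> cont2 g ->
  RInt2 (fun x y => f x y - g x y) a b c d = RInt2 f a b c d - RInt2 g a b c d.
Proof.
  intros hcd hf hg.
  replace (RInt2 f a b c d - RInt2 g a b c d) with (RInt2 f a b c d + -1 * RInt2 g a b c d) by ring.
  rewrite <- RInt2_scal, <- RInt2_plus; trivial; [|cont2_tac].
  apply RInt2_ext_all; intros; ring.
Qed.

Lemma RInt2_const k a b c d : RInt2 (fun _ _ => k) a b c d = (b - a) * ((d - c) * k).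
Proof.
  unfold RInt2; rewrite RInt_const, RInt_const; reflexivity.
Qed.

Lemma RInt2_abs_le f g a b c d :
  a <= b -> c <= d -> cont2 f -> cont2 g ->
  (forall x y, a < x < b -> c < y < d -> Rabs (f x y) <= g x y) ->
  Rabs (RInt2 f a b c d) <= RInt2 g a b c d.
Proof.
  intros hab hcd hf hg h; apply Rabs_le; split.
  - replace (- RInt2 g a b c d) with (-1 * RInt2 g a b c d) by ring.
    rewrite <- RInt2_scal; trivial; apply RInt2_le; trivial; [cont2_tac|].
    intros x y hx hy; specialize (h x y hx hy); apply Rabs_le_between in h; lra.
  - apply RInt2_le; trivial.
    intros x y hx hy; specialize (h x y hx hy); apply Rabs_le_between in h; lra.
Qed.

Lemma RInt2_dy f fx fy a b c d :
  c <= d -> has_grad f fx fy -> (forall x, f x c = 0) -> (forall x, f x d = 0) ->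
  RInt2 fy a b c d = 0.
Proof.
  intros hcd h hc hd; unfold RInt2.
  rewrite (RInt_ext _ (fun _ => 0)).
  - rewrite RInt_const; apply Rmult_0_r.
  - intros x _.
    apply is_RInt_unique.
    replace 0 with (minus (f x d) (f x c))
      by (rewrite hc, hd; unfold minus, plus, opp; simpl; ring).
    apply (is_RInt_derive (V := R_CompleteNormedModule) (fun y => f x y)).
    + intros y _; apply h.
    + intros y _; apply cont2_snd_cont, h.
Qed.

Lemma is_derive_RInt_has_grad f fx fy c d x :
  has_grad f fx fy ->
  is_derive (fun x => RInt (fun y => f x y) c d) x (RInt (fun y => fx x y) c d).
Proof.
  intros h.
  replace (RInt (fun y => fx x y) c d)
    with (RInt (fun y => Derive (fun u => f u y) x) c d).
  - apply is_derive_RInt_param.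
    + apply filter_forall; intros x' t _; exists (fx x' t); apply h.
    + intros t _; apply (continuity_2d_pt_ext fx).
      * intros u v; symmetry; apply is_derive_unique, h.
      * apply h.
    + apply filter_forall; intros x'; apply cont2_ex_RInt; eapply has_grad_cont, h.
  - apply RInt_ext; intros y _; apply is_derive_unique, h.
Qed.

(** The x-derivative is taken out of the inner integral, so no exchange of the order of integration
    is involved. *)
Lemma RInt2_dx f fx fy a b c d :
  c <= d -> has_grad f fx fy -> (forall y, f a y = 0) -> (forall y, f b y = 0) ->
  RInt2 fx a b c d = 0.
Proof.
  intros hcd h ha hb; unfold RInt2.
  assert (z : forall x0, (forall y, f x0 y = 0) -> RInt (fun y => f x0 y) c d = 0).
  { intros x0 hx0; rewrite (RInt_ext _ (fun _ => 0)) by (intros; apply hx0).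
    rewrite RInt_const; apply Rmult_0_r. }
  apply is_RInt_unique.
  replace 0 with (minus (RInt (fun y => f b y) c d) (RInt (fun y => f a y) c d))
    by (rewrite (z a ha), (z b hb); unfold minus, plus, opp; simpl; ring).
  apply (is_RInt_derive (V := R_CompleteNormedModule)
           (fun x => RInt (fun y => f x y) c d)).
  - intros x _; eapply is_derive_RInt_has_grad, h.
  - intros x _; apply cont2_RInt; trivial; apply h.
Qed.

(** As functions of the upper limit in x, both iterated integrals start at 0 and have the same
    derivative, the integral of f t y over y; so their difference [H] is constant. *)
Lemma RInt2_fubini f a b c d :
  a <= b -> c <= d -> cont2 f -> RInt2 f a b c d = RInt2 (fun y x => f x y) c d a b.
Proof.
  intros hab hcd hf.
  set (H := fun t => RInt2 f a t c d - RInt2 (fun y x => f x y) c d a t).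
  assert (H0 : H a = 0).
  { unfold H, RInt2; rewrite RInt_point.
    rewrite (RInt_ext _ (fun _ => 0)).
    - rewrite RInt_const; unfold zero, scal; simpl; unfold mult; simpl; ring.
    - intros x _; rewrite RInt_point; reflexivity. }
  assert (dH : forall t, is_derive H t 0).
  { intros t.
    replace 0 with (minus (RInt (fun y => f t y) c d) (RInt (fun y => f t y) c d))
      by (unfold minus, plus, opp; simpl; ring).
    apply @is_derive_minus.
    - apply (is_derive_RInt (fun x => RInt (fun y => f x y) c d)
               (fun t => RInt (fun x => RInt (fun y => f x y) c d) a t) a).
      + apply filter_forall; intros x; apply @RInt_correct, cont2_ex_RInt2; trivial.
      + apply cont2_RInt; trivial.
    - assert (D : forall u y, is_derive (fun z => RInt (fun x => f x y) a z) u (f u y)).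
      { intros u y; apply (is_derive_RInt (fun x => f x y) _ a).
        - apply filter_forall; intros x; apply @RInt_correct.
          apply (cont2_ex_RInt (fun y x => f x y)), cont2_swap, hf.
        - apply cont2_fst_cont, hf. }
      replace (RInt (fun y => f t y) c d)
        with (RInt (fun y => Derive (fun u => RInt (fun x => f x y) a u) t) c d).
      + apply (is_derive_RInt_param (fun u y => RInt (fun x => f x y) a u)).
        * apply filter_forall; intros x' s _; exists (f x' s); apply D.
        * intros s _; apply (continuity_2d_pt_ext f); [|apply hf].
          intros u v; symmetry; apply is_derive_unique, D.
        * apply filter_forall; intros x'.
          (* For an upper limit below [a] the inner integral is reoriented, since continuity of
             parameter integrals was established for ordered bounds. *)
          destruct (Rle_dec a x') as [hx|hx].
          -- apply (cont2_ex_RInt2 (fun y x => f x y)); trivial; apply cont2_swap, hf.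
          -- apply (ex_RInt_ext (fun y => opp (RInt (fun x => f x y) x' a))).
             ++ intros y _; apply opp_RInt_swap.
                apply (cont2_ex_RInt (fun y x => f x y)), cont2_swap, hf.
             ++ apply @ex_RInt_opp, (cont2_ex_RInt2 (fun y x => f x y));
                  [lra|apply cont2_swap, hf].
      + apply RInt_ext; intros y _; apply is_derive_unique, D. }
  assert (e : H b = H a).
  { destruct (MVT_gen H a b (fun _ => 0)) as (w & _ & e).
    - intros; apply dH.
    - intros x _; apply continuity_pt_filterlim.
      apply (ex_derive_continuous H); exists 0; apply dH.
    - lra. }
  rewrite H0 in e; unfold H in e; lra.
Qed.

Lemma RInt_sub f a b a' b' :
  a <= a' -> a' <= b' -> b' <= b -> (forall x, continuous f x) ->
  (forall x, a <= x <= b -> 0 <= f x) -> RInt f a' b' <= RInt f a b.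
Proof.
  intros h1 h2 h3 hc hp.
  assert (E : forall u v, ex_RInt f u v)
    by (intros; apply (@ex_RInt_continuous R_CompleteNormedModule); auto).
  rewrite <- (RInt_Chasles f a a' b), <- (RInt_Chasles f a' b' b) by auto.
  unfold plus; simpl.
  assert (0 <= RInt f a a') by (apply RInt_ge_0; auto; intros; apply hp; lra).
  assert (0 <= RInt f b' b) by (apply RInt_ge_0; auto; intros; apply hp; lra).
  lra.
Qed.

Lemma RInt2_sub f a b c d a' b' c' d' :
  a <= a' -> a' <= b' -> b' <= b -> c <= c' -> c' <= d' -> d' <= d -> cont2 f ->
  (forall x y, a <= x <= b -> c <= y <= d -> 0 <= f x y) ->
  RInt2 f a' b' c' d' <= RInt2 f a b c d.
Proof.
  intros h1 h2 h3 h4 h5 h6 hf hp.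
  apply Rle_trans with (RInt2 f a' b' c d).
  - apply RInt_le; trivial; try (apply cont2_ex_RInt2; trivial; lra).
    intros x hx; apply RInt_sub; trivial.
    + intros y; apply cont2_snd_cont, hf.
    + intros y hy; apply hp; lra.
  - apply (RInt_sub (fun x => RInt (fun y => f x y) c d)); trivial.
    + intros x; apply cont2_RInt; trivial; lra.
    + intros x hx; apply RInt_ge_0; [lra|apply cont2_ex_RInt, hf|].
      intros; apply hp; lra.
Qed.

(** * Minimal fields in the plane *)

(** For V = (P, Q) and JV = (-Q, P) the last clause is <JV, DV JV> = 0, that is, |V|^3 times the
    divergence of V / |V| vanishes. The potential [u] is forgotten; only curl V = 2 remains of
    it. *)
Definition minimal_field (P Q Px Py Qx Qy : R -> R -> R) : Prop :=
  has_grad P Px Py /\ has_grad Q Qx Qy /\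
  (forall x y, Qx x y - Py x y = 2) /\
  (forall x y, Q x y ^ 2 * Px x y - P x y * Q x y * (Py x y + Qx x y)
               + P x y ^ 2 * Qy x y = 0).

Lemma is_derive_comb F G k k' t l l' :
  is_derive F t l -> is_derive G t l' ->
  is_derive (fun t => F t * k + G t * k') t (l * k + l' * k').
Proof.
  intros hF hG; auto_derive.
  - repeat split; [exists l|exists l']; trivial.
  - replace (Derive (fun x => F x) t) with l
      by (symmetry; apply is_derive_unique; trivial).
    replace (Derive (fun x => G x) t) with l'
      by (symmetry; apply is_derive_unique; trivial).
    ring.
Qed.

Lemma approach_from_left T1 : 0 < T1 ->
  forall e, 0 < e -> exists t, 0 <= t < T1 /\ Rabs (t - T1) < e.
Proof.
  intros h e he; exists (T1 - Rmin e T1 / 2).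
  assert (0 < Rmin e T1) by (apply Rmin_pos; lra).
  pose proof (Rmin_l e T1); pose proof (Rmin_r e T1).
  split; [lra|]; rewrite Rabs_left; lra.
Qed.

Lemma approach_zero : forall e, 0 < e -> exists t, 0 < t /\ Rabs (t - 0) < e.
Proof. intros e he; exists (e / 2); rewrite Rabs_right; lra. Qed.

(** Blow-up at a zero: the quotient is filled in at t = 0 by the directional derivative, so that
    limits at the zero become values of continuous functions. *)
Lemma singular_quotient_cont P Px Py a b h k :
  has_grad P Px Py -> P a b = 0 ->
  continuity_pt (fun t => if Req_dec_T t 0 then Px a b * h + Py a b * k
                          else P (a + t * h) (b + t * k) / t) 0.
Proof.
  intros hP h0.
  assert (hd : is_derive (fun t => P (a + t * h) (b + t * k)) 0 (Px a b * h + Py a b * k)).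
  { evar_last.
    - apply (has_grad_chain P Px Py (fun t => a + t * h) (fun t => b + t * k)); trivial;
        auto_derive; trivial.
    - rewrite !Rmult_0_l, !Rplus_0_r; ring. }
  apply is_derive_Reals in hd.
  intros eps heps; destruct (hd eps heps) as [del hdel].
  exists del; split; [apply del|].
  intros t [[_ hne] ht]; simpl in *; unfold Rdist in *.
  destruct (Req_dec_T 0 0) as [_|]; [|lra].
  destruct (Req_dec_T t 0) as [->|hne']; [lra|].
  rewrite Rminus_0_r in ht.
  specialize (hdel t hne' ht).
  rewrite Rplus_0_l, !Rmult_0_l, !Rplus_0_r, h0, Rminus_0_r in hdel; trivial.
Qed.

Section MinimalField.

Context (P Q Px Py Qx Qy : R -> R -> R).
Context (hmin : minimal_field P Q Px Py Qx Qy).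

Let hP : has_grad P Px Py := proj1 hmin.
Let hQ : has_grad Q Qx Qy := proj1 (proj2 hmin).
Let hcurl := proj1 (proj2 (proj2 hmin)).
Let heq := proj2 (proj2 (proj2 hmin)).
Let cP : cont2 P := has_grad_cont hP.
Let cQ : cont2 Q := has_grad_cont hQ.
Let cPx : cont2 Px := proj1 (proj2 (proj2 hP)).
Let cPy : cont2 Py := proj2 (proj2 (proj2 hP)).
Let cQx : cont2 Qx := proj1 (proj2 (proj2 hQ)).
Let cQy : cont2 Qy := proj2 (proj2 (proj2 hQ)).

(* (lineX, lineY) is the point p + t JV(p); [tangential] and [normal_part] are the scalar
   products of V there with JV(p) and V(p). *)
Definition lineX (a b t : R) : R := a - t * Q a b.
Definition lineY (a b t : R) : R := b + t * P a b.
Definition tangential (a b t : R) : R :=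
  let x := lineX a b t in let y := lineY a b t in
  - P x y * Q a b + Q x y * P a b.
Definition normal_part (a b t : R) : R :=
  let x := lineX a b t in let y := lineY a b t in
  P x y * P a b + Q x y * Q a b.
Definition sqn (a b : R) : R := P a b ^ 2 + Q a b ^ 2.
(* <JV, DV V>: the lines through neighbouring points focus at t = |V|^2 / focal. *)
Definition focal (a b : R) : R :=
  - Q a b * (Px a b * P a b + Py a b * Q a b) + P a b * (Qx a b * P a b + Qy a b * Q a b).

Definition regular_to (a b T : R) : Prop :=
  forall t, Rmin 0 T <= t <= Rmax 0 T -> 0 < normal_part a b t.

Lemma is_derive_along_line f fx fy a b t :
  has_grad f fx fy ->
  is_derive (fun t => f (lineX a b t) (lineY a b t)) t
    (- fx (lineX a b t) (lineY a b t) * Q a b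
     + fy (lineX a b t) (lineY a b t) * P a b).
Proof.
  intros h; evar_last.
  - apply (has_grad_chain f fx fy (lineX a b) (lineY a b)); trivial;
      unfold lineX, lineY; auto_derive; trivial.
  - ring.
Qed.

Lemma is_derive_tangential a b t :
  let x := lineX a b t in let y := lineY a b t in
  is_derive (tangential a b) t
    (Q a b ^ 2 * Px x y - P a b * Q a b * (Py x y + Qx x y) + P a b ^ 2 * Qy x y).
Proof.
  intros x y; unfold tangential.
  evar_last.
  - apply (is_derive_ext (fun t => P (lineX a b t) (lineY a b t) * - Q a b
                                   + Q (lineX a b t) (lineY a b t) * P a b)).
    + intros; simpl; ring.
    + apply is_derive_comb; eapply is_derive_along_line; eassumption.
  - fold x y; simpl; ring.
Qed.

Lemma is_derive_normal_part a b t :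
  let x := lineX a b t in let y := lineY a b t in
  is_derive (normal_part a b) t
    (P a b * (- Px x y * Q a b + Py x y * P a b)
     + Q a b * (- Qx x y * Q a b + Qy x y * P a b)).
Proof.
  intros x y; unfold normal_part.
  evar_last.
  - apply is_derive_comb; eapply is_derive_along_line; eassumption.
  - fold x y; simpl; ring.
Qed.

Lemma continuity_along_line f a b t :
  cont2 f -> continuity_pt (fun t => f (lineX a b t) (lineY a b t)) t.
Proof.
  intros h; apply (cont2_line f (lineX a b) (lineY a b)); trivial;
    unfold lineX, lineY; reg.
Qed.

Lemma normal_part_0 a b : normal_part a b 0 = sqn a b.
Proof.
  unfold normal_part, lineX, lineY, sqn; rewrite !Rmult_0_l, Rminus_0_r, Rplus_0_r; ring.
Qed.

Lemma tangential_0 a b : tangential a b 0 = 0.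
Proof.
  unfold tangential, lineX, lineY; rewrite !Rmult_0_l, Rminus_0_r, Rplus_0_r; ring.
Qed.

Lemma normal_part_cont a b t :
  continuity_pt (normal_part a b) t.
Proof.
  unfold normal_part.
  pose proof (continuity_along_line P a b t cP).
  pose proof (continuity_along_line Q a b t cQ).
  cpt_tac.
Qed.

Lemma tangential_cont a b t :
  continuity_pt (tangential a b) t.
Proof.
  unfold tangential.
  pose proof (continuity_along_line P a b t cP).
  pose proof (continuity_along_line Q a b t cQ).
  cpt_tac.
Qed.

(* Writing V = (f JV(p) + g V(p)) / |V(p)|^2 along the line, the equation of a minimal
   field divided by g^2 is a linear differential equation for f. *)
Lemma tangential_zero a b T :
  regular_to a b T -> tangential a b T = 0.
Proof.
  intros hreg.
  (* With DV taken at (x, y) and the vectors frozen at p = (a, b), [A] is <V(p), DV V(p)> and [B] is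
     - <V(p), DV JV(p)> - <JV(p), DV V(p)>. *)
  set (A := fun x y => P a b ^ 2 * Px x y + P a b * Q a b * (Py x y + Qx x y)
                       + Q a b ^ 2 * Qy x y).
  set (B := fun x y => 2 * P a b * Q a b * Px x y - (P a b ^ 2 - Q a b ^ 2) * (Py x y + Qx x y)
                       - 2 * P a b * Q a b * Qy x y).
  assert (cA : cont2 A) by (unfold A; cont2_tac).
  assert (cB : cont2 B) by (unfold B; cont2_tac).
  apply (linear_ode_zero (tangential a b)
    (fun t => - (normal_part a b t * B (lineX a b t) (lineY a b t)
                 + tangential a b t * A (lineX a b t) (lineY a b t))
              / (normal_part a b t * normal_part a b t))).
  - intros t ht; specialize (hreg t ht).
    evar_last.
    + eapply is_derive_tangential; eassumption.
    + simpl.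
      assert (hd : sqn a b <> 0).
      { intros h0; unfold sqn in h0; unfold normal_part in hreg.
        assert (P a b = 0) by nra; assert (Q a b = 0) by nra; nra. }
      specialize (heq (lineX a b t) (lineY a b t)).
      unfold A, B in *; unfold tangential, normal_part, sqn in *; cbv zeta in *.
      set (x := lineX a b t) in *; set (y := lineY a b t) in *.
      set (g := P x y * P a b + Q x y * Q a b) in *.
      set (f := - P x y * Q a b + Q x y * P a b) in *.
      set (d := P a b ^ 2 + Q a b ^ 2) in *.
      (* [e1] and [e2] expand V at the moving point in the basis JV(p), V(p). Inserted into d^2
         times the equation they give f' g^2 = - f (g B + f A). *)
      assert (e1 : d * P x y = - f * Q a b + g * P a b) by (unfold d, f, g; ring).
      assert (e2 : d * Q x y = f * P a b + g * Q a b) by (unfold d, f, g; ring).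
      assert (e3 : (d * Q x y) ^ 2 * Px x y - (d * P x y) * (d * Q x y) * (Py x y + Qx x y)
               + (d * P x y) ^ 2 * Qy x y = 0).
      { transitivity (d ^ 2 * (Q x y ^ 2 * Px x y - P x y * Q x y * (Py x y + Qx x y)
               + P x y ^ 2 * Qy x y)); [ring|rewrite heq; ring]. }
      rewrite e1, e2 in e3.
      apply (Rmult_eq_reg_r (g * g)); [|nra].
      field_simplify; [|lra].
      clearbody f g; nra.
  - intros t ht; specialize (hreg t ht).
    pose proof (normal_part_cont a b t).
    pose proof (tangential_cont a b t).
    pose proof (continuity_along_line A a b t cA).
    pose proof (continuity_along_line B a b t cB).
    unfold Rdiv; apply cpt_mult; [cpt_tac|].
    apply (continuity_pt_inv (fun t => normal_part a b t * normal_part a b t));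
      [cpt_tac|nra].
  - apply tangential_0.
Qed.

(* Neighbouring lines stay regular up to time T, so that V(p_e + T JV(p_e)) is parallel
   to V(p_e) for p_e = p + e V(p); this is the derivative of that relation at e = 0. *)
Lemma jacobi a b T :
  regular_to a b T ->
  let x := lineX a b T in let y := lineY a b T in
  (sqn a b - T * focal a b)
  * (- Q a b * (Px x y * P a b + Py x y * Q a b) + P a b * (Qx x y * P a b + Qy x y * Q a b))
  = focal a b * normal_part a b T.
Proof.
  intros hreg x y.
  set (v1 := P a b); set (v2 := Q a b).
  assert (hlo : Rmin 0 T <= Rmax 0 T) by apply Rminmax.
  (* The positive minimum of [normal_part] on the segment exceeds, by uniform continuity, the change
     caused by moving the base point by a small e V(p). So [tangential_zero] applies to all nearby
     base points. *)
  destruct (continuity_ab_min (normal_part a b) (Rmin 0 T) (Rmax 0 T) hlo)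
    as (w & hw & hwin).
  { intros t _; apply normal_part_cont; trivial. }
  assert (hm : 0 < normal_part a b w) by (apply hreg; trivial).
  set (G := fun t e => normal_part (a + e * v1) (b + e * v2) t).
  assert (cPe : cont2 (fun t e => P (a + e * v1) (b + e * v2)))
    by (apply cont2_comp2; trivial; cont2_tac).
  assert (cQe : cont2 (fun t e => Q (a + e * v1) (b + e * v2)))
    by (apply cont2_comp2; trivial; cont2_tac).
  assert (cG : cont2 G).
  { unfold G, normal_part, lineX, lineY; apply cont2_plus; apply cont2_mult; trivial;
      apply cont2_comp2; trivial; cont2_tac. }
  destruct (uniform_continuity_2d_1d G (Rmin 0 T) (Rmax 0 T) 0 (fun t _ => cG t 0)
    (mkposreal _ hm)) as [del hdel]; simpl in hdel.
  assert (G0 : forall t, G t 0 = normal_part a b t)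
    by (intros t; unfold G; rewrite !Rmult_0_l, !Rplus_0_r; trivial).
  assert (hz : forall e, Rabs e < del ->
    tangential (a + e * v1) (b + e * v2) T = 0).
  { intros e he; eapply tangential_zero.
    intros t ht.
    pose proof (cond_pos del).
    apply Rabs_lt_between in he.
    assert (hb : Rabs (G t e - G t 0) < normal_part a b w).
    { apply hdel; trivial; try lra; rewrite Rminus_diag, Rabs_R0; trivial. }
    apply Rabs_lt_between in hb; rewrite G0 in hb.
    assert (normal_part a b w <= normal_part a b t) by (apply hw; trivial).
    fold (G t e); lra. }
  set (p' := Px a b * v1 + Py a b * v2); set (q' := Qx a b * v1 + Qy a b * v2).
  assert (dlin : forall k v, is_derive (fun e => k + e * v) 0 v)
    by (intros; auto_derive; trivial; ring).
  assert (dPe : is_derive (fun e => P (a + e * v1) (b + e * v2)) 0 p').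
  { generalize (has_grad_chain P Px Py (fun e => a + e * v1) (fun e => b + e * v2) 0 v1 v2
      hP (dlin _ _) (dlin _ _)); cbv beta; rewrite !Rmult_0_l, !Rplus_0_r; trivial. }
  assert (dQe : is_derive (fun e => Q (a + e * v1) (b + e * v2)) 0 q').
  { generalize (has_grad_chain Q Qx Qy (fun e => a + e * v1) (fun e => b + e * v2) 0 v1 v2
      hQ (dlin _ _) (dlin _ _)); cbv beta; rewrite !Rmult_0_l, !Rplus_0_r; trivial. }
  set (Xe := fun e => a + e * v1 - T * Q (a + e * v1) (b + e * v2)).
  set (Ye := fun e => b + e * v2 + T * P (a + e * v1) (b + e * v2)).
  assert (X0 : Xe 0 = x)
    by (unfold Xe, x, lineX; rewrite !Rmult_0_l, !Rplus_0_r; trivial).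
  assert (Y0 : Ye 0 = y)
    by (unfold Ye, y, lineY; rewrite !Rmult_0_l, !Rplus_0_r; trivial).
  assert (dX : is_derive Xe 0 (v1 - T * q')).
  { apply @is_derive_minus; [apply dlin|apply is_derive_scal; trivial]. }
  assert (dY : is_derive Ye 0 (v2 + T * p')).
  { apply @is_derive_plus; [apply dlin|apply is_derive_scal; trivial]. }
  assert (dP2 := has_grad_chain P Px Py Xe Ye 0 _ _ hP dX dY).
  assert (dQ2 := has_grad_chain Q Qx Qy Xe Ye 0 _ _ hQ dX dY).
  rewrite X0, Y0 in dP2, dQ2.
  set (DP := Px x y * (v1 - T * q') + Py x y * (v2 + T * p')) in *.
  set (DQ := Qx x y * (v1 - T * q') + Qy x y * (v2 + T * p')) in *.
  assert (dPhi : is_derive (fun e => tangential (a + e * v1) (b + e * v2) T) 0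
     (- DP * v2 - P x y * q' + DQ * v1 + Q x y * p')).
  { apply (is_derive_ext (fun e => - (P (Xe e) (Ye e) * Q (a + e * v1) (b + e * v2))
      + Q (Xe e) (Ye e) * P (a + e * v1) (b + e * v2))).
    - intros e; unfold tangential, lineX, lineY; fold (Xe e); fold (Ye e); simpl; ring.
    - evar_last.
      + apply @is_derive_plus; [apply @is_derive_opp|];
          (apply @is_derive_mult; [eassumption|eassumption|intros; apply Rmult_comm]).
      + cbv beta; rewrite X0, Y0, !Rmult_0_l, !Rplus_0_r.
        unfold plus, mult, opp; simpl; fold v1 v2; ring. }
  assert (e0 : - DP * v2 - P x y * q' + DQ * v1 + Q x y * p' = 0).
  { rewrite <- (is_derive_unique _ _ _ dPhi).
    rewrite (Derive_ext_loc _ (fun _ => 0)); [apply Derive_const|].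
    exists del; intros e he; apply hz.
    unfold ball in he; simpl in he; unfold AbsRing_ball, abs, minus, plus, opp in he;
      simpl in he; rewrite Ropp_0, Rplus_0_r in he; trivial. }
  pose proof (tangential_zero _ _ _ hreg) as f0.
  assert (np : 0 < normal_part a b T).
  { apply hreg; unfold Rmin, Rmax; destruct (Rle_dec 0 T); lra. }
  (* At (x, y) the field is a positive multiple of V(p), so the equation there may be read with V(p)
     in place of V(x, y). *)
  assert (f1 : v2 ^ 2 * Px x y - v1 * v2 * (Py x y + Qx x y) + v1 ^ 2 * Qy x y = 0).
  { specialize (heq x y).
    unfold tangential, normal_part in f0, np; cbv zeta in f0, np; fold x y v1 v2 in f0, np.
    set (g := P x y * v1 + Q x y * v2) in *.
    set (d := v1 ^ 2 + v2 ^ 2).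
    assert (e1 : d * P x y = g * v1).
    { replace (d * P x y) with (- (- P x y * v2 + Q x y * v1) * v2 + g * v1)
        by (unfold d, g; ring); rewrite f0; ring. }
    assert (e2 : d * Q x y = g * v2).
    { replace (d * Q x y) with ((- P x y * v2 + Q x y * v1) * v1 + g * v2)
        by (unfold d, g; ring); rewrite f0; ring. }
    apply (Rmult_eq_reg_l (g ^ 2)); [|nra].
    transitivity ((d * Q x y) ^ 2 * Px x y - (d * P x y) * (d * Q x y) * (Py x y + Qx x y)
               + (d * P x y) ^ 2 * Qy x y).
    - rewrite e1, e2; ring.
    - transitivity (d ^ 2 * (Q x y ^ 2 * Px x y - P x y * Q x y * (Py x y + Qx x y)
               + P x y ^ 2 * Qy x y)); [ring|rewrite heq; ring]. }
  unfold tangential in f0; cbv zeta in f0; fold x y v1 v2 in f0.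
  (* The derivative of the parallelism relation, times |V(p)|^2, is the claimed identity plus
     multiples of the quantities that vanish by [f1] and [f0]. *)
  assert (key : sqn a b * (- DP * v2 - P x y * q' + DQ * v1 + Q x y * p') =
    (sqn a b - T * focal a b)
     * (- v2 * (Px x y * v1 + Py x y * v2) + v1 * (Qx x y * v1 + Qy x y * v2))
    - focal a b * normal_part a b T
    + T * (v1 * p' + v2 * q') *
      (v2 ^ 2 * Px x y - v1 * v2 * (Py x y + Qx x y) + v1 ^ 2 * Qy x y)
    + (v1 * p' + v2 * q') * (- P x y * v2 + Q x y * v1)).
  { unfold normal_part, sqn, focal; cbv zeta; fold x y v1 v2.
    unfold DP, DQ, p', q'; ring. }
  rewrite e0, f0, f1 in key; lra.
Qed.

(** If d - S m vanished at a regular time S, [jacobi] would give m = 0 and then d = 0: neighbouring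
    lines cannot focus before [normal_part] vanishes. Being affine in S and positive at S = 0, the
    factor stays positive; its only possible zero is S = d / m. *)
Lemma focal_pos a b T :
  regular_to a b T ->
  0 < sqn a b - T * focal a b.
Proof.
  intros hreg.
  set (d := sqn a b); set (m := focal a b).
  assert (hd : 0 < d).
  { unfold d; rewrite <- normal_part_0; apply hreg.
    unfold Rmin, Rmax; destruct (Rle_dec 0 T); lra. }
  assert (hne : forall S, regular_to a b S -> d - S * m <> 0).
  { intros S hS h0.
    pose proof (jacobi _ _ _ hS) as j; cbv zeta in j.
    fold d m in j; rewrite h0, Rmult_0_l in j.
    assert (0 < normal_part a b S)
      by (apply hS; unfold Rmin, Rmax; destruct (Rle_dec 0 S); lra).
    assert (m = 0) by nra; nra. }
  destruct (Rlt_dec 0 (d - T * m)) as [|hn]; trivial; exfalso.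
  assert (hm : m <> 0) by (intros e; rewrite e in hn; lra).
  apply (hne (d / m)); [|field; trivial].
  assert (hmT : d <= T * m) by lra.
  assert (hbt : Rmin 0 T <= d / m <= Rmax 0 T).
  { destruct (Rlt_dec 0 m).
    - assert (0 < T) by nra; rewrite Rmin_left, Rmax_right by lra; split.
      + apply Rlt_le, Rdiv_lt_0_compat; trivial.
      + apply (Rmult_le_reg_r m); trivial.
        replace (d / m * m) with d by (field; trivial); lra.
    - assert (T < 0) by nra; rewrite Rmin_right, Rmax_left by lra; split.
      + apply (Rmult_le_reg_r (- m)); [lra|].
        replace (d / m * - m) with (- d) by (field; trivial); lra.
      + apply (Rmult_le_reg_r (- m)); [lra|].
        replace (d / m * - m) with (- d) by (field; trivial); lra. }
  intros t ht; apply hreg.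
  unfold Rmin, Rmax in *; destruct (Rle_dec 0 T), (Rle_dec 0 (d / m)); lra.
Qed.

(** By curl V = 2, [normal_part] has derivative mm - 2 d with mm = <JV(p), DV V(p)>, DV taken at the
    moving point. [jacobi] eliminates mm, and the product with the focal factor is left with the
    affine derivative - 2 d^2 + 2 d m t. *)
Lemma regular_profile a b T :
  regular_to a b T ->
  let d := sqn a b in let m := focal a b in
  (d - T * m) * normal_part a b T = d ^ 2 - 2 * d ^ 2 * T + d * m * T ^ 2.
Proof.
  intros hreg d m;   destruct (MVT_gen (fun t => (d - t * m) * normal_part a b t
     - (d ^ 2 - 2 * d ^ 2 * t + d * m * t ^ 2)) 0 T (fun _ => 0)) as (z & _ & e).
  - intros t ht.
    assert (hr : regular_to a b t).
    { intros s hs; apply hreg; unfold Rmin, Rmax in *.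
      destruct (Rle_dec 0 T), (Rle_dec 0 t); lra. }
    pose proof (jacobi _ _ _ hr) as j; cbv zeta in j.
    pose proof (is_derive_normal_part a b t) as dn; cbv zeta in dn.
    pose proof (hcurl (lineX a b t) (lineY a b t)) as hc.
    set (x := lineX a b t) in *; set (y := lineY a b t) in *.
    fold d m in j.
    auto_derive; [repeat split; exists (P a b * (- Px x y * Q a b + Py x y * P a b) + Q a b * (- Qx x y * Q a b + Qy x y * P a b)); trivial|].
    replace (Derive (fun x => normal_part a b x) t) with
     (P a b * (- Px x y * Q a b + Py x y * P a b)
     + Q a b * (- Qx x y * Q a b + Qy x y * P a b))
      by (symmetry; apply is_derive_unique; trivial).
    set (mm := - Q a b * (Px x y * P a b + Py x y * Q a b)
               + P a b * (Qx x y * P a b + Qy x y * Q a b)) in *.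
    assert (e1 : P a b * (- Px x y * Q a b + Py x y * P a b)
     + Q a b * (- Qx x y * Q a b + Qy x y * P a b) = mm - 2 * d).
    { unfold d, sqn, mm; replace (Qx x y) with (2 + Py x y) by lra; ring. }
    rewrite e1.
    replace ((d - t * m) * (mm - 2 * d)) with ((d - t * m) * mm - 2 * d * (d - t * m)) by ring.
    nra.
  - intros t _.
    pose proof (normal_part_cont a b t).
    cpt_tac.
  - rewrite normal_part_0 in e; fold d in e; lra.
Qed.

(* At a first zero T1 < 0 the two sides of [regular_profile] would vanish in the limit
   while the focal factor stays nonnegative, which is impossible. *)
Lemma backward_ray a b T :
  0 < sqn a b -> 0 <= T ->
  T * sqn a b <= normal_part a b (- T) /\ 0 < normal_part a b (- T).
Proof.
  intros hd hT.
  set (d := sqn a b) in *; set (m := focal a b).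
  assert (hc : forall t, continuity_pt (fun t => normal_part a b (- t)) t).
  { intros t; apply (continuity_pt_comp (fun t => - t) (normal_part a b));
      [reg|apply normal_part_cont; trivial]. }
  assert (hreg : regular_to a b (- T)).
  { apply NNPP; intros hn.
    destruct (first_zero (fun t => normal_part a b (- t)) T) as (T1 & hT1 & hz & hlt);
      trivial.
    - rewrite Ropp_0, normal_part_0; trivial.
    - intros k; apply hn; intros t ht.
      rewrite Rmin_right, Rmax_left in ht by lra.
      replace t with (- - t) by ring; apply k; lra.
    - assert (hr : forall t, 0 <= t < T1 -> regular_to a b (- t)).
      { intros t ht s hs; rewrite Rmin_right, Rmax_left in hs by lra.
        replace s with (- - s) by ring; apply hlt; lra. }
      assert (l1 : 0 <= d + T1 * m).
      { apply (continuity_pt_limit_ge (fun t => d + t * m)); [reg|].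
        intros e he; destruct (approach_from_left T1 (proj1 hT1) e he) as (t & ht & hte).
        exists t; split; trivial.
        pose proof (focal_pos _ _ _ (hr t ht)) as hf; fold d m in hf; lra. }
      assert (l2 : (d + T1 * m) * normal_part a b (- T1)
         - (d ^ 2 + 2 * d ^ 2 * T1 + d * m * T1 ^ 2) = 0).
      { apply (continuity_pt_limit_eq (fun t => (d + t * m) * normal_part a b (- t)
         - (d ^ 2 + 2 * d ^ 2 * t + d * m * t ^ 2))).
        - specialize (hc T1); cpt_tac.
        - intros e he; destruct (approach_from_left T1 (proj1 hT1) e he) as (t & ht & hte).
          exists t; split; trivial.
          pose proof (regular_profile _ _ _ (hr t ht)) as hf.
          cbv zeta in hf; fold d m in hf.
          replace (d + t * m) with (d - - t * m) by ring; rewrite hf; ring. }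
      rewrite hz in l2.
      (* The right-hand side of the profile is d^2 + d^2 T1 + d T1 (d + T1 m) > 0, while its
         left-hand side is 0. *)
      assert (0 <= d * T1 * (d + T1 * m)) by (apply Rmult_le_pos; nra).
      nra. }
  pose proof (focal_pos _ _ _ hreg) as hf; fold d m in hf.
  pose proof (regular_profile _ _ _ hreg) as hg.
  cbv zeta in hg; fold d m in hg.
  split.
  - apply (Rmult_le_reg_l (d - - T * m)); trivial.
    rewrite hg; nra.
  - apply hreg; rewrite Rmin_right, Rmax_left by lra; lra.
Qed.

Lemma tangential_normal_zero a b t :
  0 < sqn a b -> tangential a b t = 0 -> normal_part a b t = 0 ->
  P (lineX a b t) (lineY a b t) = 0 /\ Q (lineX a b t) (lineY a b t) = 0.
Proof.
  unfold tangential, normal_part, sqn; cbv zeta; intros hd h1 h2.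
  set (p := P (lineX a b t) (lineY a b t)) in *.
  set (q := Q (lineX a b t) (lineY a b t)) in *.
  split; apply (Rmult_eq_reg_l (P a b ^ 2 + Q a b ^ 2)); try lra.
  - transitivity (- (- p * Q a b + q * P a b) * Q a b + (p * P a b + q * Q a b) * P a b);
      [ring|rewrite h1, h2; ring].
  - transitivity ((- p * Q a b + q * P a b) * P a b + (p * P a b + q * Q a b) * Q a b);
      [ring|rewrite h1, h2; ring].
Qed.

(** At t = 1 the profile reads (d - m) [normal_part] = - d (d - m), so a line regular up to time 1
    would have [normal_part] equal to - d < 0 there. The linear lower bound in T - t makes the first
    zero transversal. *)
Lemma forward_hit a b :
  0 < sqn a b ->
  exists T, 0 < T /\
    P (lineX a b T) (lineY a b T) = 0 /\ Q (lineX a b T) (lineY a b T) = 0 /\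
    forall t, 0 <= t < T ->
      tangential a b t = 0 /\ (T - t) * sqn a b <= normal_part a b t.
Proof.
  intros hd.
  set (d := sqn a b) in *; set (m := focal a b).
  destruct (first_zero (normal_part a b) 1) as (T & hT & hz & hlt).
  - intros; apply normal_part_cont; trivial.
  - rewrite normal_part_0; trivial.
  - lra.
  - intros hn.
    assert (hr : regular_to a b 1)
      by (intros t ht; rewrite Rmin_left, Rmax_right in ht by lra; apply hn; trivial).
    pose proof (focal_pos _ _ _ hr) as hf; fold d m in hf.
    pose proof (regular_profile _ _ _ hr) as hg.
    cbv zeta in hg; fold d m in hg.
    assert (h1 : 0 < normal_part a b 1) by (apply hn; lra).
    nra.
  - exists T; split; [apply hT|].
    assert (hr : forall t, 0 <= t < T -> regular_to a b t).
    { intros t ht s hs; rewrite Rmin_left, Rmax_right in hs by lra; apply hlt; lra. }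
    assert (ht0 : forall t, 0 <= t < T -> tangential a b t = 0)
      by (intros t ht; apply tangential_zero, hr; trivial).
    assert (hT0 : tangential a b T = 0).
    { apply continuity_pt_limit_eq; [apply tangential_cont; trivial|].
      intros e he; destruct (approach_from_left T (proj1 hT) e he) as (t & ht & hte).
      exists t; split; auto. }
    destruct (tangential_normal_zero a b T hd hT0 hz) as [e1 e2].
    split; [trivial|split; [trivial|]].
    assert (l1 : 0 <= d - T * m).
    { apply (continuity_pt_limit_ge (fun t => d - t * m)); [reg|].
      intros e he; destruct (approach_from_left T (proj1 hT) e he) as (t & ht & hte).
      exists t; split; trivial.
      pose proof (focal_pos _ _ _ (hr t ht)) as hf; fold d m in hf; lra. }
    assert (l2 : (d - T * m) * normal_part a b T
         - (d ^ 2 - 2 * d ^ 2 * T + d * m * T ^ 2) = 0).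
    { apply (continuity_pt_limit_eq (fun t => (d - t * m) * normal_part a b t
         - (d ^ 2 - 2 * d ^ 2 * t + d * m * t ^ 2))).
      - pose proof (normal_part_cont a b T); cpt_tac.
      - intros e he; destruct (approach_from_left T (proj1 hT) e he) as (t & ht & hte).
        exists t; split; trivial.
        pose proof (regular_profile _ _ _ (hr t ht)) as hf.
        cbv zeta in hf; fold d m in hf; rewrite hf; ring. }
    rewrite hz in l2.
    intros t ht; split; auto.
    pose proof (focal_pos _ _ _ (hr t ht)) as hf; fold d m in hf.
    pose proof (regular_profile _ _ _ (hr t ht)) as hg.
    cbv zeta in hg; fold d m in hg.
    apply (Rmult_le_reg_l (d - t * m)); trivial.
    rewrite hg.
    (* The quadratic vanishes at [T] by [l2]; subtracting that value factors out T - t. *)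
    replace (d ^ 2 - 2 * d ^ 2 * t + d * m * t ^ 2) with
      (d * (T - t) * ((d - t * m) + (d - T * m))) by nra.
    assert (0 <= d * (T - t) * (d - T * m)) by (apply Rmult_le_pos; [nra|trivial]).
    nra.
Qed.

(* Limit of the equation at q + t (h, k), divided by t^2, as t tends to 0. *)
Lemma singular_equation a b h k :
  P a b = 0 -> Q a b = 0 ->
  let p := Px a b * h + Py a b * k in let q := Qx a b * h + Qy a b * k in
  q ^ 2 * Px a b - p * q * (Py a b + Qx a b) + p ^ 2 * Qy a b = 0.
Proof.
  intros hp hq p q.
  pose proof (singular_quotient_cont _ _ _ a b h k hP hp) as c1; fold p in c1.
  pose proof (singular_quotient_cont _ _ _ a b h k hQ hq) as c2; fold q in c2.
  set (p1 := fun t => if Req_dec_T t 0 then p else P (a + t * h) (b + t * k) / t) in *.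
  set (q1 := fun t => if Req_dec_T t 0 then q else Q (a + t * h) (b + t * k) / t) in *.
  assert (cl : forall f, cont2 f -> continuity_pt (fun t => f (a + t * h) (b + t * k)) 0)
    by (intros f hf; apply (cont2_line f (fun t => a + t * h) (fun t => b + t * k));
        trivial; reg).
  pose proof (cl _ cPx); pose proof (cl _ cPy); pose proof (cl _ cQx); pose proof (cl _ cQy).
  set (a1 := fun t => Px (a + t * h) (b + t * k)) in *.
  set (a2 := fun t => Py (a + t * h) (b + t * k)) in *.
  set (a3 := fun t => Qx (a + t * h) (b + t * k)) in *.
  set (a4 := fun t => Qy (a + t * h) (b + t * k)) in *.
  assert (hF : (q1 0 * q1 0 * a1 0 - p1 0 * q1 0 * (a2 0 + a3 0) + p1 0 * p1 0 * a4 0) = 0).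
  { apply (continuity_pt_limit_eq (fun t =>
      q1 t * q1 t * a1 t - p1 t * q1 t * (a2 t + a3 t) + p1 t * p1 t * a4 t)).
    - cpt_tac.
    - intros e he; destruct (approach_zero e he) as (t & ht & hte).
      exists t; split; trivial; unfold p1, q1.
      destruct (Req_dec_T t 0); [lra|].
      specialize (heq (a + t * h) (b + t * k)).
      apply (Rmult_eq_reg_l (t * t)); [|nra].
      rewrite Rmult_0_r, <- heq; unfold a1, a2, a3, a4; field; trivial. }
  unfold p1, q1, a1, a2, a3, a4 in hF.
  destruct (Req_dec_T 0 0) as [_|]; [|lra].
  rewrite !Rmult_0_l, !Rplus_0_r in hF; rewrite <- hF; ring.
Qed.

(** If DV is invertible, DV (h, k) is an arbitrary vector (p, q), and [singular_equation] makes a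
    whole quadratic form vanish. This kills the symmetric part of DV, and curl V = 2 fixes the rest:
    DV = J. *)
Lemma singular_nondegenerate a b :
  P a b = 0 -> Q a b = 0 ->
  Px a b * Qy a b - Py a b * Qx a b <> 0 ->
  Px a b = 0 /\ Py a b = -1 /\ Qx a b = 1 /\ Qy a b = 0.
Proof.
  intros hp hq hdet.
  specialize (hcurl a b).
  pose proof (fun h k => singular_equation _ _ h k hp hq) as E.
  cbv zeta in E.
  set (A := Px a b) in *; set (B := Py a b) in *; set (C := Qx a b) in *;
    set (D := Qy a b) in *.
  set (det := A * D - B * C) in *.
  assert (E' : forall p q, q ^ 2 * A - p * q * (B + C) + p ^ 2 * D = 0).
  { intros p q; specialize (E ((D * p - B * q) / det) ((A * q - C * p) / det)).
    replace (A * ((D * p - B * q) / det) + B * ((A * q - C * p) / det)) with p in E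
      by (unfold det; field; trivial).
    replace (C * ((D * p - B * q) / det) + D * ((A * q - C * p) / det)) with q in E
      by (unfold det; field; trivial).
    trivial. }
  pose proof (E' 0 1); pose proof (E' 1 0); pose proof (E' 1 1); repeat split; lra.
Qed.

(* Limit of the backward rays issued from q + t h as t decreases to 0: there JV is
   asymptotic to - t mu h. *)
Lemma singular_ray a b h k mu s :
  P a b = 0 -> Q a b = 0 ->
  0 < mu -> h <> 0 \/ k <> 0 ->
  Px a b * h + Py a b * k = - mu * k -> Qx a b * h + Qy a b * k = mu * h -> 0 < s ->
  P (a + s * h) (b + s * k) * h + Q (a + s * h) (b + s * k) * k = 0 /\
  0 < - P (a + s * h) (b + s * k) * k + Q (a + s * h) (b + s * k) * h.
Proof.
  intros hp hq hmu hne e1 e2 hs;   pose proof (singular_quotient_cont _ _ _ a b h k hP hp) as c1.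
  pose proof (singular_quotient_cont _ _ _ a b h k hQ hq) as c2.
  rewrite e1 in c1; rewrite e2 in c2.
  set (p1 := fun t => if Req_dec_T t 0 then - mu * k else P (a + t * h) (b + t * k) / t) in *.
  set (q1 := fun t => if Req_dec_T t 0 then mu * h else Q (a + t * h) (b + t * k) / t) in *.
  assert (p10 : p1 0 = - mu * k) by (unfold p1; destruct (Req_dec_T 0 0); lra).
  assert (q10 : q1 0 = mu * h) by (unfold q1; destruct (Req_dec_T 0 0); lra).
  (* (xt t, yt t) is the point at time - s / (mu t) on the line issued from q + t (h, k), where q =
     (a, b). It tends to q + s (h, k) because V(q + t (h, k)) / t tends to mu J(h, k). *)
  set (xt := fun t => a + t * h + s / mu * q1 t).
  set (yt := fun t => b + t * k - s / mu * p1 t).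
  assert (x0 : xt 0 = a + s * h) by (unfold xt; rewrite q10; field; lra).
  assert (y0 : yt 0 = b + s * k) by (unfold yt; rewrite p10; field; lra).
  assert (cx : continuity_pt xt 0) by (unfold xt; cpt_tac).
  assert (cy : continuity_pt yt 0) by (unfold yt; cpt_tac).
  pose proof (cont2_line P xt yt 0 cP cx cy) as cPt.
  pose proof (cont2_line Q xt yt 0 cQ cx cy) as cQt.
  assert (hk : 0 < h ^ 2 + k ^ 2) by (destruct hne; nra).
  assert (reg0 : forall e, 0 < e -> exists t, 0 < t /\ Rabs (t - 0) < e /\
    0 < p1 t ^ 2 + q1 t ^ 2).
  { intros e he.
    assert (c : continuity_pt (fun t => p1 t * p1 t + q1 t * q1 t) 0) by cpt_tac.
    assert (hpos : 0 < p1 0 * p1 0 + q1 0 * q1 0).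
    { rewrite p10, q10.
      replace (- mu * k * (- mu * k) + mu * h * (mu * h)) with (mu * mu * (h ^ 2 + k ^ 2))
        by ring.
      repeat apply Rmult_lt_0_compat; trivial. }
    destruct (c _ hpos) as (del & hdel & hd).
    destruct (approach_zero (Rmin e del)) as (t & ht & hte); [apply Rmin_pos; trivial|].
    exists t; split; trivial; split.
    - eapply Rlt_le_trans; [apply hte|apply Rmin_l].
    - assert (hb : Rabs (p1 t * p1 t + q1 t * q1 t - (p1 0 * p1 0 + q1 0 * q1 0))
                   < p1 0 * p1 0 + q1 0 * q1 0).
      { apply (hd t); split; [split; [exact I|lra]|].
        eapply Rlt_le_trans; [apply hte|apply Rmin_r]. }
      apply Rabs_lt_between in hb; nra. }
  assert (facts : forall t, 0 < t -> 0 < p1 t ^ 2 + q1 t ^ 2 ->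
    - P (xt t) (yt t) * q1 t + Q (xt t) (yt t) * p1 t = 0 /\
    s / mu * (p1 t ^ 2 + q1 t ^ 2) <= P (xt t) (yt t) * p1 t + Q (xt t) (yt t) * q1 t).
  { intros t ht hreg.
    set (at_ := a + t * h); set (bt := b + t * k).
    assert (ep : P at_ bt = t * p1 t)
      by (unfold p1; destruct (Req_dec_T t 0); [lra|unfold at_, bt; field; trivial]).
    assert (eq : Q at_ bt = t * q1 t)
      by (unfold q1; destruct (Req_dec_T t 0); [lra|unfold at_, bt; field; trivial]).
    assert (hd : 0 < sqn at_ bt).
    { unfold sqn; rewrite ep, eq.
      replace ((t * p1 t) ^ 2 + (t * q1 t) ^ 2) with (t * t * (p1 t ^ 2 + q1 t ^ 2)) by ring.
      repeat apply Rmult_lt_0_compat; trivial. }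
    set (T := s / mu / t).
    assert (hT : 0 < T) by (unfold T; repeat apply Rdiv_lt_0_compat; trivial).
    assert (eT : T * t = s / mu) by (unfold T; field; split; lra).
    assert (ex : lineX at_ bt (- T) = xt t)
      by (unfold lineX, xt; rewrite eq, <- eT; unfold at_; ring).
    assert (ey : lineY at_ bt (- T) = yt t)
      by (unfold lineY, yt; rewrite ep, <- eT; unfold bt; ring).
    destruct (backward_ray at_ bt T hd) as [g1 _]; [lra|].
    assert (f0 : tangential at_ bt (- T) = 0).
    { eapply tangential_zero.
      intros r hr; rewrite Rmin_right, Rmax_left in hr by lra.
      replace r with (- - r) by ring.
      eapply backward_ray; try eassumption; lra. }
    unfold tangential, normal_part, sqn in f0, g1; cbv zeta in f0, g1.
    rewrite ex, ey, ep, eq in f0, g1.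
    split.
    - apply (Rmult_eq_reg_l t); [|lra]; rewrite Rmult_0_r, <- f0; ring.
    - apply (Rmult_le_reg_l t); trivial.
      replace (t * (s / mu * (p1 t ^ 2 + q1 t ^ 2))) with
        (T * ((t * p1 t) ^ 2 + (t * q1 t) ^ 2)) by (rewrite <- eT; ring).
      eapply Rle_trans; [apply g1|right; ring]. }
  (* Both facts pass to the limit t = 0; V stays away from 0 there because the bound of
     [backward_ray] grows linearly with the travelled time, which compensates the size t of V at the
     starting point. *)
  assert (l1 : - P (xt 0) (yt 0) * q1 0 + Q (xt 0) (yt 0) * p1 0 = 0).
  { apply (continuity_pt_limit_eq
      (fun t => - P (xt t) (yt t) * q1 t + Q (xt t) (yt t) * p1 t)).
    - cpt_tac.
    - intros e he; destruct (reg0 e he) as (t & ht & hte & hr).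
      exists t; split; trivial; apply facts; trivial. }
  assert (l2 : 0 <= P (xt 0) (yt 0) * p1 0 + Q (xt 0) (yt 0) * q1 0
                    - s / mu * (p1 0 * p1 0 + q1 0 * q1 0)).
  { apply (continuity_pt_limit_ge
      (fun t => P (xt t) (yt t) * p1 t + Q (xt t) (yt t) * q1 t
                - s / mu * (p1 t * p1 t + q1 t * q1 t))).
    - cpt_tac.
    - intros e he; destruct (reg0 e he) as (t & ht & hte & hr).
      exists t; split; trivial.
      destruct (facts t ht hr) as [_ g]; nra. }
  rewrite x0, y0, p10, q10 in l1, l2.
  set (p := P (a + s * h) (b + s * k)) in *; set (q := Q (a + s * h) (b + s * k)) in *.
  split.
  - apply (Rmult_eq_reg_l mu); lra.
  - assert (hsm : 0 < s / mu) by (apply Rdiv_lt_0_compat; trivial).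
    assert (0 < s / mu * (mu * mu * (h ^ 2 + k ^ 2)))
      by (apply Rmult_lt_0_compat; trivial; repeat apply Rmult_lt_0_compat; trivial).
    apply (Rmult_lt_reg_l mu); trivial; nra.
Qed.

(** A field vanishing identically would contradict curl V = 2. *)
Lemma minimal_field_regular_point :
  exists a b, 0 < sqn a b.
Proof.
  intros; apply NNPP; intros hn.
  assert (hz : forall x y, P x y = 0 /\ Q x y = 0).
  { intros x y; assert (~ 0 < sqn x y) by (intros h; apply hn; exists x, y; trivial).
    unfold sqn in *; split; nra. }
  specialize (hcurl 0 0).
  rewrite <- (has_grad_dx 0 0 hQ), <- (has_grad_dy 0 0 hP) in hcurl.
  unfold dx, dy in hcurl.
  rewrite (Derive_ext (fun z => Q z 0) (fun _ => 0)), Derive_const in hcurl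
    by (intros; exact (proj2 (hz _ _))).
  rewrite (Derive_ext (fun z => P 0 z) (fun _ => 0)), Derive_const in hcurl
    by (intros; exact (proj1 (hz _ _))).
  lra.
Qed.

(** A zero of V with DV (h, k) = mu J(h, k). The condition is invariant under reversing (h, k),
    which lets [singular_ray] be applied to both half-lines. *)
Definition radial_singularity (a b h k mu : R) : Prop :=
  P a b = 0 /\ Q a b = 0 /\ 0 < mu /\ (h <> 0 \/ k <> 0) /\
  Px a b * h + Py a b * k = - mu * k /\ Qx a b * h + Qy a b * k = mu * h.

Lemma radial_singularity_line a b h k mu s :
  radial_singularity a b h k mu ->
  s <> 0 ->
  P (a + s * h) (b + s * k) * h + Q (a + s * h) (b + s * k) * k = 0 /\
  (P (a + s * h) (b + s * k) <> 0 \/ Q (a + s * h) (b + s * k) <> 0).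
Proof.
  intros (hp & hq & hmu & hne & e1 & e2) hs.
  assert (H : P (a + s * h) (b + s * k) * h + Q (a + s * h) (b + s * k) * k = 0 /\
    - P (a + s * h) (b + s * k) * k + Q (a + s * h) (b + s * k) * h <> 0).
  { destruct (Rlt_dec 0 s) as [hs0|hs0].
    - destruct (singular_ray a b h k mu s) as [g1 g2]; trivial.
      split; lra.
    - destruct (singular_ray a b (- h) (- k) mu (- s)) as [g1 g2];
        trivial; try lra.
      replace (- s * - h) with (s * h) in * by ring.
      replace (- s * - k) with (s * k) in * by ring.
      split; lra. }
  destruct H as [H1 H2]; split; trivial.
  destruct (Req_dec (P (a + s * h) (b + s * k)) 0) as [e|]; [right|left; trivial].
  intros e'; apply H2; rewrite e, e'; ring.
Qed.

(** The zero is the one reached by the forward ray. On the incoming segment V is a multiple of V(p)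
    of size at least proportional to T - t; the one-sided limit of the quotient at the zero gives DV
    JV(p) = - mu V(p) with mu >= 1, and - V(p) is J applied to JV(p). *)
Lemma regular_point_singularity a b :
  0 < sqn a b ->
  exists x y mu, radial_singularity x y (- Q a b) (P a b) mu.
Proof.
  intros hd;   destruct (forward_hit a b hd) as (T & hT & hp & hq & hline).
  set (x := lineX a b T) in *; set (y := lineY a b T) in *.
  set (v1 := P a b) in *; set (v2 := Q a b) in *.
  pose proof (singular_quotient_cont _ _ _ x y (- v2) v1 hP hp) as c1.
  pose proof (singular_quotient_cont _ _ _ x y (- v2) v1 hQ hq) as c2.
  set (m1 := Px x y * - v2 + Py x y * v1) in *.
  set (m2 := Qx x y * - v2 + Qy x y * v1) in *.
  set (p1 := fun t => if Req_dec_T t 0 then m1 else P (x + t * - v2) (y + t * v1) / t) in *.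
  set (q1 := fun t => if Req_dec_T t 0 then m2 else Q (x + t * - v2) (y + t * v1) / t) in *.
  assert (p10 : p1 0 = m1) by (unfold p1; destruct (Req_dec_T 0 0); lra).
  assert (q10 : q1 0 = m2) by (unfold q1; destruct (Req_dec_T 0 0); lra).
  assert (facts : forall t, 0 < t <= T ->
    - p1 (- t) * v2 + q1 (- t) * v1 = 0 /\ p1 (- t) * v1 + q1 (- t) * v2 <= - sqn a b).
  { intros t ht.
    destruct (hline (T - t)) as [g1 g2]; [lra|].
    unfold tangential, normal_part in g1, g2; cbv zeta in g1, g2.
    assert (ex : lineX a b (T - t) = x + - t * - v2) by (unfold x, lineX, v2; ring).
    assert (ey : lineY a b (T - t) = y + - t * v1) by (unfold y, lineY, v1; ring).
    rewrite ex, ey in g1, g2; fold v1 v2 in g1, g2.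
    assert (ep : P (x + - t * - v2) (y + - t * v1) = - t * p1 (- t))
      by (unfold p1; destruct (Req_dec_T (- t) 0); [lra|field; lra]).
    assert (eq : Q (x + - t * - v2) (y + - t * v1) = - t * q1 (- t))
      by (unfold q1; destruct (Req_dec_T (- t) 0); [lra|field; lra]).
    rewrite ep, eq in g1, g2; split.
    - apply (Rmult_eq_reg_l (- t)); lra.
    - apply (Rmult_le_reg_l t); lra. }
  assert (app : forall e, 0 < e -> exists t, 0 < t <= T /\ Rabs (- t - 0) < e).
  { intros e he; exists (Rmin e T / 2).
    assert (0 < Rmin e T) by (apply Rmin_pos; lra).
    pose proof (Rmin_l e T); pose proof (Rmin_r e T).
    split; [lra|]; rewrite Rabs_left; lra. }
  assert (l1 : - p1 0 * v2 + q1 0 * v1 = 0).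
  { apply (continuity_pt_limit_eq (fun t => - p1 t * v2 + q1 t * v1)).
    - cpt_tac.
    - intros e he; destruct (app e he) as (t & ht & hte).
      exists (- t); split; trivial; apply facts; trivial. }
  assert (l2 : 0 <= - sqn a b - (p1 0 * v1 + q1 0 * v2)).
  { apply (continuity_pt_limit_ge (fun t => - sqn a b - (p1 t * v1 + q1 t * v2))).
    - cpt_tac.
    - intros e he; destruct (app e he) as (t & ht & hte).
      exists (- t); split; trivial; destruct (facts t ht); lra. }
  rewrite p10, q10 in l1, l2.
  assert (ed : sqn a b = v1 ^ 2 + v2 ^ 2) by reflexivity.
  exists x, y, (- (m1 * v1 + m2 * v2) / sqn a b).
  repeat split; trivial.
  - apply Rdiv_lt_0_compat; lra.
  - destruct (Req_dec v1 0) as [e|]; [left|right; trivial].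
    intros e'; assert (v2 = 0) by lra; rewrite ed in hd; nra.
  - fold m1.
    apply (Rmult_eq_reg_r (sqn a b)); [|lra].
    transitivity ((m1 * v1 + m2 * v2) * v1); [|field; lra].
    transitivity ((m1 * v1 + m2 * v2) * v1 - (- m1 * v2 + m2 * v1) * v2);
      [rewrite ed; ring|rewrite l1; ring].
  - fold m2.
    apply (Rmult_eq_reg_r (sqn a b)); [|lra].
    transitivity ((m1 * v1 + m2 * v2) * v2); [|field; lra].
    transitivity ((m1 * v1 + m2 * v2) * v2 + (- m1 * v2 + m2 * v1) * v1);
      [rewrite ed; ring|rewrite l1; ring].
Qed.

(* Every regular point gives a complete line on which V is orthogonal to the line and
   has a single zero, so nonparallel lines can only meet at a common zero; there DV maps
   two independent vectors to independent vectors. *)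
Lemma minimal_field_dichotomy :
  (exists a b, forall x y, P x y * (x - a) + Q x y * (y - b) = 0) \/
  (exists h k, (h <> 0 \/ k <> 0) /\ forall x y, P x y * h + Q x y * k = 0).
Proof.
  intros .
  destruct (classic (exists a b, P a b = 0 /\ Q a b = 0 /\
    Px a b * Qy a b - Py a b * Qx a b <> 0)) as [(a & b & hp & hq & hdet)|hdeg].
  - left; exists a, b; intros x y.
    destruct (singular_nondegenerate _ _ hp hq hdet)
      as (e1 & e2 & e3 & e4).
    destruct (Req_dec (x - a) 0) as [ex|ex], (Req_dec (y - b) 0) as [ey|ey];
      [rewrite ex, ey; ring| | |];
      (destruct (singular_ray a b (x - a) (y - b) 1 1 hp hq) as [g _];
       [lra|tauto|rewrite e1, e2; ring|rewrite e3, e4; ring|lra|];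
       replace (a + 1 * (x - a)) with x in g by ring;
       replace (b + 1 * (y - b)) with y in g by ring; trivial).
  - right.
    destruct (minimal_field_regular_point) as (a0 & b0 & hd0).
    destruct (regular_point_singularity _ _ hd0) as (x0 & y0 & mu0 & hs0).
    set (h0 := - Q a0 b0) in *; set (k0 := P a0 b0) in *.
    pose proof hs0 as (hp0 & hq0 & hmu0 & hne0 & e01 & e02).
    exists h0, k0; split; trivial.
    intros a b.
    destruct (Rlt_dec 0 (sqn a b)) as [hd|hd];
      [|unfold sqn in hd; assert (P a b = 0) by nra; assert (Q a b = 0) by nra; nra].
    destruct (regular_point_singularity _ _ hd) as (x & y & mu & hs).
    pose proof hs as (hp & hq & hmu & hne & e1 & e2).
    set (h := - Q a b) in *; set (k := P a b) in *.
    replace (Q a b) with (- h) by (unfold h; ring).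
    destruct (Req_dec (h0 * k - k0 * h) 0) as [|hc]; [lra|exfalso].
    (* Cramer's rule: [s0] and [s] are the parameters of the intersection point on the two lines.
       The four cases ask whether this point is the zero of V singled out on each line. *)
    set (s0 := ((x - x0) * k - (y - y0) * h) / (h0 * k - k0 * h)).
    set (s := ((x - x0) * k0 - (y - y0) * h0) / (h0 * k - k0 * h)).
    assert (ex : x0 + s0 * h0 = x + s * h) by (unfold s0, s; field; trivial).
    assert (ey : y0 + s0 * k0 = y + s * k) by (unfold s0, s; field; trivial).
    destruct (Req_dec s0 0) as [z0|z0], (Req_dec s 0) as [z|z].
    (* Common zero: DV maps the independent vectors (h0, k0) and (h, k) to positive multiples of
       their rotations, so its determinant is not 0, which the degenerate case excludes. *)
    + rewrite z0, z, !Rmult_0_l, !Rplus_0_r in *; subst x0 y0.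
      apply hdeg; exists x, y; split; [trivial|split; [trivial|]].
      set (A := Px x y) in *; set (B := Py x y) in *; set (C := Qx x y) in *;
        set (D := Qy x y) in *.
      intros hdet.
      assert (hk : (A * D - B * C) * (h0 * k - k0 * h)
        = (A * h0 + B * k0) * (C * h + D * k) - (A * h + B * k) * (C * h0 + D * k0)) by ring.
      rewrite e01, e02, e1, e2, hdet in hk.
      assert (hk' : mu0 * (mu * (h0 * k - k0 * h)) = 0) by lra.
      apply Rmult_integral in hk'; destruct hk' as [|hk']; [lra|].
      apply Rmult_integral in hk'; destruct hk'; lra.
    + destruct (radial_singularity_line _ _ _ _ _ s hs z) as [_ g].
      rewrite <- ex, <- ey, z0, !Rmult_0_l, !Rplus_0_r in g; tauto.
    + destruct (radial_singularity_line _ _ _ _ _ s0 hs0 z0) as [_ g].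
      rewrite ex, ey, z, !Rmult_0_l, !Rplus_0_r in g; tauto.
    (* V is nonzero at the intersection point but orthogonal to two independent vectors. *)
    + destruct (radial_singularity_line _ _ _ _ _ s hs z) as [g1 g2].
      destruct (radial_singularity_line _ _ _ _ _ s0 hs0 z0) as [g3 _].
      rewrite ex, ey in g3.
      set (p := P (x + s * h) (y + s * k)) in *; set (q := Q (x + s * h) (y + s * k)) in *.
      assert (e3 : p * (h0 * k - k0 * h) = (p * h0 + q * k0) * k - (p * h + q * k) * k0) by ring.
      assert (e4 : q * (h0 * k - k0 * h) = (p * h + q * k) * h0 - (p * h0 + q * k0) * h) by ring.
      rewrite g1, g3 in e3, e4.
      assert (e3' : p * (h0 * k - k0 * h) = 0) by lra.
      assert (e4' : q * (h0 * k - k0 * h) = 0) by lra.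
      apply Rmult_integral in e3', e4'; tauto.
Qed.

End MinimalField.

(** * The exponential map *)

Lemma dmetric_eq u p v w :
  dmetric u p v w = (cx u * cy v - cy u * cx v) * frT p w + frT p v * (cx u * cy w - cy u * cx w).
Proof.
  unfold dmetric; apply is_derive_unique.
  unfold metric, frX, frY, frT, vadd, vscal, cx, cy, ct; simpl.
  auto_derive; trivial; ring.
Qed.

Lemma christoffel_eq p v w :
  christoffel p v v w = 2 * frT p v * (cx v * cy w - cy v * cx w).
Proof. unfold christoffel; rewrite !dmetric_eq; field. Qed.

(** [sn], [cs] and [ks] are the integrals over [0, r] of cos (w q), sin (w q) and [cs w q]. The
    value at w = 0 is the limit, so that one formula also covers the geodesics with [frT] = 0. *)
Definition sn (w r : R) : R := if Req_dec_T w 0 then r else sin (w * r) / w.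
Definition cs (w r : R) : R := if Req_dec_T w 0 then 0 else (1 - cos (w * r)) / w.
Definition ks (w r : R) : R := if Req_dec_T w 0 then 0 else (w * r - sin (w * r)) / w ^ 2.

Lemma is_derive_sn w r : is_derive (sn w) r (cos (w * r)).
Proof.
  unfold sn; destruct (Req_dec_T w 0) as [->|h].
  - rewrite Rmult_0_l, cos_0; apply @is_derive_id.
  - auto_derive; trivial; field; trivial.
Qed.

Lemma is_derive_cs w r : is_derive (cs w) r (sin (w * r)).
Proof.
  unfold cs; destruct (Req_dec_T w 0) as [->|h].
  - rewrite Rmult_0_l, sin_0; apply @is_derive_const.
  - auto_derive; trivial; field; trivial.
Qed.

Lemma is_derive_ks w r : is_derive (ks w) r (cs w r).
Proof.
  unfold ks, cs; destruct (Req_dec_T w 0) as [->|h].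
  - apply @is_derive_const.
  - auto_derive; trivial; field; trivial.
Qed.

Lemma sn_0 w : sn w 0 = 0.
Proof. unfold sn; destruct (Req_dec_T w 0); trivial; rewrite Rmult_0_r, sin_0; field; trivial. Qed.
Lemma cs_0 w : cs w 0 = 0.
Proof. unfold cs; destruct (Req_dec_T w 0); trivial; rewrite Rmult_0_r, cos_0; field; trivial. Qed.
Lemma ks_0 w : ks w 0 = 0.
Proof. unfold ks; destruct (Req_dec_T w 0); trivial; rewrite Rmult_0_r, sin_0; field; trivial. Qed.

Lemma sn_cs_trig w r : sn w r * sin (w * r) - cs w r * cos (w * r) = cs w r.
Proof.
  unfold sn, cs; destruct (Req_dec_T w 0) as [->|h].
  - rewrite Rmult_0_l, sin_0; ring.
  - pose proof (sin2_cos2 (w * r)) as e; unfold Rsqr in e.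
    apply (Rmult_eq_reg_r w); trivial.
    transitivity (sin (w * r) * sin (w * r) + cos (w * r) * cos (w * r) - cos (w * r));
      [field; trivial|rewrite e; field; trivial].
Qed.

(* The T-component g(c', T) is conserved and the horizontal velocity rotates with
   angular speed 2 g(c', T). *)
Definition heis_geodesic (p v : H1) (r : R) : H1 :=
  let w := 2 * frT p v in
  let xi := cx v * sn w r + cy v * cs w r in
  let eta := cy v * sn w r - cx v * cs w r in
  (cx p + xi, cy p + eta,
   ct p + frT p v * r + cy p * xi - cx p * eta + (cx v ^ 2 + cy v ^ 2) * ks w r).

Definition geodesic_velocity (p v : H1) (r : R) : H1 :=
  let w := 2 * frT p v in
  let c := heis_geodesic p v r in
  let dxi := cx v * cos (w * r) + cy v * sin (w * r) in
  let deta := cy v * cos (w * r) - cx v * sin (w * r) in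
  (dxi, deta, frT p v + cy c * dxi - cx c * deta).

Definition geodesic_acceleration (p v : H1) (r : R) : H1 :=
  let w := 2 * frT p v in
  let c := heis_geodesic p v r in
  let dv := geodesic_velocity p v r in
  (w * cy dv, - w * cx dv, cy c * (w * cy dv) + cx c * (w * cx dv)).

Lemma is_derive_lin f g t l l' a b :
  is_derive f t l -> is_derive g t l' ->
  is_derive (fun t => a * f t + b * g t) t (a * l + b * l').
Proof.
  intros hf hg; apply @is_derive_plus; apply is_derive_scal; trivial.
Qed.

Lemma is_derive_Rmult (f g : R -> R) t l l' :
  is_derive f t l -> is_derive g t l' ->
  is_derive (fun t => f t * g t) t (l * g t + f t * l').
Proof. intros hf hg; apply @is_derive_mult; trivial; intros; apply Rmult_comm. Qed.

Lemma is_derive_geodesic p v r :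
  is_derive_curve (heis_geodesic p v) r (geodesic_velocity p v r).
Proof.
  set (w := 2 * frT p v).
  pose proof (is_derive_sn w r) as d1; pose proof (is_derive_cs w r) as d2;
    pose proof (is_derive_ks w r) as d3.
  assert (dx1 : is_derive (fun r => cx v * sn w r + cy v * cs w r) r
    (cx v * cos (w * r) + cy v * sin (w * r))) by (apply is_derive_lin; trivial).
  assert (dy1 : is_derive (fun r => cy v * sn w r - cx v * cs w r) r
    (cy v * cos (w * r) - cx v * sin (w * r))).
  { apply (is_derive_ext (fun r => cy v * sn w r + (- cx v) * cs w r)).
    - intros; simpl; ring.
    - evar_last; [apply is_derive_lin; eassumption|simpl; ring]. }
  split; [|split]; unfold heis_geodesic, geodesic_velocity, cx, cy, ct; simpl;
    fold (cx v) (cy v) (cx p) (cy p) (ct p); fold w.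
  - apply (is_derive_ext (fun r => cx p + (cx v * sn w r + cy v * cs w r))); trivial.
    evar_last; [apply @is_derive_plus; [apply is_derive_const|apply dx1]|].
    apply Rplus_0_l.
  - evar_last; [apply @is_derive_plus; [apply is_derive_const|apply dy1]|].
    apply Rplus_0_l.
  - evar_last.
    + apply @is_derive_plus; [apply @is_derive_minus; [apply @is_derive_plus|]|].
      * apply @is_derive_plus; [apply is_derive_const|].
        apply is_derive_scal, is_derive_id.
      * apply is_derive_scal, dx1.
      * apply is_derive_scal, dy1.
      * apply is_derive_scal, d3.
    + pose proof (sn_cs_trig w r) as e.
      unfold plus, minus, opp, plus, zero, one; simpl; unfold opp, plus; simpl.
      apply Rminus_diag_uniq.
      transitivity ((cx v ^ 2 + cy v ^ 2)
        * (cs w r - (sn w r * sin (w * r) - cs w r * cos (w * r)))); [ring|rewrite e; ring].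
Qed.

Lemma is_derive_geodesic_velocity p v r :
  is_derive_curve (geodesic_velocity p v) r (geodesic_acceleration p v r).
Proof.
  destruct (is_derive_geodesic p v r) as (h1 & h2 & _).
  set (w := 2 * frT p v).
  assert (dx1 : is_derive (fun r => cx v * cos (w * r) + cy v * sin (w * r)) r
    (w * (cy v * cos (w * r) - cx v * sin (w * r)))) by (auto_derive; trivial; ring).
  assert (dy1 : is_derive (fun r => cy v * cos (w * r) - cx v * sin (w * r)) r
    (- w * (cx v * cos (w * r) + cy v * sin (w * r)))) by (auto_derive; trivial; ring).
  split; [|split].
  - exact dx1.
  - exact dy1.
  - evar_last.
    + apply (is_derive_ext (fun r => frT p v
        + cy (heis_geodesic p v r) * (cx v * cos (w * r) + cy v * sin (w * r))
        - cx (heis_geodesic p v r) * (cy v * cos (w * r) - cx v * sin (w * r))));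
        [intros; reflexivity|].
      apply @is_derive_minus; [apply @is_derive_plus; [apply is_derive_const|]|];
        (apply @is_derive_mult; [eassumption|eassumption|intros; apply Rmult_comm]).
    + unfold geodesic_acceleration, geodesic_velocity; fold w.
      set (c := heis_geodesic p v r).
      unfold minus, plus, mult, opp, zero; simpl; unfold plus, mult, opp; simpl.
      unfold cx, cy, ct; simpl; ring.
Qed.

Lemma heis_geodesic_is_exp p v : is_exp p v (heis_geodesic p v 1).
Proof.
  exists (heis_geodesic p v).
  assert (h0 : heis_geodesic p v 0 = p).
  { unfold heis_geodesic; rewrite sn_0, cs_0, ks_0.
    destruct p as [[x y] t]; unfold cx, cy, ct; simpl.
    f_equal; [f_equal|]; ring. }
  split; [|split; [trivial|split; trivial]].
  - exists (geodesic_velocity p v), (geodesic_acceleration p v).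
    split; [apply is_derive_geodesic|split; [apply is_derive_geodesic_velocity|]].
    intros s w; rewrite christoffel_eq.
    unfold metric, geodesic_acceleration, geodesic_velocity.
    set (c := heis_geodesic p v s).
    unfold frT, frX, frY, cx, cy, ct; simpl; ring.
  - assert (e : geodesic_velocity p v 0 = v).
    { unfold geodesic_velocity; rewrite h0, Rmult_0_r, cos_0, sin_0.
      destruct v as [[v1 v2] v3]; destruct p as [[x y] t].
      unfold frT, cx, cy, ct; simpl; f_equal; [f_equal|]; ring. }
    rewrite <- e at 2; apply is_derive_geodesic.
Qed.

Lemma is_derive_zero_const (f : R -> R) : (forall s, is_derive f s 0) -> forall s, f s = f 0.
Proof.
  intros h s; destruct (MVT_gen f 0 s (fun _ => 0)) as (c & _ & e).
  - intros; apply h.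
  - intros x _; apply continuity_pt_filterlim, (ex_derive_continuous f); exists 0; apply h.
  - lra.
Qed.

Lemma is_derive_same (f g l : R -> R) :
  (forall s, is_derive f s (l s)) -> (forall s, is_derive g s (l s)) -> f 0 = g 0 ->
  forall s, f s = g s.
Proof.
  intros hf hg h0 s.
  pose proof (is_derive_zero_const (fun s => minus (f s) (g s))) as h.
  assert (e : minus (f s) (g s) = minus (f 0) (g 0)).
  { apply h; intros t; replace 0 with (minus (l t) (l t)) by apply Rminus_diag.
    apply @is_derive_minus; trivial. }
  unfold minus, plus, opp in e; simpl in e; lra.
Qed.

(** In the frame the geodesic equation says that [frT] is conserved and that the horizontal velocity
    rotates at constant speed. Undoing the rotation leaves constants, which determine the velocity
    and then the curve. *)
Lemma is_exp_unique p v q : is_exp p v q -> q = heis_geodesic p v 1.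
Proof.
  intros (c & (v' & a & hv & ha & hgeo) & hc0 & hd0 & hq).
  assert (hv0 : v' 0 = v).
  { destruct (hv 0) as (e1 & e2 & e3), hd0 as (d1 & d2 & d3).
    destruct (v' 0) as [[x1 y1] t1], v as [[x2 y2] t2].
    unfold cx, cy, ct in *; simpl in *.
    rewrite <- (is_derive_unique _ _ _ e1), <- (is_derive_unique _ _ _ e2),
      <- (is_derive_unique _ _ _ e3).
    rewrite (is_derive_unique _ _ _ d1), (is_derive_unique _ _ _ d2),
      (is_derive_unique _ _ _ d3); trivial. }
  set (g := frT p v); set (w := 2 * g).
  assert (eqs : forall s, frT (c s) (a s) = 0 /\
    cx (a s) = 2 * frT (c s) (v' s) * cy (v' s) /\
    cy (a s) = - (2 * frT (c s) (v' s) * cx (v' s))).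
  { intros s.
    (* The three test vectors are T, X and Y at c s. *)
    pose proof (hgeo s (0, 0, 1)) as k1; pose proof (hgeo s (1, 0, cy (c s))) as k2;
      pose proof (hgeo s (0, 1, - cx (c s))) as k3.
    rewrite christoffel_eq in k1, k2, k3.
    unfold metric in k1, k2, k3; unfold frX, frY in k1, k2, k3.
    assert (f1 : frT (c s) (0, 0, 1) = 1) by (unfold frT, cx, cy, ct; simpl; ring).
    assert (f2 : frT (c s) (1, 0, cy (c s)) = 0) by (unfold frT, cx, cy, ct; simpl; ring).
    assert (f3 : frT (c s) (0, 1, - cx (c s)) = 0) by (unfold frT, cx, cy, ct; simpl; ring).
    rewrite f1 in k1; rewrite f2 in k2; rewrite f3 in k3.
    set (gg := frT (c s) (v' s)) in *; set (ga := frT (c s) (a s)) in *.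
    change (cx (0, 0, 1)) with 0 in k1; change (cy (0, 0, 1)) with 0 in k1.
    change (cx (1, 0, cy (c s))) with 1 in k2; change (cy (1, 0, cy (c s))) with 0 in k2.
    change (cx (0, 1, - cx (c s))) with 0 in k3; change (cy (0, 1, - cx (c s))) with 1 in k3.
    repeat split; lra. }
  assert (hg : forall s, frT (c s) (v' s) = g).
  { intros s; unfold g; rewrite <- hc0, <- hv0.
    apply (is_derive_zero_const (fun s => frT (c s) (v' s))); clear s; intros s.
    destruct (hv s) as (e1 & e2 & e3), (ha s) as (d1 & d2 & d3).
    evar_last.
    - apply @is_derive_plus; [apply @is_derive_minus; [eassumption|]|];
        (apply @is_derive_mult; [eassumption|eassumption|intros; apply Rmult_comm]).
    - destruct (eqs s) as [e _]; unfold frT in e.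
      unfold minus, plus, mult, opp; simpl; unfold plus, mult, opp; simpl; lra. }
  assert (hx : forall s, is_derive (fun r => cx (v' r)) s (w * cy (v' s))).
  { intros s; destruct (ha s) as (d1 & _ & _), (eqs s) as (_ & e & _).
    rewrite hg in e; rewrite e in d1; trivial. }
  assert (hy : forall s, is_derive (fun r => cy (v' r)) s (- w * cx (v' s))).
  { intros s; destruct (ha s) as (_ & d1 & _), (eqs s) as (_ & _ & e).
    rewrite hg in e; rewrite e in d1; evar_last; [apply d1|unfold w; ring]. }
  assert (dcos : forall s, is_derive (fun s => cos (w * s)) s (- w * sin (w * s)))
    by (intros; auto_derive; trivial; ring).
  assert (dsin : forall s, is_derive (fun s => sin (w * s)) s (w * cos (w * s)))
    by (intros; auto_derive; trivial; ring).
  assert (rot1 : forall s, cx (v' s) * cos (w * s) - cy (v' s) * sin (w * s) = cx v).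
  { intros s.
    rewrite (is_derive_zero_const
      (fun s => cx (v' s) * cos (w * s) - cy (v' s) * sin (w * s))).
    - rewrite hv0, Rmult_0_r, cos_0, sin_0; ring.
    - intros r; evar_last.
      + exact (is_derive_minus _ _ _ _ _ (is_derive_Rmult _ _ _ _ _ (hx r) (dcos r))
          (is_derive_Rmult _ _ _ _ _ (hy r) (dsin r))).
      + unfold minus, plus, mult, opp; simpl; unfold plus, mult, opp; simpl; ring. }
  assert (rot2 : forall s, cx (v' s) * sin (w * s) + cy (v' s) * cos (w * s) = cy v).
  { intros s.
    rewrite (is_derive_zero_const
      (fun s => cx (v' s) * sin (w * s) + cy (v' s) * cos (w * s))).
    - rewrite hv0, Rmult_0_r, cos_0, sin_0; ring.
    - intros r; evar_last.
      + exact (is_derive_plus _ _ _ _ _ (is_derive_Rmult _ _ _ _ _ (hx r) (dsin r))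
          (is_derive_Rmult _ _ _ _ _ (hy r) (dcos r))).
      + unfold minus, plus, mult, opp; simpl; unfold plus, mult, opp; simpl; ring. }
  assert (vx : forall s, cx (v' s) = cx v * cos (w * s) + cy v * sin (w * s)).
  { intros s; rewrite <- (rot1 s), <- (rot2 s).
    pose proof (sin2_cos2 (w * s)) as e; unfold Rsqr in e.
    transitivity (cx (v' s) * (sin (w * s) * sin (w * s) + cos (w * s) * cos (w * s)));
      [rewrite e|]; ring. }
  assert (vy : forall s, cy (v' s) = cy v * cos (w * s) - cx v * sin (w * s)).
  { intros s; rewrite <- (rot1 s), <- (rot2 s).
    pose proof (sin2_cos2 (w * s)) as e; unfold Rsqr in e.
    transitivity (cy (v' s) * (sin (w * s) * sin (w * s) + cos (w * s) * cos (w * s)));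
      [rewrite e|]; ring. }
  pose proof (is_derive_geodesic p v) as hgd.
  assert (g0 : heis_geodesic p v 0 = p).
  { unfold heis_geodesic; rewrite sn_0, cs_0, ks_0.
    destruct p as [[x y] t]; unfold cx, cy, ct; simpl.
    f_equal; [f_equal|]; ring. }
  assert (ex : forall s, cx (c s) = cx (heis_geodesic p v s)).
  { apply (is_derive_same _ _ (fun s => cx (v' s))).
    - intros s; exact (proj1 (hv s)).
    - intros s; rewrite vx; exact (proj1 (hgd s)).
    - rewrite hc0, g0; trivial. }
  assert (ey : forall s, cy (c s) = cy (heis_geodesic p v s)).
  { apply (is_derive_same _ _ (fun s => cy (v' s))).
    - intros s; exact (proj1 (proj2 (hv s))).
    - intros s; rewrite vy; exact (proj1 (proj2 (hgd s))).
    - rewrite hc0, g0; trivial. }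
  assert (et : forall s, ct (c s) = ct (heis_geodesic p v s)).
  { apply (is_derive_same _ _ (fun s => ct (v' s))).
    - intros s; exact (proj2 (proj2 (hv s))).
    (* The vertical velocity is recovered from the conserved [frT] and the horizontal components
       already identified. *)
    - intros s; replace (ct (v' s)) with (ct (geodesic_velocity p v s)); [exact (proj2 (proj2 (hgd s)))|].
      specialize (hg s); unfold frT in hg; rewrite vx, vy, ex, ey in hg.
      unfold geodesic_velocity; fold g; fold w; unfold ct at 1; simpl; lra.
    - rewrite hc0, g0; trivial. }
  rewrite <- hq.
  specialize (ex 1); specialize (ey 1); specialize (et 1).
  destruct (c 1) as [[x1 y1] t1], (heis_geodesic p v 1) as [[x2 y2] t2].
  unfold cx, cy, ct in ex, ey, et; simpl in *; congruence.
Qed.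

Lemma exp_map_eq p v : exp_map p v = heis_geodesic p v 1.
Proof.
  apply is_exp_unique; unfold exp_map; apply epsilon_spec.
  exists (heis_geodesic p v 1); apply heis_geodesic_is_exp.
Qed.

(** * Area and calibrations *)

Lemma metric_horizontal p v :
  metric p (horizontal p v) (horizontal p v) = frX p v ^ 2 + frY p v ^ 2.
Proof.
  assert (eX : metric p v (X p) = frX p v)
    by (unfold metric, X, frX, frY, frT, cx, cy, ct; simpl; ring).
  assert (eY : metric p v (Y p) = frY p v)
    by (unfold metric, Y, frX, frY, frT, cx, cy, ct; simpl; ring).
  unfold horizontal; rewrite eX, eY.
  set (a := frX p v); set (b := frY p v).
  unfold metric, vadd, vscal, X, Y, frX, frY, frT, cx, cy, ct; simpl; ring.
Qed.

(** By the Lagrange identity the area element is the norm of the vector product n; it cancels the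
    normalization of the unit normal and leaves the horizontal length of n. When n = 0 both sides
    are 0, so the formula holds without assuming that the surface is immersed. *)
Lemma area_density p v w :
  let n := cross p v w in
  gnorm p (horizontal p (vscal (/ gnorm p n) n))
  * sqrt (metric p v v * metric p w w - metric p v w ^ 2)
  = sqrt ((frY p v * frT p w - frT p v * frY p w) ^ 2
          + (frT p v * frX p w - frX p v * frT p w) ^ 2).
Proof.
  set (n1 := frY p v * frT p w - frT p v * frY p w).
  set (n2 := frT p v * frX p w - frX p v * frT p w).
  set (n3 := frX p v * frY p w - frY p v * frX p w).
  intros n.
  assert (e1 : frX p n = n1) by (unfold n, cross; fold n1 n2 n3;
    unfold vadd, vscal, frX, X, Y, T, cx, cy, ct; simpl; ring).
  assert (e2 : frY p n = n2) by (unfold n, cross; fold n1 n2 n3;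
    unfold vadd, vscal, frY, X, Y, T, cx, cy, ct; simpl; ring).
  assert (e3 : frT p n = n3) by (unfold n, cross; fold n1 n2 n3;
    unfold vadd, vscal, frT, X, Y, T, cx, cy, ct; simpl; ring).
  assert (hn : metric p n n = n1 ^ 2 + n2 ^ 2 + n3 ^ 2)
    by (unfold metric; rewrite e1, e2, e3; ring).
  assert (hg : metric p v v * metric p w w - metric p v w ^ 2 = n1 ^ 2 + n2 ^ 2 + n3 ^ 2)
    by (unfold metric, n1, n2, n3; ring).
  assert (hh : forall k, metric p (horizontal p (vscal k n)) (horizontal p (vscal k n))
     = k ^ 2 * (n1 ^ 2 + n2 ^ 2)).
  { intros k; rewrite metric_horizontal, <- e1, <- e2.
    unfold vscal, frX, frY, cx, cy; simpl; ring. }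
  clearbody n n1 n2 n3.
  unfold gnorm; rewrite hh, hn, hg.
  set (S := n1 ^ 2 + n2 ^ 2 + n3 ^ 2).
  pose proof (pow2_ge_0 n1); pose proof (pow2_ge_0 n2); pose proof (pow2_ge_0 n3).
  rewrite sqrt_mult by (try apply pow2_ge_0; lra).
  destruct (Req_dec S 0) as [e|e].
  - assert (e' : n1 ^ 2 + n2 ^ 2 = 0) by (unfold S in e; lra).
    rewrite e', e, sqrt_0; ring.
  - assert (hS : 0 < S) by (unfold S in *; lra).
    assert (0 < / sqrt S) by (apply Rinv_0_lt_compat, sqrt_lt_R0; trivial).
    rewrite sqrt_pow2 by lra.
    field; apply Rgt_not_eq, sqrt_lt_R0; trivial.
Qed.

(** [t1] and [t2] are the values of the contact form dt - y dx + x dy on the coordinate tangent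
    vectors. *)
Lemma area_eq {f1 f1x f1y f2 f2x f2y f3 f3x f3y} a b c d :
  has_grad f1 f1x f1y -> has_grad f2 f2x f2y -> has_grad f3 f3x f3y ->
  area (fun x y => (f1 x y, f2 x y, f3 x y)) a b c d =
  RInt2 (fun x y =>
    let t1 := f3x x y - f2 x y * f1x x y + f1 x y * f2x x y in
    let t2 := f3y x y - f2 x y * f1y x y + f1 x y * f2y x y in
    sqrt ((f2x x y * t2 - t1 * f2y x y) ^ 2 + (t1 * f1y x y - f1x x y * t2) ^ 2)) a b c d.
Proof.
  intros h1 h2 h3; apply RInt2_ext_all; intros x y.
  unfold unit_normal, area_element; rewrite area_density.
  assert (ex : tangent_x (fun x y => (f1 x y, f2 x y, f3 x y)) x y
               = (f1x x y, f2x x y, f3x x y)).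
  { unfold tangent_x, cx, cy, ct; simpl.
    f_equal; [f_equal|]; eapply has_grad_dx; eassumption. }
  assert (ey : tangent_y (fun x y => (f1 x y, f2 x y, f3 x y)) x y
               = (f1y x y, f2y x y, f3y x y)).
  { unfold tangent_y, cx, cy, ct; simpl.
    f_equal; [f_equal|]; eapply has_grad_dy; eassumption. }
  rewrite ex, ey; unfold frX, frY, frT, cx, cy, ct; simpl; reflexivity.
Qed.

(** Continuity carries the vanishing outside the closed rectangle over to its boundary, as the
    integrations by parts require. *)
Lemma support_boundary f a b c d :
  cont2 f -> (forall x y, ~ (a <= x <= b /\ c <= y <= d) -> f x y = 0) ->
  (forall y, f a y = 0) /\ (forall y, f b y = 0) /\
  (forall x, f x c = 0) /\ (forall x, f x d = 0).
Proof.
  intros hf h0.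
  assert (lim : forall g z (k : R), continuity_pt g z -> k = 1 \/ k = -1 ->
    (forall t, 0 < t -> g (z + k * t) = 0) -> g z = 0).
  { intros g z k hc hk hg; apply continuity_pt_limit_eq; trivial.
    intros e he; exists (z + k * (e / 2)); split; [|apply hg; lra].
    replace (z + k * (e / 2) - z) with (k * (e / 2)) by ring.
    destruct hk as [-> | ->]; [rewrite Rabs_right|rewrite Rabs_left]; lra. }
  repeat split; intros z;
  [ apply (lim (fun x => f x z) a (-1)) | apply (lim (fun x => f x z) b 1)
  | apply (lim (fun y => f z y) c (-1)) | apply (lim (fun y => f z y) d 1) ];
  try lra; try (intros t ht; apply h0; lra);
  apply continuity_pt_filterlim;
  first [apply cont2_fst_cont; trivial | apply cont2_snd_cont; trivial].
Qed.

(** * The regularized norm and the divergence of the regularized unit field *)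

Definition reg_norm (P Q : R -> R -> R) (sg x y : R) : R :=
  sqrt (P x y ^ 2 + Q x y ^ 2 + sg ^ 2).

Lemma reg_norm_pos P Q sg x y : 0 < sg -> 0 < reg_norm P Q sg x y.
Proof.
  intros h; apply sqrt_lt_R0.
  pose proof (pow2_ge_0 (P x y)); pose proof (pow2_ge_0 (Q x y)); nra.
Qed.

Lemma reg_norm_sq P Q sg x y : reg_norm P Q sg x y ^ 2 = P x y ^ 2 + Q x y ^ 2 + sg ^ 2.
Proof.
  unfold reg_norm; rewrite pow2_sqrt; trivial.
  pose proof (pow2_ge_0 (P x y)); pose proof (pow2_ge_0 (Q x y)); pose proof (pow2_ge_0 sg).
  lra.
Qed.

Lemma reg_norm_cont P Q sg : cont2 P -> cont2 Q -> cont2 (reg_norm P Q sg).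
Proof.
  intros hP hQ; apply cont2_sqrt; [|cont2_tac].
  intros x y; pose proof (pow2_ge_0 (P x y)); pose proof (pow2_ge_0 (Q x y));
    pose proof (pow2_ge_0 sg); lra.
Qed.

Lemma has_grad_reg_norm {P Q Px Py Qx Qy} sg :
  0 < sg -> has_grad P Px Py -> has_grad Q Qx Qy ->
  has_grad (reg_norm P Q sg)
    (fun x y => (P x y * Px x y + Q x y * Qx x y) / reg_norm P Q sg x y)
    (fun x y => (P x y * Py x y + Q x y * Qy x y) / reg_norm P Q sg x y).
Proof.
  intros hsg hP hQ.
  pose proof (has_grad_cont hP) as cP; pose proof (has_grad_cont hQ) as cQ.
  pose proof (reg_norm_cont P Q sg cP cQ) as cR.
  assert (hne : forall x y, reg_norm P Q sg x y <> 0)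
    by (intros x y; apply Rgt_not_eq, reg_norm_pos; trivial).
  assert (hpos : forall x y, 0 < P x y * P x y + Q x y * Q x y + sg ^ 2)
    by (intros; nra).
  pose proof (has_grad_plus
    (has_grad_plus (has_grad_mult hP hP)
       (has_grad_mult hQ hQ)) (has_grad_const (sg ^ 2))) as hS.
  assert (eR : forall x y, sqrt (P x y * P x y + Q x y * Q x y + sg ^ 2) = reg_norm P Q sg x y)
    by (intros; unfold reg_norm; f_equal; ring).
  refine (has_grad_ext _ _ _ (has_grad_comp sqrt (fun z => / (2 * sqrt z))
    (fun x y => P x y * P x y + Q x y * Q x y + sg ^ 2) _ _ _ _ hS)).
  - intros; cbv beta; apply eR.
  - intros; cbv beta; rewrite eR; field; apply hne.
  - intros; cbv beta; rewrite eR; field; apply hne.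
  - intros x y; apply is_derive_Reals, derivable_pt_lim_sqrt, hpos.
  - apply (cont2_ext (fun x y => / (2 * reg_norm P Q sg x y))).
    + intros; rewrite eR; trivial.
    + apply cont2_inv; [cont2_tac|].
      intros x y; specialize (hne x y); lra.
Qed.

Lemma has_grad_inv {f fx fy} :
  has_grad f fx fy -> (forall x y, f x y <> 0) ->
  has_grad (fun x y => / f x y) (fun x y => - fx x y / f x y ^ 2)
    (fun x y => - fy x y / f x y ^ 2).
Proof.
  intros hf hne; pose proof (has_grad_cont hf) as cf.
  refine (has_grad_ext _ _ _
    (has_grad_comp Rinv (fun z => - / z ^ 2) f fx fy _ _ hf)).
  - trivial.
  - intros; cbv beta; field; apply hne.
  - intros; cbv beta; field; apply hne.
  - intros x y; auto_derive; [apply hne|field; apply hne].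
  - apply cont2_opp, cont2_inv; [cont2_tac|].
    intros x y; apply pow_nonzero, hne.
Qed.

Definition reg_div (P Q Px Py Qx Qy : R -> R -> R) (sg x y : R) : R :=
  (Q x y ^ 2 * Px x y - P x y * Q x y * (Py x y + Qx x y) + P x y ^ 2 * Qy x y
   + sg ^ 2 * (Px x y + Qy x y)) / reg_norm P Q sg x y ^ 3.

Lemma reg_div_cont P Q Px Py Qx Qy sg :
  0 < sg -> has_grad P Px Py -> has_grad Q Qx Qy -> cont2 (reg_div P Q Px Py Qx Qy sg).
Proof.
  intros hsg hP hQ.
  pose proof (has_grad_cont hP) as cP; pose proof (has_grad_cont hQ) as cQ.
  destruct hP as (_ & _ & ? & ?), hQ as (_ & _ & ? & ?).
  pose proof (reg_norm_cont P Q sg cP cQ).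
  apply cont2_div; [cont2_tac|cont2_tac|].
  intros x y; apply pow_nonzero, Rgt_not_eq, reg_norm_pos; trivial.
Qed.

(* [reg_div] is the divergence of the regularized unit field V / sqrt (|V|^2 + sg^2). *)
Lemma reg_divergence {P Q Px Py Qx Qy} f fx fy sg a b c d :
  0 < sg -> c <= d -> has_grad P Px Py -> has_grad Q Qx Qy -> has_grad f fx fy ->
  (forall y, f a y = 0) -> (forall y, f b y = 0) ->
  (forall x, f x c = 0) -> (forall x, f x d = 0) ->
  RInt2 (fun x y => (fx x y * P x y + fy x y * Q x y) / reg_norm P Q sg x y) a b c d
  = - RInt2 (fun x y => f x y * reg_div P Q Px Py Qx Qy sg x y) a b c d.
Proof.
  intros hsg hcd hP hQ hf ha hb hc hd.
  pose proof (has_grad_cont hP) as cP; pose proof (has_grad_cont hQ) as cQ;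
    pose proof (has_grad_cont hf) as cf.
  pose proof (reg_norm_cont P Q sg cP cQ) as cR.
  assert (hne : forall x y, reg_norm P Q sg x y <> 0)
    by (intros x y; apply Rgt_not_eq, reg_norm_pos; trivial).
  pose proof (has_grad_inv (has_grad_reg_norm sg hsg hP hQ) hne) as hI.
  pose proof (has_grad_mult hf (has_grad_mult hP hI)) as hFP.
  pose proof (has_grad_mult hf (has_grad_mult hQ hI)) as hFQ.
  cbv beta in hFP, hFQ.
  assert (z1 := RInt2_dx _ _ _ a b c d hcd hFP); cbv beta in z1.
  assert (z2 := RInt2_dy _ _ _ a b c d hcd hFQ); cbv beta in z2.
  specialize (z1 (fun y => Rmult_eq_0_compat_r _ _ (ha y))
    (fun y => Rmult_eq_0_compat_r _ _ (hb y))).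
  specialize (z2 (fun x => Rmult_eq_0_compat_r _ _ (hc x))
    (fun x => Rmult_eq_0_compat_r _ _ (hd x))).
  pose proof (reg_div_cont _ _ _ _ _ _ sg hsg hP hQ) as cN.
  (* The integrand is the full divergence of f V / [reg_norm], split by the product rule. *)
  assert (z : RInt2 (fun x y => (fx x y * P x y + fy x y * Q x y) / reg_norm P Q sg x y
      + f x y * reg_div P Q Px Py Qx Qy sg x y) a b c d = 0).
  { rewrite <- (Rplus_0_l 0); rewrite <- z1 at 1; rewrite <- z2.
    rewrite <- RInt2_plus; trivial; [|apply hFP|apply hFQ].
    apply RInt2_ext_all; intros x y; unfold reg_div.
    pose proof (reg_norm_sq P Q sg x y) as e.
    assert (e3 : P x y ^ 2 = reg_norm P Q sg x y ^ 2 - Q x y ^ 2 - sg ^ 2) by lra.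
    specialize (hne x y).
    set (r := reg_norm P Q sg x y) in *.
    apply (Rmult_eq_reg_r (r ^ 3)); [|apply pow_nonzero; trivial].
    field_simplify; trivial.
    clearbody r.
    assert (e4 : P x y ^ 3 = P x y * (r ^ 2 - Q x y ^ 2 - sg ^ 2)) by (rewrite <- e3; ring).
    try rewrite e4; try rewrite e3; ring. }
  rewrite RInt2_plus in z; trivial; [lra| |cont2_tac].
  apply cont2_div; trivial; destruct hf as (_ & _ & ? & ?); cont2_tac.
Qed.

(** * Vertical variations of a graph *)

Definition gradP (u : R -> R -> R) (x y : R) : R := dx u x y - y.
Definition gradQ (u : R -> R -> R) (x y : R) : R := dy u x y + x.

Lemma has_grad_gradP u : C2 u ->
  has_grad (gradP u) (dx (dx u)) (fun x y => dy (dx u) x y - 1).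
Proof.
  intros (_ & h & _); generalize (has_grad_minus (C1_has_grad h) has_grad_snd).
  apply has_grad_ext; intros; unfold gradP; ring.
Qed.

Lemma has_grad_gradQ u : C2 u ->
  has_grad (gradQ u) (fun x y => dx (dy u) x y + 1) (dy (dy u)).
Proof.
  intros (_ & _ & h); generalize (has_grad_plus (C1_has_grad h) has_grad_fst).
  apply has_grad_ext; intros; unfold gradQ; ring.
Qed.

(** A vertical initial vector has no horizontal velocity to rotate, so its geodesic is the vertical
    line and the variation is again a graph. *)
Lemma variation_vertical u f s :
  variation (graph_param u) (fun x y => (0, 0, f x y)) s
  = fun x y => (x, y, u x y + s * f x y).
Proof.
  apply functional_extensionality; intros x; apply functional_extensionality; intros y.
  unfold variation; rewrite exp_map_eq.
  unfold heis_geodesic, graph_param, vscal, frT, cx, cy, ct; simpl.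
  f_equal; [f_equal|]; ring.
Qed.

Lemma area_vertical u f fx fy s a b c d :
  C2 u -> has_grad f fx fy ->
  area (variation (graph_param u) (fun x y => (0, 0, f x y)) s) a b c d
  = RInt2 (fun x y => sqrt ((gradP u x y + s * fx x y) ^ 2 + (gradQ u x y + s * fy x y) ^ 2))
      a b c d.
Proof.
  intros (hu & _ & _) hf; rewrite variation_vertical.
  rewrite (area_eq a b c d has_grad_fst has_grad_snd
    (has_grad_plus (C1_has_grad hu) (has_grad_scal s hf))).
  apply RInt2_ext_all; intros x y; cbv zeta; f_equal; unfold gradP, gradQ; ring.
Qed.

(** Cauchy-Schwarz against V / r, a vector of length at most 1, bounds |V + v| below by <V, V + v> /
    r, where v = (p, q). The term |V|^2 / r loses at most [sg] against |V| because |V| <= r <= |V| +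
    sg. The estimate is one-sided but valid also at V = 0. *)
Lemma calibration_ge P Q p q sg :
  0 < sg -> (P * p + Q * q) / sqrt (P ^ 2 + Q ^ 2 + sg ^ 2) - sg
            <= sqrt ((P + p) ^ 2 + (Q + q) ^ 2) - sqrt (P ^ 2 + Q ^ 2).
Proof.
  intros hsg; set (r := sqrt (P ^ 2 + Q ^ 2 + sg ^ 2)).
  set (n := sqrt (P ^ 2 + Q ^ 2)); set (m := sqrt ((P + p) ^ 2 + (Q + q) ^ 2)).
  assert (hr : 0 < r) by (apply sqrt_lt_R0; nra).
  assert (er : r ^ 2 = P ^ 2 + Q ^ 2 + sg ^ 2) by (apply pow2_sqrt; nra).
  assert (en : n ^ 2 = P ^ 2 + Q ^ 2) by (apply pow2_sqrt; nra).
  assert (em : m ^ 2 = (P + p) ^ 2 + (Q + q) ^ 2)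
    by (apply pow2_sqrt, Rplus_le_le_0_compat; apply pow2_ge_0).
  assert (hn : 0 <= n) by apply sqrt_pos.
  assert (hm : 0 <= m) by apply sqrt_pos.
  assert (hcs : P * (P + p) + Q * (Q + q) <= n * m).
  {
    destruct (Rle_dec (P * (P + p) + Q * (Q + q)) 0) as [h|h]; [nra|].
    apply Rsqr_incr_0_var; [|nra]; unfold Rsqr.
    replace (n * m * (n * m)) with (n ^ 2 * m ^ 2) by ring; rewrite en, em.
    assert (0 <= (P * (Q + q) - Q * (P + p)) ^ 2) by apply pow2_ge_0; nra. }
  assert (hnr : n <= r) by nra.
  assert (hrn : r <= n + sg) by nra.
  apply (Rmult_le_reg_r r); trivial.
  replace (((P * p + Q * q) / r - sg) * r) with (P * p + Q * q - sg * r) by (field; lra).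
  nra.
Qed.

(* The field V / sqrt (|V|^2 + sg^2) calibrates the area up to an error sg; its
   divergence therefore cannot have a definite sign against a test function. *)
Lemma stationary_weak u f fx fy a b c d c0 sg0 :
  C2 u -> area_stationary (graph_param u) -> has_grad f fx fy -> a < b -> c < d ->
  (forall x y, ~ (a <= x <= b /\ c <= y <= d) -> f x y = 0) -> 0 < c0 -> 0 < sg0 ->
  (forall sg, 0 < sg < sg0 ->
     c0 <= RInt2 (fun x y => f x y * reg_div (gradP u) (gradQ u) (dx (dx u))
       (fun x y => dy (dx u) x y - 1) (fun x y => dx (dy u) x y + 1) (dy (dy u)) sg x y)
       a b c d) ->
  False.
Proof.
  intros hu hst hf hab hcd hsup hc0 hsg0 hdiv.
  pose proof (has_grad_gradP u hu) as hP; pose proof (has_grad_gradQ u hu) as hQ.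
  pose proof (has_grad_cont hP) as cP; pose proof (has_grad_cont hQ) as cQ;
    pose proof (has_grad_cont hf) as cf.
  destruct (support_boundary f a b c d cf hsup) as (za & zb & zc & zd).
  specialize (hst (fun x y => (0, 0, f x y)) a b c d).
  assert (hder : is_derive (fun s => area (variation (graph_param u)
     (fun x y => (0, 0, f x y)) s) a b c d) 0 0).
  { apply hst; trivial.
    - split; [|split]; unfold cx, cy, ct; simpl.
      + eapply has_grad_C1, has_grad_const.
      + eapply has_grad_C1, has_grad_const.
      + eapply has_grad_C1, hf.
    - intros x y h; rewrite (hsup x y h); trivial. }
  clear hst; apply is_derive_Reals in hder.
  destruct (hder (c0 / 4)) as [del hdel]; [lra|].
  (* With [s] negative the linear term is |s| times the integral of f [reg_div], at least |s| c0:
     the area would have to grow at first order. *)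
  set (s := - (del / 2)).
  pose proof (cond_pos del) as hdp.
  assert (hs : s <> 0) by (unfold s; lra).
  assert (hsd : Rabs s < del) by (unfold s; rewrite Rabs_left; lra).
  specialize (hdel s hs hsd).
  rewrite Rplus_0_l, !(area_vertical u f fx fy) in hdel by trivial.
  set (A := fun s => RInt2 (fun x y =>
     sqrt ((gradP u x y + s * fx x y) ^ 2 + (gradQ u x y + s * fy x y) ^ 2)) a b c d) in *.
  fold (A s) (A 0) in hdel.
  assert (hub : A s - A 0 < c0 / 4 * (del / 2)).
  { replace ((A s - A 0) / s - 0) with ((A s - A 0) / s) in hdel by ring.
    apply Rabs_lt_between in hdel; destruct hdel as [h1 h2].
    replace (A s - A 0) with ((A s - A 0) / s * s) by (field; trivial).
    unfold s in *; nra. }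
  set (K := (b - a) * (d - c)).
  assert (hK : 0 < K) by (unfold K; apply Rmult_lt_0_compat; lra).
  (* [sg] is chosen after [s]: the calibration error is at most |s| c0 / 2, so the area grows by at
     least |s| c0 / 2, whereas the zero derivative allows less than |s| c0 / 4. *)
  set (sg := Rmin (sg0 / 2) (c0 * (del / 2) / 2 / K)).
  assert (hk2 : 0 < c0 * (del / 2) / 2 / K) by (repeat apply Rdiv_lt_0_compat; nra).
  assert (hsg : 0 < sg < sg0).
  { split; [apply Rmin_pos; lra|].
    eapply Rle_lt_trans; [apply Rmin_l|lra]. }
  assert (hsK : sg * K <= c0 * (del / 2) / 2).
  { replace (c0 * (del / 2) / 2) with (c0 * (del / 2) / 2 / K * K) by (field; lra).
    apply Rmult_le_compat_r; [lra|apply Rmin_r]. }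
  specialize (hdiv sg hsg); destruct hsg as [hsg hsg'].
  assert (z := reg_divergence f fx fy sg a b c d hsg (Rlt_le _ _ hcd) hP hQ hf
    za zb zc zd).
  pose proof (reg_norm_cont _ _ sg cP cQ) as cR.
  assert (hne : forall x y, reg_norm (gradP u) (gradQ u) sg x y <> 0)
    by (intros x y; apply Rgt_not_eq, reg_norm_pos; trivial).
  destruct hf as (hfx & hfy & cfx & cfy).
  assert (cW : cont2 (fun x y => (fx x y * gradP u x y + fy x y * gradQ u x y)
    / reg_norm (gradP u) (gradQ u) sg x y)) by (apply cont2_div; trivial; cont2_tac).
  assert (cA : forall s, cont2 (fun x y =>
     sqrt ((gradP u x y + s * fx x y) ^ 2 + (gradQ u x y + s * fy x y) ^ 2))).
  { intros r; apply cont2_sqrt; [|cont2_tac].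
    intros x y; apply Rplus_le_le_0_compat; apply pow2_ge_0. }
  assert (hle : s * RInt2 (fun x y => (fx x y * gradP u x y + fy x y * gradQ u x y)
    / reg_norm (gradP u) (gradQ u) sg x y) a b c d - (b - a) * ((d - c) * sg) <= A s - A 0).
  { rewrite <- (RInt2_const sg a b c d).
    rewrite <- RInt2_scal, <- RInt2_minus; try lra; trivial; try apply cont2_const; [|cont2_tac].
    unfold A; rewrite <- RInt2_minus; try lra; trivial.
    apply RInt2_le; try lra; [cont2_tac|apply cont2_minus; trivial|].
    intros x y _ _.
    replace (gradP u x y + 0 * fx x y) with (gradP u x y) by ring.
    replace (gradQ u x y + 0 * fy x y) with (gradQ u x y) by ring.
    eapply Rle_trans; [|apply calibration_ge, hsg].
    right; unfold reg_norm, Rdiv; ring. }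
  rewrite z in hle.
  set (I0 := RInt2 (fun x y => f x y * _) a b c d) in *.
  assert (h1 : del / 2 * c0 <= del / 2 * I0) by (apply Rmult_le_compat_l; lra).
  assert (h2 : (b - a) * ((d - c) * sg) = sg * K) by (unfold K; ring).
  assert (h3 : s * - I0 = del / 2 * I0) by (unfold s; ring).
  rewrite h2, h3 in hle.
  assert (0 < c0 * (del / 2)) by (apply Rmult_lt_0_compat; lra).
  lra.
Qed.

(** * Test functions and localization *)

Lemma cont2_near f x0 y0 eps : cont2 f -> 0 < eps ->
  exists del, 0 < del /\ forall x y, Rabs (x - x0) <= del -> Rabs (y - y0) <= del ->
    Rabs (f x y - f x0 y0) < eps.
Proof.
  intros hf he; destruct (hf x0 y0 (mkposreal _ he)) as [d hd]; simpl in hd.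
  pose proof (cond_pos d).
  exists (d / 2); split; [lra|]; intros x y hx hy; apply hd; lra.
Qed.

(** The squared positive part is C^1, which is all the regularity that a test function needs. *)
Lemma is_derive_pos_part_sq z : is_derive (fun z => Rmax 0 z ^ 2) z (2 * Rmax 0 z).
Proof.
  destruct (Rtotal_order z 0) as [h|[h|h]].
  - apply (is_derive_ext_loc (fun _ => 0)).
    + assert (hp : 0 < - z) by lra.
      exists (mkposreal _ hp); intros t ht.
      unfold ball in ht; simpl in ht; unfold AbsRing_ball, abs, minus, plus, opp in ht;
        simpl in ht; apply Rabs_lt_between in ht.
      rewrite Rmax_left by lra; simpl; ring.
    + rewrite Rmax_left by lra; rewrite Rmult_0_r; apply @is_derive_const.
  - subst z; rewrite Rmax_left by lra; rewrite Rmult_0_r.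
    apply is_derive_Reals; intros eps heps; exists (mkposreal _ heps); simpl.
    intros t ht htd; rewrite Rplus_0_l, (Rmax_left 0 0) by lra.
    destruct (Rle_dec 0 t) as [h|h].
    + rewrite Rmax_right by trivial.
      replace ((t * (t * 1) - 0 * (0 * 1)) / t - 0) with t by (field; trivial); trivial.
    + rewrite Rmax_left by lra.
      replace ((0 * (0 * 1) - 0 * (0 * 1)) / t - 0) with 0 by (field; trivial).
      rewrite Rabs_R0; trivial.
  - apply (is_derive_ext_loc (fun z => z ^ 2)).
    + exists (mkposreal _ h); intros t ht.
      unfold ball in ht; simpl in ht; unfold AbsRing_ball, abs, minus, plus, opp in ht;
        simpl in ht; apply Rabs_lt_between in ht.
      rewrite Rmax_right by lra; simpl; ring.
    + rewrite Rmax_right by lra; auto_derive; trivial; ring.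
Qed.

Lemma Rmax0_continuity_pt z : continuity_pt (fun z => 2 * Rmax 0 z) z.
Proof.
  apply (continuity_pt_locally_ext (fun z => z + Rabs z) _ 1); [lra| |].
  - intros y _; unfold Rmax, Rabs; destruct (Rle_dec 0 y), (Rcase_abs y); lra.
  - apply (continuity_pt_plus (fun z => z) Rabs); [reg|apply Rcontinuity_abs].
Qed.

Lemma bump_exists x0 y0 r : 0 < r ->
  exists f fx fy k, has_grad f fx fy /\ 0 < k /\ (forall x y, 0 <= f x y) /\
    (forall x y, ~ (x0 - r <= x <= x0 + r /\ y0 - r <= y <= y0 + r) -> f x y = 0) /\
    (forall x y, Rabs (x - x0) <= r / 2 -> Rabs (y - y0) <= r / 2 -> k <= f x y).
Proof.
  intros hr.
  pose proof (has_grad_minus (has_grad_const (r * r))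
    (has_grad_mult
      (has_grad_minus has_grad_fst (has_grad_const x0))
      (has_grad_minus has_grad_fst (has_grad_const x0)))) as h1.
  pose proof (has_grad_minus (has_grad_const (r * r))
    (has_grad_mult
      (has_grad_minus has_grad_snd (has_grad_const y0))
      (has_grad_minus has_grad_snd (has_grad_const y0)))) as h2.
  assert (hcomp : forall f fx fy, has_grad f fx fy ->
    has_grad (fun x y => Rmax 0 (f x y) ^ 2) (fun x y => 2 * Rmax 0 (f x y) * fx x y)
      (fun x y => 2 * Rmax 0 (f x y) * fy x y)).
  { intros f fx fy h.
    refine (has_grad_comp (fun z => Rmax 0 z ^ 2) (fun z => 2 * Rmax 0 z) f fx fy _ _ h).
    - intros; apply is_derive_pos_part_sq.
    - apply (cont2_comp (fun z => 2 * Rmax 0 z)); [apply Rmax0_continuity_pt|eapply has_grad_cont, h]. }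
  pose proof (has_grad_mult (hcomp _ _ _ h1) (hcomp _ _ _ h2)) as h.
  cbv beta in h.
  (* On the half-size square each of r^2 - (x - x0)^2 and r^2 - (y - y0)^2 is at least 3/4 r^2. *)
  eexists _, _, _, ((3 / 4 * (r * r)) ^ 2 * (3 / 4 * (r * r)) ^ 2).
  split; [exact h|split; [|split; [|split]]]; clear h h1 h2 hcomp.
  - apply Rmult_lt_0_compat; apply pow_lt; nra.
  - intros x y; apply Rmult_le_pos; apply pow2_ge_0.
  - intros x y hout.
    destruct (Rle_dec (r * r - (x - x0) * (x - x0)) 0) as [hx|hx].
    + rewrite (Rmax_left 0 (r * r - (x - x0) * (x - x0))) by trivial; ring.
    + destruct (Rle_dec (r * r - (y - y0) * (y - y0)) 0) as [hy|hy].
      * rewrite (Rmax_left 0 (r * r - (y - y0) * (y - y0))) by trivial; ring.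
      * exfalso; apply hout; nra.
  - intros x y hx hy; apply Rabs_le_between in hx; apply Rabs_le_between in hy.
    rewrite !Rmax_right by nra.
    apply Rmult_le_compat; try apply pow2_ge_0; apply pow_incr; nra.
Qed.

(** Testing with a bump of sign [e]: the sign of the divergence on its support makes every
    contribution nonnegative, and on the rectangle, inside the half-size square, the bump is at
    least k, so a mass bounded below uniformly in [sg] contradicts [stationary_weak]. *)
Lemma stationary_local u x0 y0 r a b c d e k0 sg0 :
  C2 u -> area_stationary (graph_param u) -> 0 < r ->
  x0 - r / 2 <= a -> a <= b -> b <= x0 + r / 2 ->
  y0 - r / 2 <= c -> c <= d -> d <= y0 + r / 2 ->
  e = 1 \/ e = -1 -> 0 < k0 -> 0 < sg0 ->
  let N := reg_div (gradP u) (gradQ u) (dx (dx u))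
       (fun x y => dy (dx u) x y - 1) (fun x y => dx (dy u) x y + 1) (dy (dy u)) in
  (forall sg, 0 < sg < sg0 ->
     (forall x y, Rabs (x - x0) <= r -> Rabs (y - y0) <= r -> 0 <= e * N sg x y) /\
     k0 <= RInt2 (fun x y => e * N sg x y) a b c d) -> False.
Proof.
  intros hu hst hr ha hab hb hc hcd hd he hk0 hsg0 N hN.
  destruct (bump_exists x0 y0 r hr) as (f & fx & fy & k & hf & hk & hf0 & hsup & hfk).
  pose proof (has_grad_cont hf) as cf.
  assert (hk1 : 0 < k * k0) by (apply Rmult_lt_0_compat; trivial).
  refine (stationary_weak u _ _ _ (x0 - r) (x0 + r) (y0 - r) (y0 + r) (k * k0) sg0 hu hst
    (has_grad_scal e hf) _ _ _ hk1 hsg0 _); try lra.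
  - intros x y h; rewrite (hsup x y h); ring.
  - intros sg hsg; fold N.
    destruct (hN sg hsg) as [hpos hint].
    assert (cN : cont2 (N sg))
      by (apply reg_div_cont; [lra|apply has_grad_gradP|apply has_grad_gradQ]; trivial).
    assert (sq : forall x y, x0 - r <= x <= x0 + r -> y0 - r <= y <= y0 + r ->
      0 <= e * N sg x y) by (intros x y hx hy; apply hpos; apply Rabs_le_between; lra).
    apply Rle_trans with (RInt2 (fun x y => f x y * (e * N sg x y)) a b c d).
    + apply Rle_trans with (RInt2 (fun x y => k * (e * N sg x y)) a b c d).
      * rewrite RInt2_scal; trivial; [|cont2_tac].
        apply Rmult_le_compat_l; lra.
      * apply RInt2_le; trivial; try cont2_tac.
        intros x y hx hy; apply Rmult_le_compat_r; [apply sq; lra|].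
        apply hfk; apply Rabs_le_between; lra.
    + rewrite (RInt2_ext_all (fun x y => e * f x y * N sg x y)
        (fun x y => f x y * (e * N sg x y))) by (intros; ring).
      apply RInt2_sub; try lra; [cont2_tac|].
      intros x y hx hy; apply Rmult_le_pos; auto.
Qed.

(** Were the expression nonzero at a point, [reg_div] would keep its sign nearby and a size bounded
    below independently of [sg]. *)
Lemma stationary_equation u :
  C2 u -> area_stationary (graph_param u) -> forall x y,
  gradQ u x y ^ 2 * dx (dx u) x y
  - gradP u x y * gradQ u x y * (dy (dx u) x y - 1 + (dx (dy u) x y + 1))
  + gradP u x y ^ 2 * dy (dy u) x y = 0.
Proof.
  intros hu hst x0 y0.
  pose proof (has_grad_gradP u hu) as hP; pose proof (has_grad_gradQ u hu) as hQ.
  pose proof (has_grad_cont hP) as cP; pose proof (has_grad_cont hQ) as cQ.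
  pose proof hP as (_ & _ & cPx & cPy); pose proof hQ as (_ & _ & cQx & cQy).
  set (Ef := fun x y => gradQ u x y ^ 2 * dx (dx u) x y
  - gradP u x y * gradQ u x y * (dy (dx u) x y - 1 + (dx (dy u) x y + 1))
  + gradP u x y ^ 2 * dy (dy u) x y).
  change (Ef x0 y0 = 0).
  destruct (Req_dec (Ef x0 y0) 0) as [|hne]; trivial; exfalso.
  assert (cE : cont2 Ef).
  { unfold Ef; apply cont2_plus; [apply cont2_minus|]; cont2_tac.
 }
  assert (he : exists e, (e = 1 \/ e = -1) /\ 0 < e * Ef x0 y0).
  { destruct (Rlt_dec 0 (Ef x0 y0)); [exists 1|exists (-1)]; split; try lra; auto. }
  destruct he as (e & he & hpos).
  set (e0 := e * Ef x0 y0) in *.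
  destruct (cont2_near Ef x0 y0 (e0 / 2) cE) as (d1 & hd1 & h1); [lra|].
  destruct (cont2_near (fun x y => dx (dx u) x y + dy (dy u) x y) x0 y0 1) as (d2 & hd2 & h2);
    [cont2_tac|lra|].
  destruct (cont2_near (fun x y => gradP u x y ^ 2 + gradQ u x y ^ 2) x0 y0 1)
    as (d3 & hd3 & h3); [cont2_tac|lra|].
  set (T0 := Rabs (dx (dx u) x0 y0 + dy (dy u) x0 y0) + 1) in *.
  set (B := gradP u x0 y0 ^ 2 + gradQ u x0 y0 ^ 2 + 1).
  assert (hB : 0 < B + 1)
    by (unfold B; pose proof (pow2_ge_0 (gradP u x0 y0)); pose proof (pow2_ge_0 (gradQ u x0 y0));
        lra).
  assert (hT0 : 0 < T0) by (unfold T0; pose proof (Rabs_pos (dx (dx u) x0 y0 + dy (dy u) x0 y0));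
    lra).
  set (r := Rmin d1 (Rmin d2 d3)).
  assert (hr : 0 < r) by (unfold r; repeat apply Rmin_pos; trivial).
  assert (hr1 : r <= d1) by apply Rmin_l.
  assert (hr2 : r <= d2) by (eapply Rle_trans; [apply Rmin_r|apply Rmin_l]).
  assert (hr3 : r <= d3) by (eapply Rle_trans; [apply Rmin_r|apply Rmin_r]).
  (* This keeps sg^2 times the trace below e0 / 4, half of the margin e0 / 2 that the main term has
     near the point. *)
  set (sg0 := Rmin 1 (e0 / 4 / T0)).
  assert (hsg0 : 0 < sg0) by (apply Rmin_pos; [lra|repeat apply Rdiv_lt_0_compat; lra]).
  (* Near the point |V|^2 <= B, and sg <= 1, so the denominator of [reg_div] is at most sqrt (B +
     1)^3. *)
  set (k := e0 / 4 / sqrt (B + 1) ^ 3).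
  assert (hk : 0 < k).
  { apply Rdiv_lt_0_compat; [lra|apply pow_lt, sqrt_lt_R0; trivial]. }
  assert (hkr : 0 < (x0 + r / 2 - (x0 - r / 2)) * ((y0 + r / 2 - (y0 - r / 2)) * k))
    by (apply Rmult_lt_0_compat; [lra|apply Rmult_lt_0_compat; [lra|exact hk]]).
  refine (stationary_local u x0 y0 r (x0 - r / 2) (x0 + r / 2) (y0 - r / 2) (y0 + r / 2)
    e _ sg0 hu hst hr _ _ _ _ _ _ he hkr hsg0 _); try lra.
  intros sg hsg.
  set (N := reg_div (gradP u) (gradQ u) (dx (dx u))
       (fun x y => dy (dx u) x y - 1) (fun x y => dx (dy u) x y + 1) (dy (dy u)) sg).
  assert (cN : cont2 N) by (apply reg_div_cont; trivial; lra).
  assert (hlow : forall x y, Rabs (x - x0) <= r -> Rabs (y - y0) <= r -> k <= e * N x y).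
  { intros x y hx hy.
    specialize (h1 x y ltac:(lra) ltac:(lra)); specialize (h2 x y ltac:(lra) ltac:(lra));
      specialize (h3 x y ltac:(lra) ltac:(lra)); cbv beta in *.
    set (tr := dx (dx u) x y + dy (dy u) x y) in *.
    assert (htr : Rabs tr <= T0).
    { unfold T0; set (tr0 := dx (dx u) x0 y0 + dy (dy u) x0 y0) in *.
      replace tr with (tr0 + (tr - tr0)) by ring.
      eapply Rle_trans; [apply Rabs_triang|lra]. }
    assert (hEf : e0 / 2 <= e * Ef x y).
    { apply Rabs_lt_between in h1; unfold e0 in *; destruct he as [-> | ->]; lra. }
    assert (hsq : sg ^ 2 * T0 <= e0 / 4).
    { assert (sg ^ 2 <= sg) by (unfold sg0 in hsg; pose proof (Rmin_l 1 (e0 / 4 / T0)); nra).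
      assert (sg <= e0 / 4 / T0)
        by (unfold sg0 in hsg; pose proof (Rmin_r 1 (e0 / 4 / T0)); lra).
      replace (e0 / 4) with (e0 / 4 / T0 * T0) by (field; lra).
      apply Rmult_le_compat_r; lra. }
    assert (hnum : e0 / 4 <= e * (Ef x y + sg ^ 2 * tr)).
    { rewrite Rmult_plus_distr_l.
      assert (Rabs (e * (sg ^ 2 * tr)) <= sg ^ 2 * T0).
      { rewrite !Rabs_mult, (Rabs_right (sg ^ 2)) by (apply Rle_ge, pow2_ge_0).
        replace (Rabs e) with 1 by (destruct he as [-> | ->]; [rewrite Rabs_right|
          rewrite Rabs_left]; lra).
        rewrite Rmult_1_l; apply Rmult_le_compat_l; [apply pow2_ge_0|trivial]. }
      apply Rabs_le_between in H; lra. }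
    pose proof (reg_norm_pos (gradP u) (gradQ u) sg x y (proj1 hsg)) as hR.
    assert (hRB : reg_norm (gradP u) (gradQ u) sg x y <= sqrt (B + 1)).
    { apply sqrt_le_1_alt; apply Rabs_lt_between in h3; unfold B.
      assert (sg ^ 2 <= 1) by (unfold sg0 in hsg; pose proof (Rmin_l 1 (e0 / 4 / T0)); nra).
      lra. }
    unfold k, N, reg_div, Rdiv; fold tr.
    fold (Ef x y).
    rewrite <- Rmult_assoc.
    apply Rmult_le_compat; trivial; [lra| |].
    - apply Rlt_le, Rinv_0_lt_compat, pow_lt, sqrt_lt_R0; trivial.
    - apply Rinv_le_contravar; [apply pow_lt; trivial|apply pow_incr; lra]. }
  split.
  - intros x y hx hy; specialize (hlow x y hx hy); fold N; lra.
  - fold N; rewrite <- RInt2_const; apply RInt2_le; try lra; [apply cont2_const|cont2_tac|].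
    intros x y hx hy; apply hlow; apply Rabs_le_between; lra.
Qed.

(* For V = f m with m a constant unit vector, the divergence of V / sqrt (|V|^2 + sg^2) is
   this density times the derivative of f along m; its mass concentrates on f = 0. *)
Definition line_density (f : R -> R -> R) (sg x y : R) : R :=
  sg ^ 2 / sqrt (f x y ^ 2 + sg ^ 2) ^ 3.

Lemma sqrt_sq_plus_pos z sg : 0 < sg -> 0 < sqrt (z ^ 2 + sg ^ 2).
Proof. intros h; apply sqrt_lt_R0; pose proof (pow2_ge_0 z); nra. Qed.

Lemma line_density_cont f sg : 0 < sg -> cont2 f -> cont2 (line_density f sg).
Proof.
  intros hsg hf; unfold line_density.
  assert (cont2 (fun x y => sqrt (f x y ^ 2 + sg ^ 2))).
  { apply cont2_sqrt; [|cont2_tac].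
    intros x y; apply Rplus_le_le_0_compat; apply pow2_ge_0. }
  apply cont2_div; [cont2_tac|cont2_tac|].
  intros x y; apply pow_nonzero, Rgt_not_eq, sqrt_sq_plus_pos; trivial.
Qed.

Lemma line_density_pos f sg x y : 0 < sg -> 0 < line_density f sg x y.
Proof.
  intros h; apply Rdiv_lt_0_compat; apply pow_lt; trivial; apply sqrt_sq_plus_pos; trivial.
Qed.

Lemma line_density_RInt f fx fy sg x c d :
  0 < sg -> has_grad f fx fy ->
  RInt (fun y => fy x y * line_density f sg x y) c d
  = f x d / sqrt (f x d ^ 2 + sg ^ 2) - f x c / sqrt (f x c ^ 2 + sg ^ 2).
Proof.
  intros hsg hf; pose proof (has_grad_cont hf) as cf.
  apply is_RInt_unique.
  apply (is_RInt_derive (V := R_CompleteNormedModule)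
    (fun y => f x y / sqrt (f x y ^ 2 + sg ^ 2))).
  - intros y _.
    pose proof (sqrt_sq_plus_pos (f x y) sg hsg) as hp.
    assert (hg : is_derive (fun z => z / sqrt (z ^ 2 + sg ^ 2)) (f x y)
      (line_density f sg x y)).
    { assert (hq : 0 < f x y ^ 2 + sg ^ 2) by (pose proof (pow2_ge_0 (f x y)); nra).
      assert (hs : sqrt (f x y ^ 2 + sg ^ 2) ^ 2 = f x y ^ 2 + sg ^ 2)
        by (apply pow2_sqrt; lra).
      auto_derive.
      - replace (f x y * (f x y * 1) + sg * (sg * 1)) with (f x y ^ 2 + sg ^ 2) by ring.
        repeat split; trivial; apply Rgt_not_eq; trivial.
      - unfold line_density.
        replace (f x y * (f x y * 1) + sg * (sg * 1)) with (f x y ^ 2 + sg ^ 2) by ring.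
        set (s := sqrt (f x y ^ 2 + sg ^ 2)) in *.
        replace (sg ^ 2) with (s ^ 2 - f x y ^ 2) by (rewrite hs; ring).
        clearbody s; field; lra. }
    apply (is_derive_comp (fun z => z / sqrt (z ^ 2 + sg ^ 2)) (fun y => f x y)); trivial.
    apply hf.
  - intros y _; apply (cont2_snd_cont (fun x y => fy x y * line_density f sg x y)).
    pose proof (line_density_cont f sg hsg cf); destruct hf as (_ & _ & ? & ?); cont2_tac.
Qed.

(** The quotient increases in [z] and decreases in [sg], so the extreme case z = eta, sg = 1 bounds
    it uniformly in [sg]. *)
Lemma normalized_ge z eta sg :
  0 < eta -> eta <= z -> 0 < sg < 1 -> eta / sqrt (eta ^ 2 + 1) <= z / sqrt (z ^ 2 + sg ^ 2).
Proof.
  intros he hz hsg.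
  pose proof (sqrt_sq_plus_pos z sg (proj1 hsg)) as h1.
  pose proof (sqrt_sq_plus_pos eta 1 Rlt_0_1) as h2; rewrite pow1 in h2.
  set (s := sqrt (z ^ 2 + sg ^ 2)) in *; set (r := sqrt (eta ^ 2 + 1)) in *.
  assert (es : s ^ 2 = z ^ 2 + sg ^ 2) by (apply pow2_sqrt; nra).
  assert (er : r ^ 2 = eta ^ 2 + 1) by (apply pow2_sqrt; nra).
  apply (Rmult_le_reg_r (s * r)); [apply Rmult_lt_0_compat; trivial|].
  replace (eta / r * (s * r)) with (eta * s) by (field; lra).
  replace (z / s * (s * r)) with (z * r) by (field; lra).
  apply Rsqr_incr_0_var; [|nra]; unfold Rsqr.
  replace (eta * s * (eta * s)) with (eta ^ 2 * s ^ 2) by ring.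
  replace (z * r * (z * r)) with (z ^ 2 * r ^ 2) by ring.
  rewrite es, er.
  assert (eta ^ 2 <= z ^ 2) by nra.
  assert (sg ^ 2 <= 1) by nra.
  assert (0 <= eta ^ 2) by nra.
  nra.
Qed.

(** In y, f / sqrt (f^2 + sg^2) is a primitive of [fy] times the density, and it passes from at most
    - j to at least j across the zero, whatever [sg]. Dividing by an upper bound of [fy] bounds the
    mass of the density itself. *)
Lemma line_density_lower_y_pos f fx fy x0 y0 del :
  has_grad f fx fy -> f x0 y0 = 0 -> 0 < fy x0 y0 -> 0 < del ->
  exists p r k, 0 < p <= del /\ 0 < r <= del /\ 0 < k /\ forall sg, 0 < sg < 1 ->
    k <= RInt2 (line_density f sg) (x0 - p) (x0 + p) (y0 - r) (y0 + r).
Proof.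
  intros hf h0 hpos hdel; pose proof (has_grad_cont hf) as cf.
  set (m := fy x0 y0) in *.
  destruct (cont2_near fy x0 y0 (m / 2)) as (d1 & hd1 & h1); [apply hf|lra|].
  set (r := Rmin d1 del).
  assert (hr : 0 < r) by (apply Rmin_pos; trivial).
  assert (hr1 : r <= d1) by apply Rmin_l.
  assert (hr2 : r <= del) by apply Rmin_r.
  (* By the mean value theorem |f| is at least r m / 2 = 2 eta at height r above and below the zero;
     moving x by at most [p] costs at most [eta]. *)
  set (eta := m * r / 4).
  assert (heta : 0 < eta) by (unfold eta; nra).
  destruct (cont2_near f x0 (y0 + r) eta cf heta) as (d2 & hd2 & h2).
  destruct (cont2_near f x0 (y0 - r) eta cf heta) as (d3 & hd3 & h3).
  assert (hfy : forall x y, Rabs (x - x0) <= r -> Rabs (y - y0) <= r ->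
    m / 2 < fy x y < 3 / 2 * m).
  { intros x y hx hy; specialize (h1 x y ltac:(lra) ltac:(lra)); fold m in h1.
    apply Rabs_lt_between in h1; lra. }
  assert (mvt : forall y, Rabs (y - y0) <= r -> exists z, Rabs (z - y0) <= r /\
    f x0 y = fy x0 z * (y - y0)).
  { intros y hy; apply Rabs_le_between in hy.
    destruct (MVT_gen (fun y => f x0 y) y0 y (fun y => fy x0 y)) as (z & hz & e).
    - intros; apply hf.
    - intros w _; apply continuity_pt_filterlim, cont2_snd_cont, cf.
    - exists z; rewrite h0 in e; split; [|lra].
      apply Rabs_le_between.
      revert hz; unfold Rmin, Rmax; destruct (Rle_dec y0 y); lra. }
  assert (hup : 2 * eta <= f x0 (y0 + r)).
  { destruct (mvt (y0 + r)) as (z & hz & e); [rewrite Rabs_right; lra|].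
    rewrite e; destruct (hfy x0 z) as [g _]; trivial;
      [rewrite Rminus_diag, Rabs_R0; lra|].
    unfold eta; nra. }
  assert (hdn : f x0 (y0 - r) <= - (2 * eta)).
  { destruct (mvt (y0 - r)) as (z & hz & e); [rewrite Rabs_left; lra|].
    rewrite e; destruct (hfy x0 z) as [g _]; trivial;
      [rewrite Rminus_diag, Rabs_R0; lra|].
    unfold eta; nra. }
  set (p := Rmin r (Rmin d2 d3)).
  assert (hp : 0 < p) by (unfold p; repeat apply Rmin_pos; trivial).
  assert (hp1 : p <= r) by apply Rmin_l.
  assert (hp2 : p <= d2) by (eapply Rle_trans; [apply Rmin_r|apply Rmin_l]).
  assert (hp3 : p <= d3) by (eapply Rle_trans; [apply Rmin_r|apply Rmin_r]).
  set (j := eta / sqrt (eta ^ 2 + 1)).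
  assert (hj : 0 < j).
  { apply Rdiv_lt_0_compat; trivial.
    pose proof (sqrt_sq_plus_pos eta 1 Rlt_0_1) as h; rewrite pow1 in h; trivial. }
  set (l := 2 * j / (3 / 2 * m)).
  assert (hl : 0 < l) by (apply Rdiv_lt_0_compat; lra).
  exists p, r, ((x0 + p - (x0 - p)) * l).
  split; [lra|split; [lra|split; [apply Rmult_lt_0_compat; lra|]]].
  intros sg hsg.
  pose proof (line_density_cont f sg (proj1 hsg) cf) as cl.
  assert (inner : forall x, x0 - p <= x <= x0 + p ->
    l <= RInt (fun y => line_density f sg x y) (y0 - r) (y0 + r)).
  { intros x hx.
    assert (hx' : Rabs (x - x0) <= p) by (apply Rabs_le_between; lra).
    assert (g1 : eta <= f x (y0 + r)).
    { specialize (h2 x (y0 + r) ltac:(lra)); rewrite Rminus_diag, Rabs_R0 in h2.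
      specialize (h2 ltac:(lra)); apply Rabs_lt_between in h2; lra. }
    assert (g2 : eta <= - f x (y0 - r)).
    { specialize (h3 x (y0 - r) ltac:(lra)); rewrite Rminus_diag, Rabs_R0 in h3.
      specialize (h3 ltac:(lra)); apply Rabs_lt_between in h3; lra. }
    apply (normalized_ge _ _ sg heta) in g1; trivial.
    apply (normalized_ge _ _ sg heta) in g2; trivial.
    fold j in g1, g2.
    replace ((- f x (y0 - r)) ^ 2) with (f x (y0 - r) ^ 2) in g2 by ring.
    pose proof (line_density_RInt f fx fy sg x (y0 - r) (y0 + r) (proj1 hsg) hf) as e.
    assert (hle : RInt (fun y => fy x y * line_density f sg x y) (y0 - r) (y0 + r)
      <= RInt (fun y => 3 / 2 * m * line_density f sg x y) (y0 - r) (y0 + r)).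
    { apply RInt_le; try lra.
      - apply (cont2_ex_RInt (fun x y => fy x y * line_density f sg x y)).
        destruct hf as (_ & _ & ? & ?); cont2_tac.
      - apply (cont2_ex_RInt (fun x y => 3 / 2 * m * line_density f sg x y)); cont2_tac.
      - intros y hy; apply Rmult_le_compat_r.
        + apply Rlt_le, line_density_pos, hsg.
        + apply Rlt_le, hfy; [lra|apply Rabs_le_between; lra]. }
    rewrite (RInt_scal (V := R_CompleteNormedModule) (fun y => line_density f sg x y)) in hle
      by (apply cont2_ex_RInt; trivial).
    change (scal (3 / 2 * m) (RInt (fun y => line_density f sg x y) (y0 - r) (y0 + r)))
      with (3 / 2 * m * RInt (fun y => line_density f sg x y) (y0 - r) (y0 + r)) in hle.
    rewrite e in hle.
    apply (Rmult_le_reg_l (3 / 2 * m)); [lra|].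
    replace (3 / 2 * m * l) with (2 * j) by (unfold l; field; lra).
    unfold Rdiv in *; lra. }
  replace ((x0 + p - (x0 - p)) * l) with (RInt (fun _ => l) (x0 - p) (x0 + p))
    by (rewrite RInt_const; reflexivity).
  apply RInt_le; try lra.
  - apply ex_RInt_const.
  - apply cont2_ex_RInt2; trivial; lra.
  - intros x hx; apply inner; lra.
Qed.

Lemma line_density_opp f sg x y : line_density (fun x y => - f x y) sg x y = line_density f sg x y.
Proof. unfold line_density; do 3 f_equal; ring. Qed.

Lemma line_density_lower_y f fx fy x0 y0 del :
  has_grad f fx fy -> f x0 y0 = 0 -> fy x0 y0 <> 0 -> 0 < del ->
  exists p r k, 0 < p <= del /\ 0 < r <= del /\ 0 < k /\ forall sg, 0 < sg < 1 ->
    k <= RInt2 (line_density f sg) (x0 - p) (x0 + p) (y0 - r) (y0 + r).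
Proof.
  intros hf h0 hne hdel.
  destruct (Rlt_dec 0 (fy x0 y0)) as [h|h].
  - eapply line_density_lower_y_pos; eassumption.
  - destruct (line_density_lower_y_pos _ _ _ x0 y0 del (has_grad_opp hf))
      as (p & r & k & hp & hr & hk & hint); try lra.
    exists p, r, k; split; [trivial|split; [trivial|split; [trivial|]]].
    intros sg hsg; eapply Rle_trans; [apply hint, hsg|right].
    apply RInt2_ext_all; intros; apply line_density_opp.
Qed.

Lemma line_density_lower f fx fy x0 y0 del :
  has_grad f fx fy -> f x0 y0 = 0 -> fx x0 y0 <> 0 \/ fy x0 y0 <> 0 -> 0 < del ->
  exists p r k, 0 < p <= del /\ 0 < r <= del /\ 0 < k /\ forall sg, 0 < sg < 1 ->
    k <= RInt2 (line_density f sg) (x0 - p) (x0 + p) (y0 - r) (y0 + r).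
Proof.
  intros hf h0 [hne|hne] hdel; [|eapply line_density_lower_y; eassumption].
  destruct (line_density_lower_y _ _ _ y0 x0 del (has_grad_swap hf))
    as (p & r & k & hp & hr & hk & hint); trivial.
  exists r, p, k; split; [trivial|split; [trivial|split; [trivial|]]].
  intros sg hsg; rewrite RInt2_fubini; try lra; [apply hint, hsg|].
  apply line_density_cont; [lra|eapply has_grad_cont, hf].
Qed.

(* Where |V| = |f| vanishes transversally and the divergence term does not, the
   divergence of the regularized field concentrates on the curve f = 0. *)
Lemma stationary_divergence_zero u f fx fy x0 y0 :
  C2 u -> area_stationary (graph_param u) -> has_grad f fx fy ->
  (forall x y, gradP u x y ^ 2 + gradQ u x y ^ 2 = f x y ^ 2) ->
  f x0 y0 = 0 -> fx x0 y0 <> 0 \/ fy x0 y0 <> 0 ->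
  dx (dx u) x0 y0 + dy (dy u) x0 y0 = 0.
Proof.
  intros hu hst hf hn h0 hne; pose proof (has_grad_cont hf) as cf.
  pose proof (has_grad_gradP u hu) as hP; pose proof (has_grad_gradQ u hu) as hQ.
  pose proof hP as (_ & _ & cPx & cPy); pose proof hQ as (_ & _ & cQx & cQy).
  pose proof (stationary_equation u hu hst) as heq.
  set (tr := fun x y => dx (dx u) x y + dy (dy u) x y).
  change (tr x0 y0 = 0); apply NNPP; intros htr.
  assert (he : exists e, (e = 1 \/ e = -1) /\ 0 < e * tr x0 y0).
  { destruct (Rlt_dec 0 (tr x0 y0)); [exists 1|exists (-1)]; split; try lra; auto. }
  destruct he as (e & he & hpos).
  set (m := e * tr x0 y0) in *.
  destruct (cont2_near tr x0 y0 (m / 2)) as (r & hr & h1);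
    [unfold tr; cont2_tac|lra|].
  assert (htr' : forall x y, Rabs (x - x0) <= r -> Rabs (y - y0) <= r -> m / 2 <= e * tr x y).
  { intros x y hx hy; specialize (h1 x y hx hy); apply Rabs_lt_between in h1.
    unfold m in *; destruct he as [-> | ->]; lra. }
  destruct (line_density_lower f fx fy x0 y0 (r / 2) hf h0 hne) as
    (p & q & k & hp & hq & hk & hint); [lra|].
  assert (hk' : 0 < m / 2 * k) by (apply Rmult_lt_0_compat; lra).
  refine (stationary_local u x0 y0 r (x0 - p) (x0 + p) (y0 - q) (y0 + q) e (m / 2 * k) 1
    hu hst hr _ _ _ _ _ _ he hk' Rlt_0_1 _); try lra.
  intros sg hsg.
  set (N := reg_div (gradP u) (gradQ u) (dx (dx u))
       (fun x y => dy (dx u) x y - 1) (fun x y => dx (dy u) x y + 1) (dy (dy u)) sg).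
  assert (cN : cont2 N) by (apply reg_div_cont; trivial; lra).
  (* The equation cancels every term of the numerator except sg^2 times the trace. *)
  assert (eN : forall x y, N x y = tr x y * line_density f sg x y).
  { intros x y; unfold N, reg_div, line_density, reg_norm; rewrite heq, hn.
    unfold tr, Rdiv; ring. }
  pose proof (line_density_cont f sg (proj1 hsg) cf) as cl.
  assert (hN : forall x y, Rabs (x - x0) <= r -> Rabs (y - y0) <= r ->
    m / 2 * line_density f sg x y <= e * N x y).
  { intros x y hx hy; rewrite eN, <- Rmult_assoc.
    apply Rmult_le_compat_r; [apply Rlt_le, line_density_pos, hsg|auto]. }
  split.
  - intros x y hx hy; fold N; eapply Rle_trans; [|apply hN; trivial].
    apply Rmult_le_pos; [lra|apply Rlt_le, line_density_pos, hsg].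
  - fold N; apply Rle_trans with (m / 2 * RInt2 (line_density f sg) (x0 - p) (x0 + p) (y0 - q) (y0 + q)).
    + apply Rmult_le_compat_l; [lra|apply hint, hsg].
    + rewrite <- RInt2_scal by (trivial; lra).
      apply RInt2_le; try lra; [cont2_tac|cont2_tac|].
      intros x y hx hy; apply hN; apply Rabs_le_between; lra.
Qed.

(** * Classification of stationary graphs *)

Lemma unit_vector_angle c s : c ^ 2 + s ^ 2 = 1 -> exists th, cos th = c /\ sin th = s.
Proof.
  intros h; assert (hc : -1 <= c <= 1) by nra.
  assert (hs : sqrt (1 - c²) = Rabs s)
    by (rewrite <- sqrt_Rsqr_abs; f_equal; unfold Rsqr; lra).
  destruct (Rle_dec 0 s) as [h0|h0].
  - exists (acos c); rewrite cos_acos, sin_acos, hs, Rabs_right; trivial; lra.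
  - exists (- acos c); rewrite cos_neg, sin_neg, cos_acos, sin_acos, hs, Rabs_left; trivial; lra.
Qed.

(** The saddle is evaluated at the point turned back by - th, since the graph itself is turned by
    th. *)
Definition rotated_saddle (th a b x y : R) : R :=
  let x' := cos th * x + sin th * y in let y' := - sin th * x + cos th * y in
  x' * y' + (a * y' + b).

Lemma rotated_saddle_image u th a b :
  (forall x y, u x y = rotated_saddle th a b x y) <->
  (forall p, graph u p <->
     image (rotation th) (graph (fun x y => x * y + (a * y + b))) p).
Proof.
  pose proof (sin2_cos2 th) as e; unfold Rsqr in e.
  set (s := sin th) in *; set (c := cos th) in *.
  assert (e1 : forall x y, c * (c * x - s * y) + s * (s * x + c * y) = x)
    by (intros; transitivity ((s * s + c * c) * x); [ring|rewrite e; ring]).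
  assert (e2 : forall x y, - s * (c * x - s * y) + c * (s * x + c * y) = y)
    by (intros; transitivity ((s * s + c * c) * y); [ring|rewrite e; ring]).
  split.
  - intros hu [[x y] t]; split.
    + intros h; exists (c * x + s * y, - s * x + c * y, t); split.
      * unfold graph, cx, cy, ct in *; simpl in *; rewrite h, hu.
        unfold rotated_saddle; fold s c; reflexivity.
      * unfold rotation, cx, cy, ct; simpl; fold s c.
        f_equal; f_equal.
        -- transitivity ((s * s + c * c) * x); [ring|rewrite e; ring].
        -- transitivity ((s * s + c * c) * y); [ring|rewrite e; ring].
    + intros ([[x' y'] t'] & hq & hp); unfold rotation in hp.
      unfold graph, cx, cy, ct in *; simpl in *; fold s c in hp.
      injection hp as <- <- <-.
      rewrite hu, hq; unfold rotated_saddle; fold s c.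
      rewrite e1, e2; reflexivity.
  - intros H x y.
    destruct (proj1 (H (x, y, u x y)) eq_refl) as ([[x' y'] t'] & hq & hp).
    unfold rotation in hp; unfold graph, cx, cy, ct in *; simpl in *; fold s c in hp.
    injection hp as hx hy ht.
    rewrite <- ht, hq; unfold rotated_saddle; fold s c; rewrite <- hx, <- hy.
    rewrite e1, e2; reflexivity.
Qed.

Lemma stationary_minimal_field u :
  C2 u -> area_stationary (graph_param u) ->
  minimal_field (gradP u) (gradQ u) (dx (dx u)) (fun x y => dy (dx u) x y - 1)
    (fun x y => dx (dy u) x y + 1) (dy (dy u)).
Proof.
  intros hu hst; split; [|split; [|split]].
  - apply has_grad_gradP, hu.
  - apply has_grad_gradQ, hu.
  - intros x y; rewrite (Schwarz_C2 u x y hu); ring.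
  - apply stationary_equation; trivial.
Qed.

(** Orthogonality of V to the radius says that along the segment from (a, b) to (x, y) the rate of u
    is Y (x - a) - X (y - b), with (X, Y) the current point. The multiples of the radius cancel,
    leaving the constant b (x - a) - a (y - b). *)
Lemma radial_field_plane u a b :
  C2 u -> (forall x y, gradP u x y * (x - a) + gradQ u x y * (y - b) = 0) ->
  forall x y, u x y = u a b + b * (x - a) - a * (y - b).
Proof.
  intros (hu & _ & _) h x y.
  pose proof (C1_has_grad hu) as hg; pose proof (has_grad_cont hg) as cu.
  destruct (MVT_gen (fun s => u (a + s * (x - a)) (b + s * (y - b))
     - s * (b * (x - a) - a * (y - b))) 0 1 (fun _ => 0)) as (z & _ & e).
  - rewrite Rmin_left, Rmax_right by lra; intros s hs.
    evar_last.
    + apply @is_derive_minus.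
      * apply (has_grad_chain u (dx u) (dy u) (fun s => a + s * (x - a))
          (fun s => b + s * (y - b)) s (x - a) (y - b)); trivial; auto_derive; trivial; ring.
      * apply (is_derive_ext (fun s => (b * (x - a) - a * (y - b)) * s));
          [intros; simpl; ring|].
        apply is_derive_scal, @is_derive_id.
    + specialize (h (a + s * (x - a)) (b + s * (y - b))).
      unfold gradP, gradQ in h.
      set (p := dx u _ _) in *; set (q := dy u _ _) in *.
      unfold minus, plus, opp, one; simpl.
      (* At parameter [s] the hypothesis carries a factor [s], nonzero in the open interval of the
         mean value theorem. *)
      apply (Rmult_eq_reg_l s); [|lra].
      rewrite Rmult_0_r, <- h; ring.
  - intros s _; apply (continuity_pt_minus (fun s => u (a + s * (x - a)) (b + s * (y - b)))
      (fun s => s * (b * (x - a) - a * (y - b)))); [|reg].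
    apply (cont2_line u (fun s => a + s * (x - a)) (fun s => b + s * (y - b)));
      trivial; reg.
  - rewrite !Rmult_0_l, !Rmult_1_l, !Rplus_0_r in e.
    replace (a + (x - a)) with x in e by ring.
    replace (b + (y - b)) with y in e by ring.
    lra.
Qed.

(** With n = (c, s) and V = f Jn, curl V = 2 says that f has derivative 2 along n. So every line
    along n crosses f = 0, and the gradient of f is constant on it: what stationarity yields on the
    curve f = 0 spreads to the whole plane. *)
Lemma parallel_field_saddle u c s :
  C2 u -> area_stationary (graph_param u) -> c ^ 2 + s ^ 2 = 1 ->
  (forall x y, gradP u x y * c + gradQ u x y * s = 0) ->
  exists a b, forall x y, u x y =
    (c * x + s * y) * (- s * x + c * y) + (a * (- s * x + c * y) + b).
Proof.
  intros hu hst hcs hpar.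
  pose proof (has_grad_gradP u hu) as hP; pose proof (has_grad_gradQ u hu) as hQ.
  pose proof (has_grad_plus (has_grad_scal (- s) hP)
    (has_grad_scal c hQ)) as hf; cbv beta in hf.
  set (f := fun x y => - s * gradP u x y + c * gradQ u x y) in *.
  set (fx := fun x y => - s * dx (dx u) x y + c * (dx (dy u) x y + 1)) in *.
  set (fy := fun x y => - s * (dy (dx u) x y - 1) + c * dy (dy u) x y) in *.
  assert (eP : forall x y, gradP u x y = - s * f x y).
  { intros x y; unfold f.
    transitivity ((c ^ 2 + s ^ 2) * gradP u x y
      - c * (gradP u x y * c + gradQ u x y * s)); [rewrite hcs, hpar|]; ring. }
  assert (eQ : forall x y, gradQ u x y = c * f x y).
  { intros x y; unfold f.
    transitivity ((c ^ 2 + s ^ 2) * gradQ u x y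
      - s * (gradP u x y * c + gradQ u x y * s)); [rewrite hcs, hpar|]; ring. }
  assert (hP' : has_grad (gradP u) (fun x y => - s * fx x y) (fun x y => - s * fy x y)).
  { refine (has_grad_ext _ _ _ (has_grad_scal (- s) hf)); trivial.
    intros; symmetry; apply eP. }
  assert (hQ' : has_grad (gradQ u) (fun x y => c * fx x y) (fun x y => c * fy x y)).
  { refine (has_grad_ext _ _ _ (has_grad_scal c hf)); trivial.
    intros; symmetry; apply eQ. }
  assert (ePx : forall x y, dx (dx u) x y = - s * fx x y).
  { intros x y; rewrite <- (has_grad_dx x y hP), (has_grad_dx x y hP'); trivial. }
  assert (ePy : forall x y, dy (dx u) x y - 1 = - s * fy x y).
  { intros x y; rewrite <- (has_grad_dy x y hP'), (has_grad_dy x y hP); trivial. }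
  assert (eQx : forall x y, dx (dy u) x y + 1 = c * fx x y).
  { intros x y; rewrite <- (has_grad_dx x y hQ'), (has_grad_dx x y hQ); trivial. }
  assert (eQy : forall x y, dy (dy u) x y = c * fy x y).
  { intros x y; rewrite <- (has_grad_dy x y hQ), (has_grad_dy x y hQ'); trivial. }
  assert (hn : forall x y, c * fx x y + s * fy x y = 2).
  { intros x y; pose proof (Schwarz_C2 u x y hu); pose proof (ePy x y); pose proof (eQx x y).
    lra. }
  assert (shift : forall t x y, f (x + t * c) (y + t * s) = f x y + 2 * t).
  { intros t x y.
    destruct (MVT_gen (fun t => f (x + t * c) (y + t * s)) 0 t (fun _ => 2)) as (z & _ & e).
    - intros r _; evar_last.
      + apply (has_grad_chain f fx fy (fun r => x + r * c) (fun r => y + r * s) r c s hf);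
          auto_derive; trivial; ring.
      + cbv beta; rewrite <- (hn (x + r * c) (y + r * s)); ring.
    - intros r _; apply (cont2_line f (fun r => x + r * c) (fun r => y + r * s));
        [eapply has_grad_cont, hf|reg|reg].
    - rewrite !Rmult_0_l, !Rplus_0_r in e; lra. }
  assert (shift_grad : forall t x y, fx (x + t * c) (y + t * s) = fx x y /\
    fy (x + t * c) (y + t * s) = fy x y).
  { intros t x y; split.
    - assert (d1 : is_derive (fun z => f (z + t * c) (y + t * s)) x
        (fx (x + t * c) (y + t * s))).
      { evar_last.
        - apply (has_grad_chain f fx fy (fun z => z + t * c) (fun _ => y + t * s) x 1 0 hf);
            auto_derive; trivial; ring.
        - cbv beta; ring. }
      apply (is_derive_ext _ (fun z => f z y + 2 * t)) in d1; [|intros; apply shift].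
      apply is_derive_unique in d1; rewrite <- d1; apply is_derive_unique.
      evar_last; [apply @is_derive_plus; [exact (proj1 hf x y)|apply @is_derive_const]|].
      apply Rplus_0_r.
    - assert (d1 : is_derive (fun z => f (x + t * c) (z + t * s)) y
        (fy (x + t * c) (y + t * s))).
      { evar_last.
        - apply (has_grad_chain f fx fy (fun _ => x + t * c) (fun z => z + t * s) y 0 1 hf);
            auto_derive; trivial; ring.
        - cbv beta; ring. }
      apply (is_derive_ext _ (fun z => f x z + 2 * t)) in d1; [|intros; apply shift].
      apply is_derive_unique in d1; rewrite <- d1; apply is_derive_unique.
      evar_last; [apply @is_derive_plus; [exact (proj1 (proj2 hf) x y)|apply @is_derive_const]|].
      apply Rplus_0_r. }
  (* The left-hand side is the derivative of f along Jn and equals u_xx + u_yy. It vanishes where f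
     = 0, and the shift by t along n reaches such a point without changing it. *)
  assert (htr : forall x y, - s * fx x y + c * fy x y = 0).
  { intros x y.
    set (t := - (f x y / 2)).
    destruct (shift_grad t x y) as [gx gy].
    rewrite <- gx, <- gy, <- ePx, <- eQy.
    apply (stationary_divergence_zero u f fx fy); trivial.
    - intros x1 y1; rewrite eP, eQ.
      transitivity ((c ^ 2 + s ^ 2) * f x1 y1 ^ 2); [ring|rewrite hcs; ring].
    - rewrite shift; unfold t; field.
    - destruct (Req_dec (fx (x + t * c) (y + t * s)) 0) as [z|]; [right|left; trivial].
      intros z'; specialize (hn (x + t * c) (y + t * s)); rewrite z, z' in hn; lra. }
  assert (efx : forall x y, fx x y = 2 * c).
  { intros x y; transitivity ((c ^ 2 + s ^ 2) * fx x y); [rewrite hcs; ring|].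
    transitivity (c * (c * fx x y + s * fy x y) - s * (- s * fx x y + c * fy x y));
      [ring|rewrite hn, htr; ring]. }
  assert (efy : forall x y, fy x y = 2 * s).
  { intros x y; transitivity ((c ^ 2 + s ^ 2) * fy x y); [rewrite hcs; ring|].
    transitivity (s * (c * fx x y + s * fy x y) + c * (- s * fx x y + c * fy x y));
      [ring|rewrite hn, htr; ring]. }
  assert (ef : forall x y, f x y = 2 * (c * x + s * y) + f 0 0).
  { assert (hlin : has_grad (fun x y => 2 * c * x + 2 * s * y) (fun _ _ => 2 * c)
      (fun _ _ => 2 * s)).
    { generalize (has_grad_plus (has_grad_scal (2 * c) has_grad_fst)
        (has_grad_scal (2 * s) has_grad_snd)); apply has_grad_ext; intros; ring. }
    intros x y.
    pose proof (has_grad_zero_const (has_grad_minus hf hlin)) as hz.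
    cbv beta in hz; specialize (hz ltac:(intros; rewrite efx; ring)
      ltac:(intros; rewrite efy; ring) x y); lra. }
  (* The gradient of f being 2 n, the parameter of the saddle is the constant term of f. *)
  set (a := f 0 0) in *.
  exists a, (u 0 0).
  intros x y.
  pose proof (has_grad_plus (has_grad_scal c has_grad_fst)
    (has_grad_scal s has_grad_snd)) as h1.
  pose proof (has_grad_plus (has_grad_scal (- s) has_grad_fst)
    (has_grad_scal c has_grad_snd)) as h2.
  pose proof (has_grad_plus (has_grad_mult h1 h2)
    (has_grad_scal a h2)) as h3.
  pose proof (has_grad_minus (C1_has_grad (proj1 hu)) h3) as h4.
  pose proof (has_grad_zero_const h4) as hz; cbv beta in hz.
  assert (e : u x y - ((c * x + s * y) * (- s * x + c * y) + a * (- s * x + c * y)) = u 0 0).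
  { rewrite hz; [ring| |].
    - intros x1 y1; pose proof (eP x1 y1) as e; unfold gradP in e; rewrite ef in e.
      replace (dx u x1 y1) with (y1 + - s * (2 * (c * x1 + s * y1) + a)) by lra.
      transitivity ((1 - (c ^ 2 + s ^ 2)) * y1); [ring|rewrite hcs; ring].
    - intros x1 y1; pose proof (eQ x1 y1) as e; unfold gradQ in e; rewrite ef in e.
      replace (dy u x1 y1) with (- x1 + c * (2 * (c * x1 + s * y1) + a)) by lra.
      transitivity (((c ^ 2 + s ^ 2) - 1) * x1); [ring|rewrite hcs; ring]. }
  lra.
Qed.

Lemma stationary_classification u :
  C2 u -> area_stationary (graph_param u) ->
  nonvertical_plane (graph u) \/
  exists th a b, forall x y, u x y = rotated_saddle th a b x y.
Proof.
  intros hu hst.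
  destruct (minimal_field_dichotomy _ _ _ _ _ _ (stationary_minimal_field u hu hst))
    as [(a & b & h)|(h & k & hne & hk)].
  - left; pose proof (radial_field_plane u a b hu h) as e.
    exists (- b), a, 1, (u a b); split; [lra|].
    intros p; unfold graph; rewrite e; lra.
  - right.
    assert (hd : 0 < h ^ 2 + k ^ 2) by (destruct hne; nra).
    set (d := sqrt (h ^ 2 + k ^ 2)).
    assert (hd0 : 0 < d) by (apply sqrt_lt_R0; trivial).
    assert (ed : d ^ 2 = h ^ 2 + k ^ 2) by (apply pow2_sqrt; lra).
    assert (hcs : (h / d) ^ 2 + (k / d) ^ 2 = 1).
    { transitivity ((h ^ 2 + k ^ 2) / d ^ 2); [field; lra|rewrite ed; field; lra]. }
    destruct (parallel_field_saddle u (h / d) (k / d) hu hst hcs) as (a & b & e).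
    { intros x y; transitivity ((gradP u x y * h + gradQ u x y * k) / d);
        [field; lra|rewrite hk; field; lra]. }
    destruct (unit_vector_angle _ _ hcs) as (th & ec & es).
    exists th, a, b; intros x y; rewrite e; unfold rotated_saddle; rewrite ec, es; ring.
Qed.

(** * Expansion of the area *)

Lemma affine_denominator_pos al be ga s x y :
  s <> 0 -> 0 < (al * x + be * y + ga) ^ 2 + s ^ 2.
Proof. intros hs; pose proof (pow2_ge_0 (al * x + be * y + ga)); pose proof (pow2_gt_0 s hs); lra. Qed.

Lemma affine_density_cont al be ga s : s <> 0 ->
  cont2 (fun x y => s ^ 2 / ((al * x + be * y + ga) ^ 2 + s ^ 2)).
Proof.
  intros hs; apply cont2_div; try cont2_tac.
  intros x y; apply Rgt_not_eq, affine_denominator_pos; trivial.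
Qed.

(** The primitive in y is (s / be) atan of the affine function over s, so each inner integral is at
    most PI |s| / |be|: the mean is O(s), although near the line the density itself does not become
    small. *)
Lemma affine_density_bound_y al be ga a b c d :
  a <= b -> c <= d -> be <> 0 ->
  exists C, 0 <= C /\ forall s, s <> 0 ->
    RInt2 (fun x y => s ^ 2 / ((al * x + be * y + ga) ^ 2 + s ^ 2)) a b c d <= C * Rabs s.
Proof.
  intros hab hcd hbe.
  assert (hB : 0 < Rabs be) by (apply Rabs_pos_lt; trivial).
  assert (hpi : 0 < PI) by apply PI_RGT_0.
  exists ((b - a) * (PI / Rabs be)); split.
  { apply Rmult_le_pos; [lra|]; apply Rlt_le, Rdiv_lt_0_compat; trivial. }
  intros s hs.
  assert (hS : 0 < Rabs s) by (apply Rabs_pos_lt; trivial).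
  pose proof (affine_density_cont al be ga s hs) as cf.
  assert (inner : forall x, RInt (fun y => s ^ 2 / ((al * x + be * y + ga) ^ 2 + s ^ 2)) c d
     <= PI / Rabs be * Rabs s).
  { intros x.
    set (G := fun y => s / be * atan ((al * x + be * y + ga) / s)).
    assert (e : RInt (fun y => s ^ 2 / ((al * x + be * y + ga) ^ 2 + s ^ 2)) c d = G d - G c).
    { apply is_RInt_unique, (is_RInt_derive (V := R_CompleteNormedModule) G).
      - intros y _; unfold G; auto_derive; trivial.
        pose proof (affine_denominator_pos al be ga s x y hs).
        field; repeat split; trivial; lra.
      - intros y _; apply (cont2_snd_cont
          (fun x y => s ^ 2 / ((al * x + be * y + ga) ^ 2 + s ^ 2))), cf. }
    rewrite e; eapply Rle_trans; [apply Rle_abs|].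
    unfold G.
    set (t1 := atan _); set (t2 := atan _).
    assert (h1 : - PI / 2 < t1 < PI / 2) by apply atan_bound.
    assert (h2 : - PI / 2 < t2 < PI / 2) by apply atan_bound.
    replace (s / be * t1 - s / be * t2) with (s / be * (t1 - t2)) by ring.
    unfold Rdiv at 1; rewrite !Rabs_mult, Rabs_inv.
    replace (PI / Rabs be * Rabs s) with (Rabs s * / Rabs be * PI) by (field; lra).
    apply Rmult_le_compat_l.
    - apply Rlt_le, Rmult_lt_0_compat; trivial; apply Rinv_0_lt_compat; trivial.
    - apply Rabs_le; lra. }
  replace ((b - a) * (PI / Rabs be) * Rabs s)
    with (RInt (fun _ => PI / Rabs be * Rabs s) a b)
    by (rewrite RInt_const; unfold scal; simpl; unfold mult; simpl; ring).
  apply RInt_le; trivial.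
  - apply cont2_ex_RInt2; trivial.
  - apply ex_RInt_const.
Qed.

Lemma affine_density_bound al be ga a b c d :
  a <= b -> c <= d -> al <> 0 \/ be <> 0 ->
  exists C, 0 <= C /\ forall s, s <> 0 ->
    RInt2 (fun x y => s ^ 2 / ((al * x + be * y + ga) ^ 2 + s ^ 2)) a b c d <= C * Rabs s.
Proof.
  intros hab hcd [h|h]; [|apply affine_density_bound_y; trivial].
  destruct (affine_density_bound_y be al ga c d a b hcd hab h) as (C & hC & hb).
  exists C; split; trivial; intros s hs.
  rewrite RInt2_fubini; trivial; [|apply affine_density_cont; trivial].
  eapply Rle_trans; [right|apply (hb s hs)].
  apply RInt2_ext_all; intros y x; do 3 f_equal; ring.
Qed.

(** The linear term <V, v> / r, v = (p, q), stays meaningful where V = 0. For the regularized norms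
    r at V and w at V + v, the Taylor error times r is at most 2 |v|^2 <= 4 D^2 s^2; passing to the
    true norms costs (1 + 2 D) s^2 at V + v and s^2 at V. These add up to the constant. *)
Lemma norm_expansion P Q p q D s :
  s <> 0 -> 0 <= D -> Rabs p <= D * Rabs s -> Rabs q <= D * Rabs s ->
  let r := sqrt (P ^ 2 + Q ^ 2 + s ^ 2) in
  Rabs (sqrt ((P + p) ^ 2 + (Q + q) ^ 2) - sqrt (P ^ 2 + Q ^ 2) - (P * p + Q * q) / r)
  <= (4 * D ^ 2 + 2 * D + 2) * s ^ 2 / r.
Proof.
  intros hs hD hp hq r.
  set (S := Rabs s) in *.
  assert (hS : 0 < S) by (apply Rabs_pos_lt; trivial).
  assert (eS : s ^ 2 = S ^ 2) by (unfold S; rewrite pow2_abs; trivial).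
  rewrite eS.
  pose proof (pow2_ge_0 P); pose proof (pow2_ge_0 Q); pose proof (pow2_gt_0 s hs).
  pose proof (pow2_ge_0 (P + p)); pose proof (pow2_ge_0 (Q + q)).
  set (n := sqrt (P ^ 2 + Q ^ 2)); set (m := sqrt ((P + p) ^ 2 + (Q + q) ^ 2)).
  set (w := sqrt ((P + p) ^ 2 + (Q + q) ^ 2 + s ^ 2)).
  assert (er : r ^ 2 = P ^ 2 + Q ^ 2 + S ^ 2) by (rewrite <- eS; apply pow2_sqrt; lra).
  assert (ew : w ^ 2 = (P + p) ^ 2 + (Q + q) ^ 2 + S ^ 2)
    by (rewrite <- eS; apply pow2_sqrt; lra).
  assert (en : n ^ 2 = P ^ 2 + Q ^ 2) by (apply pow2_sqrt; lra).
  assert (em : m ^ 2 = (P + p) ^ 2 + (Q + q) ^ 2) by (apply pow2_sqrt; lra).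
  assert (hr : 0 < r) by (apply sqrt_lt_R0; lra).
  assert (hw : 0 < w) by (apply sqrt_lt_R0; lra).
  assert (hn : 0 <= n) by apply sqrt_pos.
  assert (hm : 0 <= m) by apply sqrt_pos.
  apply Rabs_le_between in hp; apply Rabs_le_between in hq.
  set (k := P * p + Q * q).
  assert (hDS : 0 <= D * S) by nra.
  assert (hpq : p ^ 2 + q ^ 2 <= 2 * D ^ 2 * S ^ 2).
  { assert (p ^ 2 <= (D * S) ^ 2) by nra; assert (q ^ 2 <= (D * S) ^ 2) by nra.
    replace (2 * D ^ 2 * S ^ 2) with ((D * S) ^ 2 + (D * S) ^ 2) by ring; lra. }
  assert (hk2 : k ^ 2 <= r ^ 2 * (p ^ 2 + q ^ 2)).
  { rewrite er; unfold k.
    assert (0 <= (P * q - Q * p) ^ 2) by apply pow2_ge_0.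
    assert (0 <= S ^ 2 * (p ^ 2 + q ^ 2)).
    { apply Rmult_le_pos; [apply pow2_ge_0|apply Rplus_le_le_0_compat; apply pow2_ge_0]. }
    nra. }
  set (t := sqrt (p ^ 2 + q ^ 2)).
  assert (ht : 0 <= t) by apply sqrt_pos.
  assert (et : t ^ 2 = p ^ 2 + q ^ 2)
    by (apply pow2_sqrt, Rplus_le_le_0_compat; apply pow2_ge_0).
  assert (hkt : Rabs k <= r * t).
  { rewrite <- (Rabs_right (r * t)) by (apply Rle_ge, Rmult_le_pos; lra).
    apply Rsqr_le_abs_0; unfold Rsqr; nra. }
  assert (ewr : w ^ 2 = r ^ 2 + 2 * k + t ^ 2) by (rewrite ew, er, et; unfold k; ring).
  assert (hrw : r ^ 2 + k <= r * w).
  { destruct (Rle_dec (r ^ 2 + k) 0) as [h|h]; [nra|].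
    apply Rsqr_incr_0_var; [|nra]; unfold Rsqr.
    replace (r * w * (r * w)) with (r ^ 2 * w ^ 2) by ring.
    rewrite ewr; rewrite <- et in hk2; nra. }
  assert (hd : Rabs (r - w) <= t).
  { rewrite <- (Rabs_right t) by lra.
    apply Rsqr_le_abs_0; unfold Rsqr; nra. }
  assert (ht2 : t ^ 2 <= 2 * D ^ 2 * S ^ 2) by (rewrite et; trivial).
  assert (htD : t <= 2 * (D * S)) by nra.
  (* [z] is r times the Taylor error between regularized norms; the factor w + r turns the
     difference of square roots into the polynomial w^2 - r^2. *)
  set (z := r * (w - r) - k).
  assert (hz : Rabs z <= 2 * t ^ 2).
  { apply (Rmult_le_reg_r (w + r)); [lra|].
    rewrite <- (Rabs_right (w + r)) at 1 by lra; rewrite <- Rabs_mult.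
    replace (z * (w + r)) with (r * t ^ 2 + k * (r - w))
      by (unfold z; transitivity (r * (w ^ 2 - r ^ 2) - k * (w + r)); [rewrite ewr|]; ring).
    eapply Rle_trans; [apply Rabs_triang|]; rewrite !Rabs_mult.
    rewrite (Rabs_right r), (Rabs_right (t ^ 2)) by (try apply Rle_ge, pow2_ge_0; lra).
    assert (Rabs k * Rabs (r - w) <= r * t * t)
      by (apply Rmult_le_compat; trivial; apply Rabs_pos).
    assert (0 <= w * t ^ 2) by (apply Rmult_le_pos; [lra|apply pow2_ge_0]).
    nra. }
  assert (hSw : S <= w) by nra.
  assert (hrw' : r <= (1 + 2 * D) * w).
  { apply Rabs_le_between in hd; nra. }
  assert (hwm : 0 <= r * (w - m) <= (1 + 2 * D) * S ^ 2).
  { assert (e : (w - m) * (w + m) = S ^ 2)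
      by (transitivity (w ^ 2 - m ^ 2); [ring|rewrite ew, em; ring]).
    assert (0 <= w - m) by nra.
    split; [apply Rmult_le_pos; lra|].
    assert (r * (w - m) <= (1 + 2 * D) * w * (w - m)) by (apply Rmult_le_compat_r; lra).
    assert (w * (w - m) <= S ^ 2) by nra.
    nra. }
  assert (hrn : 0 <= r * (r - n) <= S ^ 2).
  { assert (e : (r - n) * (r + n) = S ^ 2)
      by (transitivity (r ^ 2 - n ^ 2); [ring|rewrite er, en; ring]).
    assert (0 <= r - n) by nra.
    split; [apply Rmult_le_pos; lra|nra]. }
  apply (Rmult_le_reg_r r); trivial.
  replace ((4 * D ^ 2 + 2 * D + 2) * S ^ 2 / r * r)
    with (4 * D ^ 2 * S ^ 2 + (1 + 2 * D) * S ^ 2 + S ^ 2) by (field; lra).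
  rewrite <- (Rabs_right r) at 2 by lra; rewrite <- Rabs_mult.
  replace ((m - n - k / r) * r) with (z - r * (w - m) + r * (r - n))
    by (unfold z; field; lra).
  apply Rabs_le_between in hz.
  apply Rabs_le; lra.
Qed.

(** This is what the variation requires of [sn], [cs] and [ks] at r = 1 as functions of w: C^1
    dependence through the removable singularity w = 0 and a Lipschitz constant. *)
Definition mild (S dS : R -> R) : Prop :=
  (forall w, is_derive S w (dS w)) /\ (forall w, continuity_pt dS w) /\
  (forall w, Rabs (dS w) <= 1).

Lemma mild_bound S dS w : mild S dS -> Rabs (S w - S 0) <= Rabs w.
Proof.
  intros (h1 & _ & h3).
  destruct (MVT_gen S 0 w dS) as (z & _ & e).
  - intros; apply h1.
  - intros t _; apply continuity_pt_filterlim, (ex_derive_continuous S).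
    exists (dS t); apply h1.
  - rewrite e, Rminus_0_r, Rabs_mult.
    rewrite <- (Rmult_1_l (Rabs w)) at 2.
    apply Rmult_le_compat_r; [apply Rabs_pos|apply h3].
Qed.

Lemma has_grad_trig (h dh : R -> R) :
  (forall z, is_derive h z (dh z)) -> (forall z, continuity_pt dh z) ->
  has_grad (fun w q => h (w * q)) (fun w q => dh (w * q) * q) (fun w q => dh (w * q) * w).
Proof.
  intros hd hc.
  refine (has_grad_ext _ _ _
    (has_grad_comp h dh _ _ _ _ _ (has_grad_mult has_grad_fst has_grad_snd)));
    try (intros; ring); trivial.
  apply cont2_comp; trivial; cont2_tac.
Qed.

(** Differentiation under the integral involves no division by w, so it works at w = 0 as well; on
    [0, 1] every factor of the derivative is at most 1 in absolute value. *)
Lemma mild_parameter_integral g (h dh k : R -> R) :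
  (forall w q, g w q = h (w * q) * k q) ->
  (forall z, is_derive h z (dh z)) -> (forall z, continuity_pt dh z) ->
  (forall z, Rabs (dh z) <= 1) -> (forall q, is_derive k q (Derive k q)) ->
  (forall q, continuity_pt (Derive k) q) -> (forall q, 0 <= q <= 1 -> Rabs (k q) <= 1) ->
  mild (fun w => RInt (fun q => g w q) 0 1)
    (fun w => RInt (fun q => dh (w * q) * q * k q) 0 1).
Proof.
  intros hg hd hc hb kd kc kb.
  assert (hk : has_grad (fun _ q => k q) (fun _ _ => 0) (fun _ q => Derive k q)).
  { split; [|split; [|split]].
    - intros x y; apply (is_derive_const (k y)).
    - intros x y; apply kd.
    - apply cont2_const.
    - apply (cont2_comp (Derive k) (fun _ q => q)); [trivial|apply cont2_snd]. }
  pose proof (has_grad_mult (has_grad_trig h dh hd hc) hk) as H; cbv beta in H.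
  assert (H' : has_grad g (fun w q => dh (w * q) * q * k q)
    (fun w q => dh (w * q) * w * k q + h (w * q) * Derive k q)).
  { refine (has_grad_ext _ _ _ H); intros; cbv beta; auto; try ring. }
  assert (cf : cont2 (fun w q => dh (w * q) * q * k q)) by apply H'.
  split; [|split].
  - intros w; exact (is_derive_RInt_has_grad _ _ _ 0 1 w H').
  - intros w; apply continuity_pt_filterlim.
    exact (cont2_RInt (fun w q => dh (w * q) * q * k q) 0 1 w Rle_0_1 cf).
  - intros w; replace 1 with ((1 - 0) * 1) at 2 by ring.
    apply abs_RInt_le_const; [lra|
      exact (cont2_ex_RInt (fun w q => dh (w * q) * q * k q) w 0 1 cf)|].
    intros q hq; rewrite !Rabs_mult, (Rabs_right q) by lra.
    rewrite <- (Rmult_1_l 1).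
    apply Rmult_le_compat; auto; try apply Rabs_pos.
    + apply Rmult_le_pos; [apply Rabs_pos|lra].
    + rewrite <- (Rmult_1_l 1).
      apply Rmult_le_compat; auto; try apply Rabs_pos; lra.
Qed.

Lemma mild_ext S S' dS : (forall w, S w = S' w) -> mild S dS -> mild S' dS.
Proof.
  intros e (h1 & h2 & h3); split; [|split]; trivial.
  intros w; apply (is_derive_ext S); trivial.
Qed.

Lemma Rabs_sin_le z : Rabs (sin z) <= 1.
Proof. apply Rabs_le, SIN_bound. Qed.
Lemma Rabs_cos_le z : Rabs (cos z) <= 1.
Proof. apply Rabs_le, COS_bound. Qed.

Lemma mild_one (h dh : R -> R) :
  (forall z, is_derive h z (dh z)) -> (forall z, continuity_pt dh z) ->
  (forall z, Rabs (dh z) <= 1) ->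
  exists dS, mild (fun w => RInt (fun q => h (w * q)) 0 1) dS.
Proof.
  intros h1 h2 h3; eexists.
  apply (mild_parameter_integral _ h dh (fun _ => 1)); trivial.
  - intros; ring.
  - intros; apply Derive_correct; auto_derive; trivial.
  - intros q; apply (continuity_pt_locally_ext (fun _ => 0) _ 1); [lra| |reg].
    intros; symmetry; apply Derive_const.
  - intros; rewrite Rabs_R1; lra.
Qed.

Lemma is_derive_cos z : is_derive cos z (- sin z).
Proof. apply is_derive_Reals, derivable_pt_lim_cos. Qed.
Lemma is_derive_sin z : is_derive sin z (cos z).
Proof. apply is_derive_Reals, derivable_pt_lim_sin. Qed.

Lemma mild_sn : exists dS, mild (fun w => sn w 1) dS.
Proof.
  destruct (mild_one cos (fun z => - sin z)) as [dS hS].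
  - apply is_derive_cos.
  - intros; reg.
  - intros; rewrite Rabs_Ropp; apply Rabs_sin_le.
  - exists dS; refine (mild_ext _ _ _ _ hS).
    intros w; apply is_RInt_unique.
    replace (sn w 1) with (minus (sn w 1) (sn w 0))
      by (rewrite sn_0; unfold minus, plus, opp; simpl; ring).
    apply (is_RInt_derive (V := R_CompleteNormedModule) (sn w)).
    + intros; apply is_derive_sn.
    + intros q _; apply continuity_pt_filterlim; reg.
Qed.

Lemma mild_cs : exists dS, mild (fun w => cs w 1) dS.
Proof.
  destruct (mild_one sin cos) as [dS hS].
  - apply is_derive_sin.
  - intros; reg.
  - apply Rabs_cos_le.
  - exists dS; refine (mild_ext _ _ _ _ hS).
    intros w; apply is_RInt_unique.
    replace (cs w 1) with (minus (cs w 1) (cs w 0))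
      by (rewrite cs_0; unfold minus, plus, opp; simpl; ring).
    apply (is_RInt_derive (V := R_CompleteNormedModule) (cs w)).
    + intros; apply is_derive_cs.
    + intros q _; apply continuity_pt_filterlim; reg.
Qed.

Lemma mild_ks : exists dS, mild (fun w => ks w 1) dS.
Proof.
  assert (hS := mild_parameter_integral (fun w q => sin (w * q) * (1 - q)) sin cos
    (fun q => 1 - q)).
  eexists; refine (mild_ext _ _ _ _ (hS _ _ _ _ _ _ _)); trivial.
  - intros w; apply is_RInt_unique.
    (* (1 - q) [cs w q] + [ks w q] is a primitive of sin (w q) (1 - q): integration by parts in the
       integral of [cs w] that defines [ks w 1]. *)
    replace (ks w 1) with (minus ((1 - 1) * cs w 1 + ks w 1) ((1 - 0) * cs w 0 + ks w 0))
      by (rewrite cs_0, ks_0; unfold minus, plus, opp; simpl; ring).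
    apply (is_RInt_derive (V := R_CompleteNormedModule) (fun q => (1 - q) * cs w q + ks w q)).
    + intros q _; evar_last.
      * apply @is_derive_plus; [|apply is_derive_ks].
        apply is_derive_Rmult; [|apply is_derive_cs].
        apply @is_derive_minus; [apply is_derive_const|apply is_derive_id].
      * unfold minus, plus, opp, zero, one; simpl; ring.
    + intros q _; apply continuity_pt_filterlim; reg.
  - apply is_derive_sin.
  - intros; reg.
  - apply Rabs_cos_le.
  - intros; apply Derive_correct; auto_derive; trivial.
  - intros q; apply (continuity_pt_locally_ext (fun _ => -1) _ 1); [lra| |reg].
    intros y _; symmetry; apply is_derive_unique; auto_derive; trivial; ring.
  - intros; rewrite Rabs_right; lra.
Qed.

(** * First-order expansions in s, uniform on a set *)

Definition bounded_on (K : R -> R -> Prop) (f : R -> R -> R) : Prop :=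
  exists M, 0 <= M /\ forall x y, K x y -> Rabs (f x y) <= M.

Definition expands0 (K : R -> R -> Prop) (F : R -> R -> R -> R) (F0 : R -> R -> R) : Prop :=
  bounded_on K F0 /\
  exists C, 0 <= C /\ forall s x y, Rabs s <= 1 -> K x y ->
    Rabs (F s x y - F0 x y) <= C * Rabs s.

(** The coefficients are required to be bounded so that expansions can be multiplied; Rabs s <= 1
    lets higher powers of s be absorbed. *)
Definition expands1 (K : R -> R -> Prop) (F : R -> R -> R -> R) (F0 F1 : R -> R -> R)
  : Prop :=
  bounded_on K F0 /\ bounded_on K F1 /\
  exists C, 0 <= C /\ forall s x y, Rabs s <= 1 -> K x y ->
    Rabs (F s x y - F0 x y - s * F1 x y) <= C * s ^ 2.

Lemma bounded_plus K f g :
  bounded_on K f -> bounded_on K g -> bounded_on K (fun x y => f x y + g x y).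
Proof.
  intros (M & hM & h) (N & hN & k); exists (M + N); split; [lra|].
  intros x y hK; eapply Rle_trans; [apply Rabs_triang|].
  specialize (h x y hK); specialize (k x y hK); lra.
Qed.

Lemma bounded_mult K f g :
  bounded_on K f -> bounded_on K g -> bounded_on K (fun x y => f x y * g x y).
Proof.
  intros (M & hM & h) (N & hN & k); exists (M * N); split; [nra|].
  intros x y hK; rewrite Rabs_mult; apply Rmult_le_compat; auto using Rabs_pos.
Qed.

Lemma bounded_const K c : bounded_on K (fun _ _ => c).
Proof. exists (Rabs c); split; [apply Rabs_pos|intros; lra]. Qed.

(** [f] is bounded on the bottom side, and each upward step of at most del / 2 changes it by less
    than 1, del being a modulus of uniform continuity for 1. Finitely many steps reach the top. *)
Lemma cont2_bounded f a b c d :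
  a <= b -> c <= d -> cont2 f ->
  bounded_on (fun x y => a <= x <= b /\ c <= y <= d) f.
Proof.
  intros hab hcd hf.
  destruct (uniform_continuity_2d f a b c d (fun x y _ _ => hf x y) (mkposreal 1 Rlt_0_1))
    as [del hdel]; simpl in hdel.
  assert (hx : exists M, 0 <= M /\ forall x, a <= x <= b -> Rabs (f x c) <= M).
  { destruct (continuity_ab_maj (fun x => Rabs (f x c)) a b hab) as (w & hw & _).
    - intros x _; apply (continuity_pt_comp (fun x => f x c) Rabs); [|apply Rcontinuity_abs].
      apply continuity_pt_filterlim, cont2_fst_cont, hf.
    - exists (Rabs (f w c)); split; [apply Rabs_pos|auto]. }
  destruct hx as (M & hM & hx).
  assert (hn : forall n x y, a <= x <= b -> c <= y <= d -> y - c <= INR n * (del / 2) ->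
    Rabs (f x y) <= M + INR n).
  { induction n as [|n IH]; intros x y h1 h2 h3.
    - simpl in h3; replace y with c by lra; simpl; rewrite Rplus_0_r; auto.
    - rewrite S_INR in *.
      pose proof (cond_pos del).
      set (y' := Rmax c (y - del / 2)).
      assert (hy' : c <= y' <= y /\ y - y' <= del / 2 /\ y' - c <= INR n * (del / 2)).
      { pose proof (pos_INR n).
        assert (0 <= INR n * (del / 2)) by (apply Rmult_le_pos; lra).
        unfold y', Rmax; destruct (Rle_dec c (y - del / 2)); lra. }
      specialize (IH x y' h1 ltac:(lra) ltac:(lra)).
      specialize (hdel x y' x y h1 ltac:(lra) h1 h2).
      rewrite Rminus_diag, Rabs_R0, Rabs_right in hdel by lra.
      specialize (hdel ltac:(lra) ltac:(lra)).
      replace (f x y) with (f x y' + (f x y - f x y')) by ring.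
      eapply Rle_trans; [apply Rabs_triang|lra]. }
  destruct (INR_unbounded ((d - c) / (del / 2))) as [n hn'].
  pose proof (cond_pos del).
  exists (M + INR n); split; [pose proof (pos_INR n); lra|].
  intros x y [h1 h2]; apply hn; trivial.
  assert (d - c <= INR n * (del / 2)); [|lra].
  replace (d - c) with ((d - c) / (del / 2) * (del / 2)) by (field; lra).
  apply Rmult_le_compat_r; lra.
Qed.

Lemma expands0_const K f : bounded_on K f -> expands0 K (fun _ x y => f x y) f.
Proof.
  intros h; split; trivial; exists 0; split; [lra|].
  intros; rewrite Rminus_diag, Rabs_R0; lra.
Qed.

Lemma expands0_plus {K F G F0 G0} :
  expands0 K F F0 -> expands0 K G G0 ->
  expands0 K (fun s x y => F s x y + G s x y) (fun x y => F0 x y + G0 x y).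
Proof.
  intros (b1 & C & hC & h) (b2 & D & hD & k); split; [apply bounded_plus; trivial|].
  exists (C + D); split; [lra|]; intros s x y hs hK.
  replace (F s x y + G s x y - (F0 x y + G0 x y)) with
    ((F s x y - F0 x y) + (G s x y - G0 x y)) by ring.
  eapply Rle_trans; [apply Rabs_triang|].
  specialize (h s x y hs hK); specialize (k s x y hs hK); lra.
Qed.

Lemma expands0_mult {K F G F0 G0} :
  expands0 K F F0 -> expands0 K G G0 ->
  expands0 K (fun s x y => F s x y * G s x y) (fun x y => F0 x y * G0 x y).
Proof.
  intros ((M & hM & b1) & C & hC & h) ((N & hN & b2) & D & hD & k).
  split; [apply bounded_mult; [exists M|exists N]; auto|].
  exists (C * D + M * D + N * C); split; [repeat apply Rplus_le_le_0_compat; nra|].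
  intros s x y hs hK.
  specialize (h s x y hs hK); specialize (k s x y hs hK);
    specialize (b1 x y hK); specialize (b2 x y hK).
  set (p := F s x y - F0 x y) in *; set (q := G s x y - G0 x y) in *.
  replace (F s x y * G s x y - F0 x y * G0 x y) with (p * q + F0 x y * q + G0 x y * p)
    by (unfold p, q; ring).
  eapply Rle_trans; [apply Rabs_triang|].
  eapply Rle_trans; [apply Rplus_le_compat_r, Rabs_triang|]; rewrite !Rabs_mult.
  pose proof (Rabs_pos s); pose proof (Rabs_pos p); pose proof (Rabs_pos q).
  assert (Rabs p * Rabs q <= C * Rabs s * (D * Rabs s)) by (apply Rmult_le_compat; trivial).
  assert (C * D * (Rabs s * Rabs s) <= C * D * Rabs s)
    by (apply Rmult_le_compat_l; nra).
  assert (Rabs (F0 x y) * Rabs q <= M * (D * Rabs s))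
    by (apply Rmult_le_compat; trivial; apply Rabs_pos).
  assert (Rabs (G0 x y) * Rabs p <= N * (C * Rabs s))
    by (apply Rmult_le_compat; trivial; apply Rabs_pos).
  nra.
Qed.

Lemma expands0_mild K S dS g :
  mild S dS -> bounded_on K g -> expands0 K (fun s x y => S (2 * s * g x y)) (fun _ _ => S 0).
Proof.
  intros hS (M & hM & hg); split; [apply bounded_const|].
  exists (2 * M); split; [lra|]; intros s x y hs hK.
  eapply Rle_trans; [eapply mild_bound, hS|].
  rewrite !Rabs_mult, (Rabs_right 2) by lra.
  specialize (hg x y hK); pose proof (Rabs_pos s); nra.
Qed.

Lemma expands0_mild_derive K S dS g h :
  mild S dS -> bounded_on K h ->
  expands0 K (fun s x y => dS (2 * s * g x y) * (2 * s * h x y)) (fun _ _ => 0).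
Proof.
  intros (_ & _ & hb) (M & hM & hh); split; [apply bounded_const|].
  exists (2 * M); split; [lra|]; intros s x y hs hK.
  rewrite Rminus_0_r, !Rabs_mult, (Rabs_right 2) by lra.
  specialize (hh x y hK); specialize (hb (2 * s * g x y)).
  pose proof (Rabs_pos s); pose proof (Rabs_pos (h x y)).
  replace (2 * M * Rabs s) with (1 * (2 * Rabs s * M)) by ring.
  apply Rmult_le_compat; trivial; try apply Rabs_pos; nra.
Qed.

Lemma expands1_ext K F F0 F1 G G0 G1 :
  (forall s x y, F s x y = G s x y) -> (forall x y, F0 x y = G0 x y) ->
  (forall x y, F1 x y = G1 x y) -> expands1 K F F0 F1 -> expands1 K G G0 G1.
Proof.
  intros e e0 e1 ((M & hM & b1) & (N & hN & b2) & C & hC & h).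
  split; [|split].
  - exists M; split; trivial; intros; rewrite <- e0; auto.
  - exists N; split; trivial; intros; rewrite <- e1; auto.
  - exists C; split; trivial; intros; rewrite <- e, <- e0, <- e1; auto.
Qed.

Lemma expands1_const K f : bounded_on K f -> expands1 K (fun _ x y => f x y) f (fun _ _ => 0).
Proof.
  intros h; split; [trivial|split; [apply bounded_const|]]; exists 0; split; [lra|].
  intros s x y _ _.
  replace (f x y - f x y - s * 0) with 0 by ring; rewrite Rabs_R0; lra.
Qed.

Lemma expands1_scale {K F F0} :
  expands0 K F F0 -> expands1 K (fun s x y => s * F s x y) (fun _ _ => 0) F0.
Proof.
  intros (b & C & hC & h); split; [apply bounded_const|split; [trivial|]].
  exists C; split; trivial; intros s x y hs hK.
  replace (s * F s x y - 0 - s * F0 x y) with (s * (F s x y - F0 x y)) by ring.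
  rewrite Rabs_mult, <- pow2_abs.
  specialize (h s x y hs hK); pose proof (Rabs_pos s); nra.
Qed.

Lemma expands1_plus {K F G F0 F1 G0 G1} :
  expands1 K F F0 F1 -> expands1 K G G0 G1 ->
  expands1 K (fun s x y => F s x y + G s x y) (fun x y => F0 x y + G0 x y)
    (fun x y => F1 x y + G1 x y).
Proof.
  intros (a0 & a1 & C & hC & h) (b0 & b1 & D & hD & k).
  split; [apply bounded_plus; trivial|split; [apply bounded_plus; trivial|]].
  exists (C + D); split; [lra|]; intros s x y hs hK.
  replace (F s x y + G s x y - (F0 x y + G0 x y) - s * (F1 x y + G1 x y)) with
    ((F s x y - F0 x y - s * F1 x y) + (G s x y - G0 x y - s * G1 x y)) by ring.
  eapply Rle_trans; [apply Rabs_triang|].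
  specialize (h s x y hs hK); specialize (k s x y hs hK); lra.
Qed.

Lemma expands1_expands0 {K F F0 F1} : expands1 K F F0 F1 -> expands0 K F F0.
Proof.
  intros (a0 & (M & hM & hb) & C & hC & h); split; trivial.
  exists (C + M); split; [lra|]; intros s x y hs hK.
  specialize (h s x y hs hK); specialize (hb x y hK).
  replace (F s x y - F0 x y) with ((F s x y - F0 x y - s * F1 x y) + s * F1 x y) by ring.
  eapply Rle_trans; [apply Rabs_triang|]; rewrite Rabs_mult.
  rewrite <- pow2_abs in h; pose proof (Rabs_pos s).
  assert (Rabs s ^ 2 <= Rabs s) by nra.
  assert (C * Rabs s ^ 2 <= C * Rabs s) by (apply Rmult_le_compat_l; trivial).
  assert (Rabs s * Rabs (F1 x y) <= Rabs s * M) by (apply Rmult_le_compat_l; trivial).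
  lra.
Qed.

(* F G - F0 G0 - s (F1 G0 + F0 G1) is the sum of [eF G0], [F0 eG] and (F - F0)(G - G0). *)
Lemma expands1_mult {K F G F0 F1 G0 G1} :
  expands1 K F F0 F1 -> expands1 K G G0 G1 ->
  expands1 K (fun s x y => F s x y * G s x y) (fun x y => F0 x y * G0 x y)
    (fun x y => F1 x y * G0 x y + F0 x y * G1 x y).
Proof.
  intros hF hG.
  destruct (expands1_expands0 hF) as (_ & C' & hC' & h').
  destruct (expands1_expands0 hG) as (_ & D' & hD' & k').
  destruct hF as (a0 & a1 & C & hC & h), hG as (b0 & b1 & D & hD & k).
  split; [apply bounded_mult; trivial|split].
  - apply bounded_plus; apply bounded_mult; trivial.
  - destruct a0 as (M & hM & a0), b0 as (N & hN & b0).
    exists (C * N + M * D + C' * D'); split;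
      [repeat apply Rplus_le_le_0_compat; apply Rmult_le_pos; trivial|].
    intros s x y hs hK.
    specialize (h s x y hs hK); specialize (k s x y hs hK);
      specialize (h' s x y hs hK); specialize (k' s x y hs hK);
      specialize (a0 x y hK); specialize (b0 x y hK).
    set (p := F s x y - F0 x y - s * F1 x y) in *;
      set (q := G s x y - G0 x y - s * G1 x y) in *.
    set (p' := F s x y - F0 x y) in *; set (q' := G s x y - G0 x y) in *.
    replace (F s x y * G s x y - F0 x y * G0 x y - s * (F1 x y * G0 x y + F0 x y * G1 x y))
      with (p * G0 x y + F0 x y * q + p' * q') by (unfold p, q, p', q'; ring).
    eapply Rle_trans; [apply Rabs_triang|].
    eapply Rle_trans; [apply Rplus_le_compat_r, Rabs_triang|]; rewrite !Rabs_mult.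
    assert (Rabs p * Rabs (G0 x y) <= C * s ^ 2 * N)
      by (apply Rmult_le_compat; trivial; apply Rabs_pos).
    assert (Rabs (F0 x y) * Rabs q <= M * (D * s ^ 2))
      by (apply Rmult_le_compat; trivial; apply Rabs_pos).
    assert (Rabs p' * Rabs q' <= C' * Rabs s * (D' * Rabs s))
      by (apply Rmult_le_compat; trivial; apply Rabs_pos).
    replace (C' * Rabs s * (D' * Rabs s)) with (C' * D' * Rabs s ^ 2) in H1 by ring.
    rewrite pow2_abs in H1; lra.
Qed.

Lemma expands1_opp K F F0 F1 :
  expands1 K F F0 F1 ->
  expands1 K (fun s x y => - F s x y) (fun x y => - F0 x y) (fun x y => - F1 x y).
Proof.
  intros h.
  generalize (expands1_mult (expands1_const K _ (bounded_const K (-1))) h).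
  apply expands1_ext; intros; ring.
Qed.

Lemma expands1_minus {K F G F0 F1 G0 G1} :
  expands1 K F F0 F1 -> expands1 K G G0 G1 ->
  expands1 K (fun s x y => F s x y - G s x y) (fun x y => F0 x y - G0 x y)
    (fun x y => F1 x y - G1 x y).
Proof. intros h k; apply expands1_plus; trivial; apply expands1_opp; trivial. Qed.

Lemma expands1_eq K F F0 F1 G0 G1 :
  expands1 K F F0 F1 -> (forall x y, F0 x y = G0 x y) -> (forall x y, F1 x y = G1 x y) ->
  expands1 K F G0 G1.
Proof. intros h e0 e1; exact (expands1_ext _ _ _ _ _ _ _ (fun _ _ _ => eq_refl) e0 e1 h). Qed.

Ltac expands1_tac :=
  repeat first
    [ eassumption | apply expands1_const; assumption
    | eapply expands1_scale, expands0_const; assumption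
    | eapply expands1_minus | eapply expands1_plus | eapply expands1_mult ].

Ltac expand_with f :=
  eapply expands1_eq; [unfold f; expands1_tac| |]; intros; cbv beta.

(** Common shape of the displacements under the exponential map of s U: amplitudes times mild
    functions of w = 2 s g, where s g is the T-component of s U. Derivatives falling on w carry an
    additional factor s and so vanish in the limit s = 0. *)
Definition mix (S C : R -> R) (g U V : R -> R -> R) (s x y : R) : R :=
  U x y * S (2 * s * g x y) + V x y * C (2 * s * g x y).

Definition mix_derivative (S dS C dC : R -> R) (g g' U U' V V' : R -> R -> R) (s x y : R)
  : R :=
  (U' x y * S (2 * s * g x y) + U x y * (dS (2 * s * g x y) * (2 * s * g' x y)))
  + (V' x y * C (2 * s * g x y) + V x y * (dC (2 * s * g x y) * (2 * s * g' x y))).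

Lemma has_grad_mix S dS C dC g gx gy U Ux Uy V Vx Vy s :
  mild S dS -> mild C dC -> has_grad g gx gy -> has_grad U Ux Uy -> has_grad V Vx Vy ->
  has_grad (mix S C g U V s) (mix_derivative S dS C dC g gx U Ux V Vx s)
    (mix_derivative S dS C dC g gy U Uy V Vy s).
Proof.
  intros (s1 & s2 & _) (c1 & c2 & _) hg hU hV.
  pose proof (has_grad_scal (2 * s) hg) as hsg.
  pose proof (has_grad_cont hsg) as csg.
  exact (has_grad_plus
    (has_grad_mult hU (has_grad_comp S dS _ _ _
       (fun x y => s1 (2 * s * g x y)) (cont2_comp dS _ s2 csg) hsg))
    (has_grad_mult hV (has_grad_comp C dC _ _ _
       (fun x y => c1 (2 * s * g x y)) (cont2_comp dC _ c2 csg) hsg))).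
Qed.

Lemma expands0_mix K S dS C dC g U V :
  mild S dS -> mild C dC -> bounded_on K g -> bounded_on K U -> bounded_on K V ->
  expands0 K (mix S C g U V) (fun x y => U x y * S 0 + V x y * C 0).
Proof.
  intros hS hC hg hU hV; unfold mix.
  exact (expands0_plus
    (expands0_mult (expands0_const K U hU) (expands0_mild K S dS g hS hg))
    (expands0_mult (expands0_const K V hV) (expands0_mild K C dC g hC hg))).
Qed.

Lemma expands0_mix_derivative K S dS C dC g g' U U' V V' :
  mild S dS -> mild C dC -> bounded_on K g -> bounded_on K g' -> bounded_on K U ->
  bounded_on K U' -> bounded_on K V -> bounded_on K V' ->
  expands0 K (mix_derivative S dS C dC g g' U U' V V')
    (fun x y => (U' x y * S 0 + U x y * 0) + (V' x y * C 0 + V x y * 0)).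
Proof.
  intros hS hC hg hg' hU hU' hV hV'; unfold mix_derivative.
  exact (expands0_plus
    (expands0_plus
      (expands0_mult (expands0_const K U' hU') (expands0_mild K S dS g hS hg))
      (expands0_mult (expands0_const K U hU)
        (expands0_mild_derive K S dS g g' hS hg')))
    (expands0_plus
      (expands0_mult (expands0_const K V' hV') (expands0_mild K C dC g hC hg))
      (expands0_mult (expands0_const K V hV)
        (expands0_mild_derive K C dC g g' hC hg')))).
Qed.

Lemma sn_zero : sn 0 1 = 1.
Proof. unfold sn; destruct (Req_dec_T 0 0); lra. Qed.
Lemma cs_zero : cs 0 1 = 0.
Proof. unfold cs; destruct (Req_dec_T 0 0); lra. Qed.
Lemma ks_zero : ks 0 1 = 0.
Proof. unfold ks; destruct (Req_dec_T 0 0); lra. Qed.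

(** The [ks] term of the geodesic is quadratic in the initial vector, hence the double factor s.
    [m3] fits the pattern of [mix] with second amplitude 0. *)
Lemma variation_explicit u U1 U2 U3 s :
  let g := fun x y => U3 x y - y * U1 x y + x * U2 x y in
  let S := fun w => sn w 1 in let C := fun w => cs w 1 in let K := fun w => ks w 1 in
  let m1 := mix S C g U1 U2 s in
  let m2 := mix S C g U2 (fun x y => - U1 x y) s in
  let m3 := mix K K g (fun x y => U1 x y * U1 x y + U2 x y * U2 x y) (fun _ _ => 0) s in
  variation (graph_param u) (fun x y => (U1 x y, U2 x y, U3 x y)) s =
  fun x y => (x + s * m1 x y, y + s * m2 x y,
    u x y + s * g x y + y * (s * m1 x y) - x * (s * m2 x y) + s * (s * m3 x y)).
Proof.
  intros g S C K m1 m2 m3.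
  apply functional_extensionality; intros x; apply functional_extensionality; intros y.
  unfold variation; rewrite exp_map_eq.
  unfold m1, m2, m3, mix, S, C, K.
  assert (eg : frT (graph_param u x y) (vscal s (U1 x y, U2 x y, U3 x y)) = s * g x y)
    by (unfold g, frT, graph_param, vscal, cx, cy, ct; simpl; ring).
  unfold heis_geodesic; rewrite eg.
  replace (2 * (s * g x y)) with (2 * s * g x y) by ring.
  set (A1 := sn _ _); set (A2 := cs _ _); set (A3 := ks _ _).
  unfold graph_param, vscal, cx, cy, ct; simpl.
  f_equal; [f_equal|]; ring.
Qed.

(** With phi = U3 - u_x U1 - u_y U2 the first-order coefficients form grad phi + DV (U1, U2) + V div
    (U1, U2): the vertical displacement of the graph plus the transport of V by the projected field.
    The components are expanded, not their norm, because |V| is not differentiable at its zeros. *)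
Lemma variation_density u U1 U1x U1y U2 U2x U2y U3 U3x U3y a b c d :
  C2 u -> has_grad U1 U1x U1y -> has_grad U2 U2x U2y -> has_grad U3 U3x U3y ->
  a <= b -> c <= d ->
  let rect := fun x y => a <= x <= b /\ c <= y <= d in
  exists n1 n2 : R -> R -> R -> R,
    (forall s, cont2 (n1 s)) /\ (forall s, cont2 (n2 s)) /\
    (forall s, area (variation (graph_param u) (fun x y => (U1 x y, U2 x y, U3 x y)) s) a b c d
       = RInt2 (fun x y => sqrt (n1 s x y ^ 2 + n2 s x y ^ 2)) a b c d) /\
    expands1 rect n1 (gradP u) (fun x y =>
      (U3x x y - (dx (dx u) x y * U1 x y + dx u x y * U1x x y)
         - (dx (dy u) x y * U2 x y + dy u x y * U2x x y))
      + dx (dx u) x y * U1 x y + (dy (dx u) x y - 1) * U2 x y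
      + gradP u x y * (U1x x y + U2y x y)) /\
    expands1 rect n2 (gradQ u) (fun x y =>
      (U3y x y - (dy (dx u) x y * U1 x y + dx u x y * U1y x y)
         - (dy (dy u) x y * U2 x y + dy u x y * U2y x y))
      + (dx (dy u) x y + 1) * U1 x y + dy (dy u) x y * U2 x y
      + gradQ u x y * (U1x x y + U2y x y)).
Proof.
  intros hu h1 h2 h3 hab hcd rect.
  destruct mild_sn as [dS hS], mild_cs as [dC hC], mild_ks as [dK hK].
  pose proof (C1_has_grad (proj1 hu)) as hgu.
  set (S := fun w => sn w 1) in *; set (C := fun w => cs w 1) in *;
    set (K := fun w => ks w 1) in *.
  assert (S0 : S 0 = 1) by apply sn_zero.
  assert (C0 : C 0 = 0) by apply cs_zero.
  assert (K0 : K 0 = 0) by apply ks_zero.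
  set (g := fun x y => U3 x y - y * U1 x y + x * U2 x y).
  pose proof (has_grad_plus
    (has_grad_minus h3 (has_grad_mult has_grad_snd h1))
    (has_grad_mult has_grad_fst h2)) as hg.
  cbv beta in hg; fold g in hg.
  set (gx := fun x y => U3x x y - (0 * U1 x y + y * U1x x y) + (1 * U2 x y + x * U2x x y)) in *.
  set (gy := fun x y => U3y x y - (1 * U1 x y + y * U1y x y) + (0 * U2 x y + x * U2y x y)) in *.
  pose proof (has_grad_opp h1) as h1n.
  pose proof (has_grad_plus (has_grad_mult h1 h1)
    (has_grad_mult h2 h2)) as hq; cbv beta in hq.
  set (q := fun x y => U1 x y * U1 x y + U2 x y * U2 x y) in *.
  set (qx := fun x y => U1x x y * U1 x y + U1 x y * U1x x y
                        + (U2x x y * U2 x y + U2 x y * U2x x y)) in *.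
  set (qy := fun x y => U1y x y * U1 x y + U1 x y * U1y x y
                        + (U2y x y * U2 x y + U2 x y * U2y x y)) in *.
  assert (bd : forall f, cont2 f -> bounded_on rect f)
    by (intros f hf; apply cont2_bounded; trivial).
  assert (bg : forall f fx fy, has_grad f fx fy ->
    bounded_on rect f /\ bounded_on rect fx /\ bounded_on rect fy).
  { intros f fx fy hf; split; [apply bd; eapply has_grad_cont, hf|split; apply bd; apply hf]. }
  pose proof (bg _ _ _ h1) as (b1 & b1x & b1y); pose proof (bg _ _ _ h2) as (b2 & b2x & b2y);
    pose proof (bg _ _ _ hg) as (bg0 & bgx & bgy);
    pose proof (bg _ _ _ h1n) as (b1n & b1nx & b1ny);
    pose proof (bg _ _ _ hq) as (bq & bqx & bqy);
    pose proof (bg _ _ _ hgu) as (bu & bux & buy).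
  assert (bz : bounded_on rect (fun _ _ => 0)) by apply bounded_const.
  assert (bone : bounded_on rect (fun _ _ => 1)) by apply bounded_const.
  assert (bx : bounded_on rect (fun x _ => x)) by (apply bd, cont2_fst).
  assert (by_ : bounded_on rect (fun _ y => y)) by (apply bd, cont2_snd).
  set (m1 := mix S C g U1 U2).
  set (m2 := mix S C g U2 (fun x y => - U1 x y)).
  set (m3 := mix K K g q (fun _ _ => 0)).
  set (m1x := mix_derivative S dS C dC g gx U1 U1x U2 U2x).
  set (m1y := mix_derivative S dS C dC g gy U1 U1y U2 U2y).
  set (m2x := mix_derivative S dS C dC g gx U2 U2x (fun x y => - U1 x y) (fun x y => - U1x x y)).
  set (m2y := mix_derivative S dS C dC g gy U2 U2y (fun x y => - U1 x y) (fun x y => - U1y x y)).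
  set (m3x := mix_derivative K dK K dK g gx q qx (fun _ _ => 0) (fun _ _ => 0)).
  set (m3y := mix_derivative K dK K dK g gy q qy (fun _ _ => 0) (fun _ _ => 0)).
  assert (hm1 : forall s, has_grad (m1 s) (m1x s) (m1y s))
    by (intros s; apply has_grad_mix; trivial).
  assert (hm2 : forall s, has_grad (m2 s) (m2x s) (m2y s))
    by (intros s; apply has_grad_mix; trivial).
  assert (hm3 : forall s, has_grad (m3 s) (m3x s) (m3y s))
    by (intros s; apply has_grad_mix; trivial; apply has_grad_const).
  pose proof (expands0_mix rect S dS C dC g U1 U2 hS hC bg0 b1 b2) as em1.
  pose proof (expands0_mix rect S dS C dC g U2 _ hS hC bg0 b2 b1n) as em2.
  pose proof (expands0_mix rect K dK K dK g q _ hK hK bg0 bq bz) as em3.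
  pose proof (expands0_mix_derivative rect S dS C dC g gx U1 U1x U2 U2x
    hS hC bg0 bgx b1 b1x b2 b2x) as em1x.
  pose proof (expands0_mix_derivative rect S dS C dC g gy U1 U1y U2 U2y
    hS hC bg0 bgy b1 b1y b2 b2y) as em1y.
  pose proof (expands0_mix_derivative rect S dS C dC g gx U2 U2x _ _
    hS hC bg0 bgx b2 b2x b1n b1nx) as em2x.
  pose proof (expands0_mix_derivative rect S dS C dC g gy U2 U2y _ _
    hS hC bg0 bgy b2 b2y b1n b1ny) as em2y.
  pose proof (expands0_mix_derivative rect K dK K dK g gx q qx _ _
    hK hK bg0 bgx bq bqx bz bz) as em3x.
  pose proof (expands0_mix_derivative rect K dK K dK g gy q qy _ _
    hK hK bg0 bgy bq bqy bz bz) as em3y.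
  fold m1 in em1; fold m2 in em2; fold m3 in em3; fold m1x in em1x; fold m1y in em1y;
    fold m2x in em2x; fold m2y in em2y; fold m3x in em3x; fold m3y in em3y.
  pose proof (expands1_scale em1) as sm1; pose proof (expands1_scale em1x) as sm1x;
  pose proof (expands1_scale em1y) as sm1y; pose proof (expands1_scale em2) as sm2;
  pose proof (expands1_scale em2x) as sm2x; pose proof (expands1_scale em2y) as sm2y.
  assert (es : expands1 rect (fun s _ _ => s) (fun _ _ => 0) (fun _ _ => 1)).
  { generalize (expands1_scale (expands0_const rect _ bone)).
    apply expands1_ext; intros; ring. }
  pose proof (expands1_mult es (expands1_scale em3)) as sm3.
  pose proof (expands1_mult es (expands1_scale em3x)) as sm3x.
  pose proof (expands1_mult es (expands1_scale em3y)) as sm3y.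
  cbv beta in sm1, sm1x, sm1y, sm2, sm2x, sm2y, sm3, sm3x, sm3y.
  set (f1 := fun s x y => x + s * m1 s x y).
  set (f2 := fun s x y => y + s * m2 s x y).
  set (f3 := fun s x y => u x y + s * g x y + y * (s * m1 s x y) - x * (s * m2 s x y)
                          + s * (s * m3 s x y)).
  set (f1x := fun s x y => 1 + s * m1x s x y).
  set (f1y := fun s x y => s * m1y s x y).
  set (f2x := fun s x y => s * m2x s x y).
  set (f2y := fun s x y => 1 + s * m2y s x y).
  set (f3x := fun s x y => dx u x y + s * gx x y + y * (s * m1x s x y)
     - (s * m2 s x y + x * (s * m2x s x y)) + s * (s * m3x s x y)).
  set (f3y := fun s x y => dy u x y + s * gy x y + (s * m1 s x y + y * (s * m1y s x y))
     - x * (s * m2y s x y) + s * (s * m3y s x y)).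
  assert (hf1 : forall s, has_grad (f1 s) (f1x s) (f1y s)).
  { intros s; generalize (has_grad_plus has_grad_fst
      (has_grad_scal s (hm1 s))).
    apply has_grad_ext; intros; unfold f1, f1x, f1y; ring. }
  assert (hf2 : forall s, has_grad (f2 s) (f2x s) (f2y s)).
  { intros s; generalize (has_grad_plus has_grad_snd
      (has_grad_scal s (hm2 s))).
    apply has_grad_ext; intros; unfold f2, f2x, f2y; ring. }
  assert (hf3 : forall s, has_grad (f3 s) (f3x s) (f3y s)).
  { intros s; refine (has_grad_ext _ _ _ (has_grad_plus
     (has_grad_minus
      (has_grad_plus
       (has_grad_plus hgu (has_grad_scal s hg))
       (has_grad_mult has_grad_snd (has_grad_scal s (hm1 s))))
      (has_grad_mult has_grad_fst (has_grad_scal s (hm2 s))))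
     (has_grad_scal s (has_grad_scal s (hm3 s)))));
      intros; unfold f3, f3x, f3y; ring. }
  assert (ef1 : expands1 rect f1 (fun x _ => x) U1)
    by (expand_with f1; rewrite ?S0, ?C0; ring).
  assert (ef2 : expands1 rect f2 (fun _ y => y) U2)
    by (expand_with f2; rewrite ?S0, ?C0; ring).
  assert (ef1x : expands1 rect f1x (fun _ _ => 1) U1x)
    by (expand_with f1x; rewrite ?S0, ?C0; ring).
  assert (ef1y : expands1 rect f1y (fun _ _ => 0) U1y)
    by (expand_with f1y; rewrite ?S0, ?C0; ring).
  assert (ef2x : expands1 rect f2x (fun _ _ => 0) U2x)
    by (expand_with f2x; rewrite ?S0, ?C0; ring).
  assert (ef2y : expands1 rect f2y (fun _ _ => 1) U2y)
    by (expand_with f2y; rewrite ?S0, ?C0; ring).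
  assert (ef3x : expands1 rect f3x (dx u) U3x)
    by (expand_with f3x; unfold gx; rewrite ?S0, ?C0, ?K0; ring).
  assert (ef3y : expands1 rect f3y (dy u) U3y)
    by (expand_with f3y; unfold gy; rewrite ?S0, ?C0, ?K0; ring).
  set (t1 := fun s x y => f3x s x y - f2 s x y * f1x s x y + f1 s x y * f2x s x y).
  set (t2 := fun s x y => f3y s x y - f2 s x y * f1y s x y + f1 s x y * f2y s x y).
  assert (et1 : expands1 rect t1 (gradP u)
    (fun x y => U3x x y - (U2 x y + y * U1x x y) + x * U2x x y)).
  { expand_with t1; unfold gradP; ring. }
  assert (et2 : expands1 rect t2 (gradQ u)
    (fun x y => U3y x y - y * U1y x y + (U1 x y + x * U2y x y))).
  { expand_with t2; unfold gradQ; ring. }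
  (* These are the horizontal components of the vector product of the tangent vectors, with the sign
     that makes them equal to V at s = 0. *)
  exists (fun s x y => t1 s x y * f2y s x y - f2x s x y * t2 s x y),
    (fun s x y => f1x s x y * t2 s x y - t1 s x y * f1y s x y).
  assert (cf : forall s, cont2 (f1 s) /\ cont2 (f2 s) /\ cont2 (f1x s) /\ cont2 (f1y s) /\
    cont2 (f2x s) /\ cont2 (f2y s) /\ cont2 (f3x s) /\ cont2 (f3y s)).
  { intros s; pose proof (has_grad_cont (hf1 s)); pose proof (has_grad_cont (hf2 s)).
    destruct (hf1 s) as (_ & _ & ? & ?), (hf2 s) as (_ & _ & ? & ?),
      (hf3 s) as (_ & _ & ? & ?); repeat split; assumption. }
  split; [|split; [|split; [|split]]].
  - intros s; destruct (cf s) as (? & ? & ? & ? & ? & ? & ? & ?); unfold t1, t2.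
    cont2_tac; assumption.
  - intros s; destruct (cf s) as (? & ? & ? & ? & ? & ? & ? & ?); unfold t1, t2.
    cont2_tac; assumption.
  - intros s.
    rewrite (variation_explicit u U1 U2 U3 s).
    transitivity (area (fun x y => (f1 s x y, f2 s x y, f3 s x y)) a b c d); [reflexivity|].
    rewrite (area_eq a b c d (hf1 s) (hf2 s) (hf3 s)).
    apply RInt2_ext_all; intros x y; cbv zeta; fold (t1 s x y) (t2 s x y).
    f_equal; ring.
  - eapply expands1_eq; [expands1_tac| |]; intros; cbv beta; [ring|].
    rewrite (Schwarz_C2 u _ _ hu); unfold gradP, gradQ; ring.
  - eapply expands1_eq; [expands1_tac| |]; intros; cbv beta; [ring|].
    rewrite (Schwarz_C2 u _ _ hu); unfold gradP, gradQ; ring.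
Qed.

(** * Sufficiency *)

(** The integrand is the divergence of f V / r + r (U1, U2), r being the regularized norm, once the
    divergence of V / r is 0. The s^2 term arises from writing r as (|V|^2 + s^2) / r. *)
Lemma reg_norm_divergence P Q Px Py Qx Qy f fx fy U1 U1x U1y U2 U2x U2y s a b c d :
  0 < s -> c <= d -> has_grad P Px Py -> has_grad Q Qx Qy -> has_grad f fx fy ->
  has_grad U1 U1x U1y -> has_grad U2 U2x U2y ->
  (forall x y, reg_div P Q Px Py Qx Qy s x y = 0) ->
  (forall y, f a y = 0 /\ U1 a y = 0) -> (forall y, f b y = 0 /\ U1 b y = 0) ->
  (forall x, f x c = 0 /\ U2 x c = 0) -> (forall x, f x d = 0 /\ U2 x d = 0) ->
  RInt2 (fun x y =>
    (P x y * (fx x y + Px x y * U1 x y + Py x y * U2 x y + P x y * (U1x x y + U2y x y))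
     + Q x y * (fy x y + Qx x y * U1 x y + Qy x y * U2 x y + Q x y * (U1x x y + U2y x y))
     + s ^ 2 * (U1x x y + U2y x y)) / reg_norm P Q s x y) a b c d = 0.
Proof.
  intros hs hcd hP hQ hf h1 h2 hdiv ha hb hc hd.
  pose proof (reg_divergence f fx fy s a b c d hs hcd hP hQ hf
    (fun y => proj1 (ha y)) (fun y => proj1 (hb y)) (fun x => proj1 (hc x))
    (fun x => proj1 (hd x))) as z0.
  rewrite (RInt2_ext_all (fun x y => f x y * _) (fun _ _ => 0)), RInt2_const in z0
    by (intros; rewrite hdiv; ring).
  pose proof (has_grad_reg_norm s hs hP hQ) as hR.
  pose proof (has_grad_mult hR h1) as hR1.
  pose proof (has_grad_mult hR h2) as hR2.
  assert (z1 := RInt2_dx _ _ _ a b c d hcd hR1); cbv beta in z1.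
  assert (z2 := RInt2_dy _ _ _ a b c d hcd hR2); cbv beta in z2.
  specialize (z1 (fun y => Rmult_eq_0_compat_l _ _ (proj2 (ha y)))
    (fun y => Rmult_eq_0_compat_l _ _ (proj2 (hb y)))).
  specialize (z2 (fun x => Rmult_eq_0_compat_l _ _ (proj2 (hc x)))
    (fun x => Rmult_eq_0_compat_l _ _ (proj2 (hd x)))).
  pose proof (has_grad_cont hP) as cP; pose proof (has_grad_cont hQ) as cQ.
  pose proof (reg_norm_cont P Q s cP cQ) as cR.
  assert (hne : forall x y, reg_norm P Q s x y <> 0)
    by (intros x y; apply Rgt_not_eq, reg_norm_pos; trivial).
  assert (c0 : cont2 (fun x y => (fx x y * P x y + fy x y * Q x y) / reg_norm P Q s x y)).
  { apply cont2_div; trivial; destruct hf as (_ & _ & ? & ?); cont2_tac. }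
  destruct hR1 as (_ & _ & c1 & _), hR2 as (_ & _ & _ & c2).
  assert (z : RInt2 (fun x y =>
    (fx x y * P x y + fy x y * Q x y) / reg_norm P Q s x y
    + ((P x y * Px x y + Q x y * Qx x y) / reg_norm P Q s x y * U1 x y
       + reg_norm P Q s x y * U1x x y)
    + ((P x y * Py x y + Q x y * Qy x y) / reg_norm P Q s x y * U2 x y
       + reg_norm P Q s x y * U2y x y)) a b c d = 0).
  { rewrite RInt2_plus, RInt2_plus; trivial; [|apply cont2_plus; trivial].
    rewrite z0, z1, z2; ring. }
  rewrite <- z; apply RInt2_ext_all; intros x y.
  pose proof (reg_norm_sq P Q s x y) as e; specialize (hne x y).
  set (r := reg_norm P Q s x y) in *.
  assert (e' : s ^ 2 = r ^ 2 - P x y ^ 2 - Q x y ^ 2) by lra.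
  rewrite e'; field; trivial.
Qed.

Lemma Rabs_le_reg_norm P Q s x y :
  0 < s -> Rabs (P x y) <= reg_norm P Q s x y /\ Rabs (Q x y) <= reg_norm P Q s x y
           /\ s <= reg_norm P Q s x y.
Proof.
  intros hs; pose proof (reg_norm_pos P Q s x y hs) as hR.
  pose proof (reg_norm_sq P Q s x y) as e.
  pose proof (pow2_ge_0 (P x y)); pose proof (pow2_ge_0 (Q x y)); pose proof (pow2_ge_0 s).
  split; [|split].
  - rewrite <- (Rabs_right (reg_norm P Q s x y)) by lra; apply Rsqr_le_abs_0; unfold Rsqr; lra.
  - rewrite <- (Rabs_right (reg_norm P Q s x y)) by lra; apply Rsqr_le_abs_0; unfold Rsqr; lra.
  - nra.
Qed.

(* The first variation is the integral of the divergence of [phi nu + |V| (U1, U2)], where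
   [phi] is the vertical component of the variation, so it vanishes when nu is divergence
   free.  The remainder is of order s^2 / sqrt (|V|^2 + s^2), which is o(s) in mean. *)
Lemma stationary_sufficient u al be ga :
  C2 u -> (forall x y, dx (dx u) x y + dy (dy u) x y = 0) ->
  (forall x y, gradQ u x y ^ 2 * dx (dx u) x y
    - gradP u x y * gradQ u x y * (dy (dx u) x y - 1 + (dx (dy u) x y + 1))
    + gradP u x y ^ 2 * dy (dy u) x y = 0) ->
  al <> 0 \/ be <> 0 ->
  (forall x y, (al * x + be * y + ga) ^ 2 <= gradP u x y ^ 2 + gradQ u x y ^ 2) ->
  area_stationary (graph_param u).
Proof.
  intros hu htr heq hlin hge U a b c d (hU1 & hU2 & hU3) hab hcd hsup.
  set (U1 := fun x y => cx (U x y)) in *; set (U2 := fun x y => cy (U x y)) in *;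
    set (U3 := fun x y => ct (U x y)) in *.
  assert (eU : U = fun x y => (U1 x y, U2 x y, U3 x y)).
  { apply functional_extensionality; intros x; apply functional_extensionality; intros y.
    unfold U1, U2, U3, cx, cy, ct; destruct (U x y) as [[? ?] ?]; reflexivity. }
  assert (s1 : forall x y, ~ (a <= x <= b /\ c <= y <= d) -> U1 x y = 0)
    by (intros x y h; unfold U1; rewrite (hsup x y h); reflexivity).
  assert (s2 : forall x y, ~ (a <= x <= b /\ c <= y <= d) -> U2 x y = 0)
    by (intros x y h; unfold U2; rewrite (hsup x y h); reflexivity).
  assert (s3 : forall x y, ~ (a <= x <= b /\ c <= y <= d) -> U3 x y = 0)
    by (intros x y h; unfold U3; rewrite (hsup x y h); reflexivity).
  apply C1_has_grad in hU1, hU2, hU3.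
  set (U1x := dx U1) in *; set (U1y := dy U1) in *; set (U2x := dx U2) in *;
    set (U2y := dy U2) in *; set (U3x := dx U3) in *; set (U3y := dy U3) in *.
  rewrite eU; clear hsup eU; clearbody U1 U2 U3 U1x U1y U2x U2y U3x U3y; clear U.
  destruct (support_boundary U1 a b c d (has_grad_cont hU1) s1) as (a1 & b1 & c1 & d1).
  destruct (support_boundary U2 a b c d (has_grad_cont hU2) s2) as (a2 & b2 & c2 & d2).
  destruct (support_boundary U3 a b c d (has_grad_cont hU3) s3) as (a3 & b3 & c3 & d3).
  destruct (variation_density u U1 U1x U1y U2 U2x U2y U3 U3x U3y a b c d hu hU1 hU2 hU3)
    as (n1 & n2 & cn1 & cn2 & harea & e1 & e2); try lra.
  pose proof (expands1_expands0 e1) as (_ & D1 & hD1 & f1).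
  pose proof (expands1_expands0 e2) as (_ & D2 & hD2 & f2).
  destruct e1 as (_ & _ & C1 & hC1 & e1), e2 as (_ & _ & C2 & hC2 & e2).
  destruct hu as (hu0 & hux & huy).
  assert (hu : Defs.C2 u) by (split; [|split]; trivial).
  pose proof (has_grad_gradP u hu) as hP; pose proof (has_grad_gradQ u hu) as hQ.
  pose proof (has_grad_cont hP) as cP; pose proof (has_grad_cont hQ) as cQ.
  pose proof (has_grad_minus
    (has_grad_minus hU3 (has_grad_mult (C1_has_grad hux) hU1))
    (has_grad_mult (C1_has_grad huy) hU2)) as hphi; cbv beta in hphi.
  set (phi := fun x y => U3 x y - dx u x y * U1 x y - dy u x y * U2 x y) in *.
  set (phix := fun x y => U3x x y - (dx (dx u) x y * U1 x y + dx u x y * U1x x y)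
         - (dx (dy u) x y * U2 x y + dy u x y * U2x x y)) in *.
  set (phiy := fun x y => U3y x y - (dy (dx u) x y * U1 x y + dx u x y * U1y x y)
         - (dy (dy u) x y * U2 x y + dy u x y * U2y x y)) in *.
  set (q1 := fun x y => phix x y + dx (dx u) x y * U1 x y + (dy (dx u) x y - 1) * U2 x y
      + gradP u x y * (U1x x y + U2y x y)).
  set (q2 := fun x y => phiy x y + (dx (dy u) x y + 1) * U1 x y + dy (dy u) x y * U2 x y
      + gradQ u x y * (U1x x y + U2y x y)).
  set (dv := fun x y => U1x x y + U2y x y).
  assert (cphix : cont2 phix) by apply hphi.
  assert (cphiy : cont2 phiy) by apply hphi.
  pose proof (has_grad_cont hU1) as cU1; pose proof (has_grad_cont hU2) as cU2.
  pose proof hU1 as (_ & _ & cU1x & cU1y); pose proof hU2 as (_ & _ & cU2x & cU2y).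
  pose proof hP as (_ & _ & cPx & cPy); pose proof hQ as (_ & _ & cQx & cQy).
  assert (cdv : cont2 dv) by (unfold dv; cont2_tac).
  assert (cq1 : cont2 q1).
  { unfold q1; apply cont2_plus; [apply cont2_plus; [cont2_tac|]|cont2_tac].
    exact (cont2_mult _ _ cPy cU2). }
  assert (cq2 : cont2 q2).
  { unfold q2; apply cont2_plus; [apply cont2_plus; [apply cont2_plus; [trivial|]|]|cont2_tac].
    - exact (cont2_mult _ _ cQx cU1).
    - cont2_tac. }
  destruct (cont2_bounded dv a b c d) as (M & hM & bdv); try lra; trivial.
  destruct (affine_density_bound al be ga a b c d) as (CL & hCL & bL); try lra; trivial.
  set (D := D1 + D2).
  set (Cd := 4 * D ^ 2 + 2 * D + 2).
  assert (hD : 0 <= D) by (unfold D; lra).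
  assert (hCd : 0 < Cd) by (unfold Cd; nra).
  set (A0 := C1 + C2 + M).
  assert (hA0 : 0 <= A0) by (unfold A0; lra).
  set (N := fun x y => sqrt (gradP u x y ^ 2 + gradQ u x y ^ 2)).
  set (h := fun s x y => sqrt (n1 s x y ^ 2 + n2 s x y ^ 2)).
  assert (cN : cont2 N).
  { apply cont2_sqrt; [|cont2_tac].
    intros; apply Rplus_le_le_0_compat; apply pow2_ge_0. }
  assert (ch : forall s, cont2 (h s)).
  { intros s; apply cont2_sqrt; [|specialize (cn1 s); specialize (cn2 s); cont2_tac].
    intros; apply Rplus_le_le_0_compat; apply pow2_ge_0. }
  assert (area0 : RInt2 (h 0) a b c d = RInt2 N a b c d).
  { apply RInt2_ext; try lra; intros x y hx hy; unfold h, N.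
    assert (hK : a <= x <= b /\ c <= y <= d) by lra.
    assert (h0 : Rabs 0 <= 1) by (rewrite Rabs_R0; lra).
    specialize (f1 0 x y h0 hK); specialize (f2 0 x y h0 hK).
    rewrite Rabs_R0, Rmult_0_r in f1, f2.
    apply Rabs_le_between in f1; apply Rabs_le_between in f2.
    replace (n1 0 x y) with (gradP u x y) by lra.
    replace (n2 0 x y) with (gradQ u x y) by lra; reflexivity. }
  set (Kr := (b - a) * (d - c)).
  assert (hKr : 0 < Kr) by (apply Rmult_lt_0_compat; lra).
  (* [eta] is a free parameter, fixed later in terms of eps before s is made small. *)
  assert (main : forall s eta, s <> 0 -> Rabs s <= 1 -> 0 < eta ->
    Rabs (RInt2 (h s) a b c d - RInt2 N a b c d)
    <= Rabs s * (Cd * eta * Kr + Rabs s * (A0 * Kr + Cd / (4 * eta) * CL))).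
  { intros s eta hs0 hs1 heta.
    set (S := Rabs s).
    assert (hS : 0 < S) by (apply Rabs_pos_lt; trivial).
    assert (eS : S ^ 2 = s ^ 2) by apply pow2_abs.
    set (R := reg_norm (gradP u) (gradQ u) S).
    assert (hR : forall x y, 0 < R x y) by (intros; apply reg_norm_pos; trivial).
    assert (cR : cont2 R) by (apply reg_norm_cont; trivial).
    (* The term S^2 dv completes the integrand to an exact divergence, so [W] has integral 0. Since
       S <= R, it adds at most M S^2 to s W. *)
    set (W := fun x y => (gradP u x y * q1 x y + gradQ u x y * q2 x y + S ^ 2 * dv x y) / R x y).
    assert (cW : cont2 W).
    { apply cont2_div; trivial; [cont2_tac|intros; apply Rgt_not_eq, hR]. }
    assert (zW : RInt2 W a b c d = 0).
    { apply (reg_norm_divergence _ _ _ _ _ _ phi phix phiy U1 U1x U1y U2 U2x U2y S a b c d);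
        trivial; try lra;
        try (intros z; unfold phi; split; trivial;
             rewrite ?a1, ?a2, ?a3, ?b1, ?b2, ?b3, ?c1, ?c2, ?c3, ?d1, ?d2, ?d3; ring).
      intros x y; unfold reg_div; rewrite heq, htr; unfold Rdiv; ring. }
    replace (RInt2 (h s) a b c d - RInt2 N a b c d)
      with (RInt2 (fun x y => h s x y - N x y - s * W x y) a b c d).
    2:{ rewrite RInt2_minus, RInt2_minus, RInt2_scal, zW; try lra; trivial; cont2_tac; trivial. }
    set (aff := fun x y => s ^ 2 / ((al * x + be * y + ga) ^ 2 + s ^ 2)).
    assert (caff : cont2 aff) by (apply affine_density_cont; trivial).
    apply Rle_trans with (RInt2 (fun x y => (A0 * S ^ 2 + Cd * S * eta)
      + Cd * S / (4 * eta) * aff x y) a b c d).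
    - apply RInt2_abs_le; try lra; [specialize (ch s); cont2_tac; trivial|cont2_tac|].
      intros x y hx hy.
      assert (hK : a <= x <= b /\ c <= y <= d) by lra.
      specialize (f1 s x y hs1 hK); specialize (f2 s x y hs1 hK);
        specialize (e1 s x y hs1 hK); specialize (e2 s x y hs1 hK); specialize (bdv x y hK).
      fold (q1 x y) in e1; fold (q2 x y) in e2; fold S in f1, f2.
      set (p := n1 s x y - gradP u x y) in *; set (q := n2 s x y - gradQ u x y) in *.
      specialize (hR x y).
      destruct (Rabs_le_reg_norm (gradP u) (gradQ u) S x y hS) as (hPR & hQR & hSR).
      fold (R x y) in hPR, hQR, hSR.
      assert (k1 : Rabs (h s x y - N x y - (gradP u x y * p + gradQ u x y * q) / R x y)
        <= Cd * S ^ 2 / R x y).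
      { pose proof (norm_expansion (gradP u x y) (gradQ u x y) p q D s hs0 hD) as k.
        unfold h, N, Cd, R, reg_norm.
        replace (n1 s x y) with (gradP u x y + p) by (unfold p; ring).
        replace (n2 s x y) with (gradQ u x y + q) by (unfold q; ring).
        rewrite eS; apply k; fold S;
          (eapply Rle_trans; [eassumption|apply Rmult_le_compat_r; unfold D; lra]). }
      (* Replacing the increment (p, q) by s (q1, q2) makes an O(s^2) error; the weights V / R are
         at most 1, so no power of s is lost near the zeros. *)
      assert (k2 : Rabs ((gradP u x y * p + gradQ u x y * q) / R x y - s * W x y)
        <= A0 * S ^ 2).
      { set (p' := p - s * q1 x y) in *; set (q' := q - s * q2 x y) in *.
        replace ((gradP u x y * p + gradQ u x y * q) / R x y - s * W x y)
          with ((gradP u x y * p' + gradQ u x y * q' + - (S ^ 2 * (s * dv x y))) / R x y)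
          by (unfold W, p', q'; field; lra).
        unfold Rdiv; rewrite Rabs_mult, (Rabs_right (/ R x y))
          by (apply Rle_ge, Rlt_le, Rinv_0_lt_compat; trivial).
        apply (Rmult_le_reg_r (R x y)); trivial.
        rewrite Rmult_assoc, Rinv_l, Rmult_1_r by lra.
        eapply Rle_trans; [apply Rabs_triang|].
        eapply Rle_trans; [apply Rplus_le_compat_r, Rabs_triang|].
        rewrite Rabs_Ropp, !Rabs_mult.
        rewrite (Rabs_right (S ^ 2)) by (apply Rle_ge, pow2_ge_0); fold S.
        rewrite <- eS in e1, e2.
        assert (Rabs (gradP u x y) * Rabs p' <= R x y * (C1 * S ^ 2))
          by (apply Rmult_le_compat; trivial; apply Rabs_pos).
        assert (Rabs (gradQ u x y) * Rabs q' <= R x y * (C2 * S ^ 2))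
          by (apply Rmult_le_compat; trivial; apply Rabs_pos).
        assert (S * Rabs (dv x y) <= R x y * M)
          by (apply Rmult_le_compat; trivial; [lra|apply Rabs_pos]).
        assert (S ^ 2 * (S * Rabs (dv x y)) <= S ^ 2 * (R x y * M))
          by (apply Rmult_le_compat_l; [apply pow2_ge_0|trivial]).
        unfold A0; lra. }
      (* AM-GM: S / R <= eta + (S / R)^2 / (4 eta) *)
      assert (k3 : S ^ 2 / R x y <= S * eta + S / (4 * eta) * aff x y).
      { assert (g1 : S / R x y <= eta + (S / R x y) ^ 2 / (4 * eta)).
        { set (t := S / R x y).
          apply (Rmult_le_reg_r (4 * eta)); [lra|].
          replace ((eta + t ^ 2 / (4 * eta)) * (4 * eta)) with (4 * eta ^ 2 + t ^ 2)
            by (field; lra).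
          assert (0 <= (2 * eta - t) ^ 2) by apply pow2_ge_0; nra. }
        assert (g2 : (S / R x y) ^ 2 <= aff x y).
        { unfold aff; rewrite <- eS.
          replace ((S / R x y) ^ 2) with (S ^ 2 / R x y ^ 2) by (field; lra).
          apply Rmult_le_compat_l; [apply pow2_ge_0|].
          apply Rinv_le_contravar.
          - pose proof (pow2_ge_0 (al * x + be * y + ga)); pose proof (pow_lt S 2 hS); lra.
          - unfold R; rewrite reg_norm_sq; specialize (hge x y); lra. }
        replace (S ^ 2 / R x y) with (S * (S / R x y)) by (field; lra).
        replace (S * eta + S / (4 * eta) * aff x y)
          with (S * (eta + aff x y / (4 * eta))) by (field; lra).
        apply Rmult_le_compat_l; [lra|].
        eapply Rle_trans; [apply g1|apply Rplus_le_compat_l].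
        apply Rmult_le_compat_r; [|trivial].
        apply Rlt_le, Rinv_0_lt_compat; lra. }
      replace (h s x y - N x y - s * W x y) with
        ((h s x y - N x y - (gradP u x y * p + gradQ u x y * q) / R x y)
         + ((gradP u x y * p + gradQ u x y * q) / R x y - s * W x y)) by ring.
      eapply Rle_trans; [apply Rabs_triang|].
      assert (Cd * (S ^ 2 / R x y) <= Cd * (S * eta + S / (4 * eta) * aff x y))
        by (apply Rmult_le_compat_l; lra).
      unfold Rdiv in *; lra.
    - rewrite RInt2_plus, RInt2_const, RInt2_scal; try lra; trivial;
        [|apply cont2_const|cont2_tac].
      specialize (bL s hs0); fold aff S in bL.
      assert (0 < Cd * S / (4 * eta)) by (apply Rdiv_lt_0_compat; [apply Rmult_lt_0_compat; trivial|lra]).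
      assert (Cd * S / (4 * eta) * RInt2 aff a b c d <= Cd * S / (4 * eta) * (CL * S))
        by (apply Rmult_le_compat_l; [lra|exact bL]).
      unfold Kr.
      replace (S * (Cd * eta * ((b - a) * (d - c))
        + S * (A0 * ((b - a) * (d - c)) + Cd / (4 * eta) * CL))) with
        ((b - a) * ((d - c) * (A0 * S ^ 2 + Cd * S * eta)) + Cd * S / (4 * eta) * (CL * S))
        by (field; lra).
      lra. }
  apply is_derive_Reals; intros eps heps.
  (* The [eta] term then takes exactly eps / 4, and the term with a further factor |s| at most
     another eps / 4. *)
  set (eta := eps / (4 * (Cd * Kr))).
  assert (hCK : 0 < Cd * Kr) by (apply Rmult_lt_0_compat; trivial).
  assert (heta : 0 < eta) by (apply Rdiv_lt_0_compat; lra).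
  set (B := A0 * Kr + Cd / (4 * eta) * CL + 1).
  assert (hB : 0 < B).
  { unfold B; assert (0 <= A0 * Kr) by (apply Rmult_le_pos; lra).
    assert (0 <= Cd / (4 * eta) * CL).
    { apply Rmult_le_pos; trivial; apply Rlt_le, Rdiv_lt_0_compat; lra. }
    lra. }
  assert (hdel : 0 < Rmin 1 (eps / (4 * B)))
    by (apply Rmin_pos; [lra|apply Rdiv_lt_0_compat; lra]).
  exists (mkposreal _ hdel); simpl; intros s hs hsd.
  assert (hs1 : Rabs s <= 1) by (pose proof (Rmin_l 1 (eps / (4 * B))); lra).
  assert (hs2 : Rabs s <= eps / (4 * B)) by (pose proof (Rmin_r 1 (eps / (4 * B))); lra).
  rewrite Rplus_0_l, Rminus_0_r, !harea.
  fold (h s) (h 0); rewrite area0.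
  specialize (main s eta hs hs1 heta).
  unfold Rdiv; rewrite Rabs_mult, Rabs_inv.
  assert (hS : 0 < Rabs s) by (apply Rabs_pos_lt; trivial).
  apply (Rmult_lt_reg_r (Rabs s)); trivial.
  rewrite Rmult_assoc, Rinv_l, Rmult_1_r by lra.
  eapply Rle_lt_trans; [apply main|].
  rewrite (Rmult_comm eps); apply Rmult_lt_compat_l; trivial.
  assert (g1 : Cd * eta * Kr = eps / 4) by (unfold eta; field; split; lra).
  assert (g2 : Rabs s * (A0 * Kr + Cd / (4 * eta) * CL) <= eps / 4).
  { apply Rle_trans with (Rabs s * B); [apply Rmult_le_compat_l; unfold B; lra|].
    replace (eps / 4) with (eps / (4 * B) * B) by (field; lra).
    apply Rmult_le_compat_r; lra. }
  lra.
Qed.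

Lemma has_grad_functions {f fx fy} : has_grad f fx fy -> dx f = fx /\ dy f = fy.
Proof.
  intros h; split; apply functional_extensionality; intros x;
    apply functional_extensionality; intros y;
    [eapply has_grad_dx, h|eapply has_grad_dy, h].
Qed.

Lemma has_grad_affine al be ga :
  has_grad (fun x y => al * x + be * y + ga) (fun _ _ => al) (fun _ _ => be).
Proof.
  generalize (has_grad_plus
    (has_grad_plus (has_grad_scal al has_grad_fst)
      (has_grad_scal be has_grad_snd)) (has_grad_const ga)).
  apply has_grad_ext; intros; ring.
Qed.

Lemma plane_stationary u :
  C2 u -> nonvertical_plane (graph u) -> area_stationary (graph_param u).
Proof.
  intros hu (al & be & ga & de & hga & h).
  assert (e : u = fun x y => (- al / ga) * x + (- be / ga) * y + de / ga).
  { apply functional_extensionality; intros x; apply functional_extensionality; intros y.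
    pose proof (proj1 (h (x, y, u x y)) eq_refl) as k.
    unfold cx, cy, ct in k; simpl in k; rewrite <- k; field; trivial. }
  destruct (has_grad_functions (has_grad_affine (- al / ga) (- be / ga) (de / ga)))
    as [ex ey]; rewrite <- e in ex, ey.
  destruct (has_grad_functions (has_grad_const (- al / ga))) as [exx exy].
  destruct (has_grad_functions (has_grad_const (- be / ga))) as [eyx eyy].
  rewrite <- ex in exx, exy; rewrite <- ey in eyx, eyy.
  (* For a plane V is (- y, x) up to a constant vector; its second component alone, x - be / ga, is
     an affine lower bound for |V|. *)
  apply (stationary_sufficient u 1 0 (- be / ga)); trivial.
  - intros; rewrite exx, eyy; ring.
  - intros; rewrite exx, exy, eyx, eyy; ring.
  - left; lra.
  - intros; unfold gradP, gradQ; rewrite ex, ey.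
    pose proof (pow2_ge_0 (- al / ga - y)).
    replace (1 * x + 0 * y + - be / ga) with (- be / ga + x) by ring; lra.
Qed.

(** Here V = f Jn with n = (cos th, sin th) and f = 2 <n, (x, y)> + a. The trace of DV is the
    derivative of f along Jn, which is 0; the equation holds because V keeps the direction Jn, and
    |V| = |f| supplies the affine lower bound. *)
Lemma rotated_saddle_stationary u th a b :
  C2 u -> (forall x y, u x y = rotated_saddle th a b x y) ->
  area_stationary (graph_param u).
Proof.
  intros hu h.
  pose proof (sin2_cos2 th) as hsc; unfold Rsqr in hsc.
  set (s := sin th) in *; set (c := cos th) in *.
  assert (hg : has_grad u
    (fun x y => (- 2 * c * s) * x + (c * c - s * s) * y + - (a * s))
    (fun x y => (c * c - s * s) * x + (2 * c * s) * y + a * c)).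
  { generalize (has_grad_plus
      (has_grad_mult (has_grad_affine c s a) (has_grad_affine (- s) c 0))
      (has_grad_affine 0 0 b)).
    apply has_grad_ext; intros; [rewrite h; unfold rotated_saddle; fold s c| |]; ring. }
  destruct (has_grad_functions hg) as [ex ey].
  destruct (has_grad_functions (has_grad_affine (- 2 * c * s) (c * c - s * s) (- (a * s))))
    as [exx exy].
  destruct (has_grad_functions (has_grad_affine (c * c - s * s) (2 * c * s) (a * c)))
    as [eyx eyy].
  rewrite <- ex in exx, exy; rewrite <- ey in eyx, eyy.
  assert (eP : forall x y, gradP u x y = - s * (2 * c * x + 2 * s * y + a)).
  { intros x y; unfold gradP; rewrite ex.
    transitivity (- 2 * c * s * x + (c * c - s * s) * y + - (a * s)
      - (s * s + c * c) * y); [rewrite hsc|]; ring. }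
  assert (eQ : forall x y, gradQ u x y = c * (2 * c * x + 2 * s * y + a)).
  { intros x y; unfold gradQ; rewrite ey.
    transitivity ((c * c - s * s) * x + 2 * c * s * y + a * c
      + (s * s + c * c) * x); [rewrite hsc|]; ring. }
  apply (stationary_sufficient u (2 * c) (2 * s) a); trivial.
  - intros; rewrite exx, eyy; ring.
  - intros; rewrite eP, eQ, exx, exy, eyx, eyy; ring.
  - destruct (Req_dec c 0) as [e|]; [right|left; lra].
    intros e'; assert (s = 0) by lra; rewrite e, H in hsc; lra.
  - intros x y; rewrite eP, eQ; right.
    set (f := 2 * c * x + 2 * s * y + a).
    transitivity ((s * s + c * c) * f ^ 2); [rewrite hsc|]; ring.
Qed.

Theorem theorem5p1 (u : R -> R -> R) (hu : C2 u) :
  area_stationary (graph_param u) <->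
  (nonvertical_plane (graph u) \/
   exists th a b : R,
     forall p : H1,
       graph u p <->
       image (rotation th) (graph (fun x y => x * y + (a * y + b))) p).
Proof.
  split.
  - intros hst; destruct (stationary_classification u hu hst) as [h|(th & a & b & h)];
      [left; trivial|right].
    exists th, a, b; apply rotated_saddle_image; trivial.
  - intros [h|(th & a & b & h)]; [apply plane_stationary; trivial|].
    apply (rotated_saddle_stationary u th a b hu), rotated_saddle_image, h.
Qed.
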